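(* Let $f:M\to M$ be a $C^1$ diffeomorphism of a compact Riemannian manifold $M$, and let $\Lambda\subseteq M$ be a locally maximal hyperbolic set. Then for every $x\in\Lambda$ (and every sufficiently small $\beta>0$), $$\overline{\dim}_B\big(W^u_\beta(f,x)\cap\Lambda\big)\le t^*,$$ where $t^*$ is the unique real number $t$ such that $P_\Lambda\big(f,-t\log m(D_\xi f|_{E^u(\xi)})\big)=0$.
   Context: A compact $f$-invariant set $\Lambda\subset M$ is a hyperbolic set if there are a continuous $Df$-invariant splitting $T_\Lambda M=E^s\oplus E^u$ and constants $C>0$, $0<\lambda<1$ with $\|D_xf^n(v)\|\le C\lambda^n\|v\|$ for $v\in E^s(x)$ and $\|D_xf^{-n}(v)\|\le C\lambda^n\|v\|$ for $v\in E^u(x)$, for all $x\in\Lambda$, $n\ge0$. It is locally maximal if there is a neighbourhood $U$ of $\Lambda$ with $\Lambda=\bigcap_{n\in\mathbb{Z}}f^n(U)$. For $x\in\Lambda$ and small $\beta>0$, $W_\beta^u(f,x)=\{y\in M: d(f^{-n}(x),f^{-n}(y))\le\beta\ \forall n\ge0\}$. $\overline{\dim}_B$ is upper box dimension. For a linear map $A$ between normed spaces, $m(A)=\inf_{u\ne0}\|Au\|/\|u\|$ is its minimum norm. For a continuous function $\phi:\Lambda\to\mathbb{R}$, $P_\Lambda(f,\phi)$ is the topological pressure of $\phi$ with respect to $f|_\Lambda$: $$P_\Lambda(f,\phi)=\lim_{\varepsilon\to0}\limsup_{n\to\infty}\frac1n\log\sup\Big\{\sum_{x\in F}e^{\sum_{k=0}^{n-1}\phi(f^kx)}: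 F\subset\Lambda\ \text{is } (n,\varepsilon)\text{-separated}\Big\},$$ where $F$ is $(n,\varepsilon)$-separated if $\max_{0\le k\le n-1}d(f^kx,f^ky)>\varepsilon$ for all distinct $x,y\in F$. In the claim the potential is the function $\xi\mapsto-t\log m(D_\xi f|_{E^u(\xi)})$ on $\Lambda$.
   Formalization: As written the claim can fail, since the hyperbolicity constant C may exceed 1 (t* may be negative or not exist); the bound is proved whenever the unique zero t* exists and is at least 0, and existence and uniqueness of t* are proved when m(D_ξf|E^u(ξ)) > 1 on Λ. *)

(* Defs.v *)
(* MathComp-Analysis *)
From HB Require Import structures.
From mathcomp Require Import all_boot all_order all_algebra.
From mathcomp Require Import all_classical all_reals all_analysis.

Set Implicit Arguments.
Unset Strict Implicit.
Unset Printing Implicit Defensive.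

Import Order.TTheory GRing.Theory Num.Theory.
Import numFieldNormedType.Exports.

Local Open Scope classical_set_scope.
Local Open Scope ring_scope.

(* [f] is of class C^k at the points of [U], which is meant to be open. *)
Fixpoint class_C (R : realType) (V W : normedModType R) (k : nat)
    (U : set V) (f : V -> W) {struct k} : Prop :=
  match k with
  | 0%N => forall x, U x -> {for x, continuous f}
  | k'.+1 => (forall x, U x -> differentiable f x) /\
             (forall v, class_C k' U (fun x => 'D_v f x))
  end.

(* A smooth [n]-dimensional manifold without boundary.  The chart [i] is the
   homeomorphism [chart i] from the open set [chart_dom i] onto an open subset
   of R^n, with inverse [chart_inv i]; outside of these sets the values of
   [chart i] and [chart_inv i] are irrelevant.  Second countability is not
   listed: it is automatic for compact [M]. *)
Record smooth_manifold (R : realType) (n : nat) (M : topologicalType) := {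
  chart_index : Type;
  chart_dom : chart_index -> set M;
  chart : chart_index -> M -> 'rV[R]_n;
  chart_inv : chart_index -> 'rV[R]_n -> M;
  chart_at : M -> chart_index;
  manifold_hausdorff : hausdorff_space M;
  chart_atP : forall p, chart_dom (chart_at p) p;
  chart_dom_open : forall i, open (chart_dom i);
  chart_img_open : forall i, open (chart i @` chart_dom i);
  chartK : forall i p, chart_dom i p -> chart_inv i (chart i p) = p;
  chart_continuous : forall i p, chart_dom i p -> {for p, continuous (chart i)};
  chart_inv_continuous : forall i u, (chart i @` chart_dom i) u ->
    {for u, continuous (chart_inv i)};
  chart_transition : forall i j k,
    class_C k (chart i @` (chart_dom i `&` chart_dom j))
      (chart j \o chart_inv i)
}.

Section Manifold.
Context {R : realType} {n : nat} {M : topologicalType}.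
Variable S : smooth_manifold R n M.

(* The tangent space T_p M is represented by R^n: a tangent vector at [p] is
   given by its components in the preferred chart [chart_at S p].
   [to_chart i p] and [of_chart i p] convert these components to, and from, the
   components in another chart [i] around [p]. *)
Definition to_chart (i : chart_index S) (p : M) (v : 'rV[R]_n) : 'rV[R]_n :=
  'd (chart i \o chart_inv (chart_at S p)) (chart (chart_at S p) p) v.

Definition of_chart (i : chart_index S) (p : M) (v : 'rV[R]_n) : 'rV[R]_n :=
  'd (chart (chart_at S p) \o chart_inv i) (chart i p) v.

Definition C1_map (f : M -> M) : Prop :=
  continuous f /\
  forall i j : chart_index S,
    class_C 1 (chart i @` (chart_dom i `&` f @^-1` chart_dom j))
      (chart j \o f \o chart_inv i).

Definition C1_diffeo (f finv : M -> M) : Prop :=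
  [/\ cancel f finv, cancel finv f, C1_map f & C1_map finv].

(* [tangent_map f p] is D_p f : T_p M -> T_(f p) M. *)
Definition tangent_map (f : M -> M) (p : M) (v : 'rV[R]_n) : 'rV[R]_n :=
  'd (chart (chart_at S (f p)) \o f \o chart_inv (chart_at S p))
    (chart (chart_at S p) p) v.

Record riemannian_metric := {
  rform : M -> 'rV[R]_n -> 'rV[R]_n -> R;
  rform_linear : forall p w, linear (fun v => rform p v w : R^o);
  rform_sym : forall p v w, rform p v w = rform p w v;
  rform_gt0 : forall p v, v != 0 -> 0 < rform p v v;
  rform_smooth : forall (i : chart_index S) v w k,
    class_C k (chart i @` chart_dom i)
      (fun u => rform (chart_inv i u) (of_chart i (chart_inv i u) v)
                                      (of_chart i (chart_inv i u) w) : R^o)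
}.

Definition C1_curve (c : R -> M) : Prop :=
  continuous c /\
  forall i : chart_index S,
    @class_C R R^o 'rV[R]_n 1 (c @^-1` chart_dom i) (chart i \o c).

Definition velocity (c : R -> M) (s : R) : 'rV[R]_n :=
  derive1 (chart (chart_at S (c s)) \o c) s.

Variable g : riemannian_metric.

Definition rnorm (p : M) (v : 'rV[R]_n) : R := Num.sqrt (rform g p v v).

Definition curve_length (c : R -> M) : \bar R :=
  (\int[lebesgue_measure]_(s in `[0%R, 1%R]) (rnorm (c s) (velocity c s))%:E)%E.

(* [M] is not assumed connected, so that the distance may be [+oo]. *)
Definition rdist (x y : M) : \bar R :=
  ereal_inf [set curve_length c | c in
    [set c : R -> M | [/\ C1_curve c, c 0 = x & c 1 = y]]].

(* A continuous subbundle of the restriction of TM to [L]: it admits, around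
   each point of [L], a frame of vector fields that are continuous on [L]. *)
Definition continuous_subbundle (L : set M) (E : M -> {vspace 'rV[R]_n}) :=
  forall p, L p ->
  exists (V : set M) (k : nat) (X : 'I_k -> M -> 'rV[R]_n),
    [/\ nbhs p V, V `<=` chart_dom (chart_at S p),
        forall q, (V `&` L) q -> basis_of (E q) [tuple X j q | j < k]
      & forall j, {within V `&` L, continuous
                    (fun q => to_chart (chart_at S p) q (X j q))}].

Definition Df_invariant (f : M -> M) (L : set M) (E : M -> {vspace 'rV[R]_n}) :=
  forall p, L p -> tangent_map f p @` [set` E p] = [set` E (f p)].

(* [L] is a hyperbolic set of the diffeomorphism [f], whose inverse is [finv],
   with hyperbolic splitting [Es], [Eu]. *)
Definition hyperbolic_set (f finv : M -> M) (L : set M)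
    (Es Eu : M -> {vspace 'rV[R]_n}) : Prop :=
  [/\ compact L, f @` L = L,
      forall p, L p -> (Es p + Eu p = fullv)%VS /\ (Es p :&: Eu p = 0)%VS,
      [/\ continuous_subbundle L Es, continuous_subbundle L Eu,
          Df_invariant f L Es & Df_invariant f L Eu]
    & exists C lambda : R,
      [/\ 0 < C, 0 < lambda < 1,
          forall p k v, L p -> v \in Es p ->
            rnorm (iter k f p) (tangent_map (iter k f) p v)
              <= C * lambda ^+ k * rnorm p v
        & forall p k v, L p -> v \in Eu p ->
            rnorm (iter k finv p) (tangent_map (iter k finv) p v)
              <= C * lambda ^+ k * rnorm p v]].

Definition iterz (f finv : M -> M) (k : int) : M -> M :=
  match k with Posz m => iter m f | Negz m => iter m.+1 finv end.

Definition locally_maximal (f finv : M -> M) (L : set M) : Prop :=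
  exists2 U : set M, set_nbhs L U &
    L = \bigcap_(k in [set: int]) (iterz f finv k @` U).

Definition unstable_set (finv : M -> M) (beta : R) (x : M) : set M :=
  [set y | forall k : nat,
    (rdist (iter k finv x) (iter k finv y) <= beta%:E)%E].

(* Least number of closed [r]-balls covering [A]; [+oo] if there is no finite
   cover. *)
Definition covering_number (A : set M) (r : R) : \bar R :=
  ereal_inf [set (size s)%:R%:E | s in
    [set s : seq M |
      A `<=` [set y | exists2 x, x \in s & (rdist x y <= r%:E)%E]]].

Definition upper_box_dim (A : set M) : \bar R :=
  limf_esup (fun r : R => lne (covering_number A r) * ((- ln r)^-1)%:E)%E 0^'+.

(* The neutral element [0] is harmless, [rdist] being nonnegative. *)
Definition bowen_dist (f : M -> M) (k : nat) (x y : M) : \bar R :=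
  (\big[maxe/0]_(j < k) rdist (iter j f x) (iter j f y))%E.

Definition separated (f : M -> M) (k : nat) (eps : R) (F : set M) : Prop :=
  forall x y, F x -> F y -> x <> y -> (eps%:E < bowen_dist f k x y)%E.

Definition pressure_at (f : M -> M) (L : set M) (phi : M -> \bar R) (eps : R) :
    \bar R :=
  limn_esup (fun k : nat => (k%:R^-1)%:E * lne (ereal_sup
    [set \esum_(x in F) expeR (\sum_(j < k) phi (iter j f x)) | F in
      [set F : set M | F `<=` L /\ separated f k eps F]]))%E.

(* The potential may take infinite values; see [min_norm]. *)
Definition pressure (f : M -> M) (L : set M) (phi : M -> \bar R) : \bar R :=
  lim (pressure_at f L phi eps @[eps --> 0^'+]).

(* Minimum norm of D_p f restricted to [E].  As the infimum of the empty set it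
   is [+oo] when [E = 0], and the potential below is then [-oo], [0] or [+oo]
   for [t > 0], [t = 0] and [t < 0] respectively; otherwise both are finite. *)
Definition min_norm (f : M -> M) (p : M) (E : {vspace 'rV[R]_n}) : \bar R :=
  ereal_inf [set (rnorm (f p) (tangent_map f p v) / rnorm p v)%:E | v in
    [set v | v \in E /\ v != 0]].

Definition unstable_potential (f : M -> M) (Eu : M -> {vspace 'rV[R]_n})
    (t : R) (p : M) : \bar R :=
  ((- t)%:E * lne (min_norm f p (Eu p)))%E.

Definition unique_pressure_zero (f : M -> M) (L : set M)
    (Eu : M -> {vspace 'rV[R]_n}) (t : R) : Prop :=
  unique (fun s : R => pressure f L (unstable_potential f Eu s) = 0%E) t.

(* The Riemannian metric is adapted to the unstable bundle.  This can always be
   achieved by changing the metric, but the constant C of a hyperbolic set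
   allows metrics for which it fails. *)
Definition adapted_metric (f : M -> M) (L : set M)
    (Eu : M -> {vspace 'rV[R]_n}) : Prop :=
  forall p, L p -> (1 < min_norm f p (Eu p))%E.

End Manifold.

(* Main.v *)
(* Local product coordinates are replaced by displacements: tangent vectors at
   p that describe nearby points q up to bi-Lipschitz distortion. If q stays
   close to p in backward time, a cone argument in Lyapunov norms shows that
   the displacement from p to q is almost in E^u(p), so that f expands it by
   almost m(Df|E^u(p)). Hence two points y, z of W^u(x) /\ L whose orbits are
   close for k steps satisfy d(y, z) <= K exp (- B_k(y)), where B_k is the
   Birkhoff sum of log m, minus a small multiple of k. Given tau, cover W^u(x)
   /\ L by Bowen balls whose length k(y) is the first k with B_k(y) >= tau:
   their radii are about exp (- tau), and if the pressure of - t log m is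
   negative, the total weight sum exp (- t B_k(y)) of a separated set is
   summable in k, so there are at most C exp (t tau) of them. For t > t0 > 0,
   t0 the zero, the pressure is negative: on a single orbit P(t0) = 0 bounds -
   t0 B_k by o(k), hence P(t) <= 0, and the zero is unique. If t0 = 0, the
   entropy vanishes, and the crude contraction rate of the hyperbolic set
   suffices.

   When the metric is adapted, the pressure is strictly decreasing in t, with
   slope between - log K and - log mu, where mu > 1 and K bound m from below
   and above. Points with E^u = 0, where the potential is infinite, form a
   forward stable set whose separated subsets have bounded cardinality, and
   thus do not contribute. *)
Require Import Defs.
From HB Require Import structures.
From mathcomp Require Import all_boot all_order all_algebra.
From mathcomp Require Import all_classical all_reals all_analysis.
From mathcomp Require Import ring lra.
Import Order.TTheory GRing.Theory Num.Theory.
Import numFieldNormedType.Exports measurable_realfun.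
Local Open Scope classical_set_scope.
Local Open Scope ring_scope.

Set Implicit Arguments.
Unset Strict Implicit.
Unset Printing Implicit Defensive.

(** * Charts, tangent maps and norms *)

(** The distance is an infimum of lengths of C^1 curves, and two such curves cannot simply be
    concatenated. Symmetry and the triangle inequality are therefore replaced by local comparison
    with charts, valid up to constants. Such a constant may be lost once, when a distance is turned
    into a displacement or back, but not at every step of an orbit; so all iteration takes place in
    norms of tangent vectors.

    Tangent components at [p] refer to a preferred chart that may jump with [p]. Continuity is hence
    always tested in a fixed chart, and uniformity comes from compactness of [M] and of the unit
    sphere.

    A displacement is based at a point of [L] and split by the splitting at that point, the second
    point being arbitrary. In the same way the estimate for d(y, z) involves the minimum norms along
    the orbit of y alone, and Birkhoff sums at y and z are never compared with each other. *)

Section LocalCalculus.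
Context {R : realType}.
Implicit Types V W : normedModType R.

Lemma cvg_to_eq (T : Type) (U : topologicalType) (F : set_system T) (f : T -> U) (a b : U) :
  a = b -> f @ F --> a -> f @ F --> b.
Proof. by move=> ->. Qed.

Lemma near_eq_diff V W (f g : V -> W) x :
  (\forall y \near x, f y = g y) -> differentiable f x ->
  differentiable g x /\ 'd g x = 'd f x :> (V -> W).
Proof.
move=> fg df.
have E : g \o shift x = cst (g x) + 'd f x +o_ 0 id.
  apply/eqaddoP => _/posnumP[e].
  have /diff_locallyP[_ /eqaddoP/(_ e%:num (gt0 e))] := df.
  have fg0 : \forall y \near (0 : V), f (y + x) = g (y + x).
    by have := fg; rewrite (near_shift 0 x); apply: filterS => y /=; rewrite subr0.
  have fgx := nbhs_singleton fg.
  apply: filterS2 fg0 => y E.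
  by rewrite /= -![(_ - _) y]/(_ - _) -![(_ + _) y]/(_ + _) /= E fgx.
have dgf : 'd g x = 'd f x :> (V -> W) by apply: diff_unique => //; exact: diff_continuous.
split=> //; apply/diff_locallyP; split; first by rewrite dgf; exact: diff_continuous.
by rewrite dgf.
Qed.

(** The pointwise form of [class_C 1], which passes to maps that agree nearby and to compositions
    without bookkeeping of open domains. *)
Definition c1_at V W (h : V -> W) (u : V) :=
  (\forall u' \near u, differentiable h u') /\
  forall v, {for u, continuous (fun x => 'D_v h x)}.

Lemma class_C1P V W (U : set V) (h : V -> W) : open U ->
  class_C 1 U h <-> forall u, U u -> c1_at h u.
Proof.
move=> oU; split=> [[dh ch] u Uu|H].
  split; first by apply: filterS (open_nbhs_nbhs (conj oU Uu)).
  by move=> v; exact: ch.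
split=> [u /H[/nbhs_singleton//]|v u /H[_]]; exact.
Qed.

Lemma c1_at_continuous V W (h : V -> W) u : c1_at h u -> {for u, continuous h}.
Proof. by move=> [/nbhs_singleton/differentiable_continuous]. Qed.

Lemma c1_at_near_eq V W (f g : V -> W) x :
  (\forall y \near x, f y = g y) -> c1_at f x -> c1_at g x.
Proof.
move=> fg [df cf]; have fgj := near_join fg; split.
  by apply: filterS2 fgj df => y fgy dfy; exact: (near_eq_diff fgy dfy).1.
move=> v; have E : 'D_v g x = 'D_v f x.
  by apply/esym; exact: near_eq_derive.
change ('D_v g y @[y --> x] --> 'D_v g x); rewrite E; apply: cvg_trans (cf v); apply: near_eq_cvg.
by apply: filterS fgj => y fgy; exact: near_eq_derive.
Qed.

Lemma diff_rVE n W (h : 'rV[R]_n -> W) u w : differentiable h u ->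
  'd h u w = \sum_(j < n) w 0 j *: 'D_(delta_mx 0 j) h u.
Proof.
move=> dh; rewrite {1}(row_sum_delta w) linear_sum.
by apply: eq_bigr => j _; rewrite linearZ deriveE.
Qed.

(** In finite dimension the differential is a finite sum of coordinates times directional
    derivatives, so continuity of the latter at [u0] gives continuity jointly in base point and
    vector. *)
Lemma diff_joint_cvg n W (h : 'rV[R]_n -> W) u0 w0 T (F : set_system T)
    (FF : Filter F) (a b : T -> 'rV[R]_n) :
  c1_at h u0 -> a @ F --> u0 -> b @ F --> w0 ->
  'd h (a z) (b z) @[z --> F] --> 'd h u0 w0.
Proof.
move=> [dh ch] au bw; have E := diff_rVE w0 (nbhs_singleton dh).
have C : (fun z => \sum_(j < n) b z 0 j *: 'D_(delta_mx 0 j) h (a z)) @ F -->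
    \sum_(j < n) w0 0 j *: 'D_(delta_mx 0 j) h u0.
  apply: cvg_big => [|j _]; first exact: (@add_continuous W).
  apply: cvgZ.
    exact: (cvg_comp _ _ bw (@coord_continuous _ _ _ ord0 j w0)).
  exact: (cvg_comp _ _ au (ch (delta_mx 0 j))).
apply: (cvg_to_eq (esym E)); apply: cvg_trans C; apply: near_eq_cvg.
have dz : \forall z \near F, differentiable h (a z) := au _ dh.
by apply: filterS dz => z dz; apply/esym; exact: diff_rVE.
Qed.

Lemma c1_at_comp n V W (k : V -> 'rV[R]_n) (h : 'rV[R]_n -> W) u :
  c1_at k u -> c1_at h (k u) -> c1_at (h \o k) u.
Proof.
move=> ck ch; have kc := c1_at_continuous ck; split.
  have dh := kc _ (proj1 ch); have dk := proj1 ck.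
  near=> x; apply: differentiable_comp; [by near: x|by near: x].
move=> v; have dk := proj1 ck.
have dE x : differentiable k x -> differentiable h (k x) ->
    'D_v (h \o k) x = 'd h (k x) ('D_v k x).
  move=> dkx dhx; rewrite deriveE; last exact: differentiable_comp.
  by rewrite diff_comp//= deriveE.
have E := dE _ (nbhs_singleton dk) (nbhs_singleton (proj1 ch)).
have C : 'd h (k x) ('D_v k x) @[x --> u] --> 'd h (k u) ('D_v k u).
  by apply: diff_joint_cvg => //; exact: (proj2 ck).
apply: (cvg_to_eq (esym E)); apply: cvg_trans C; apply: near_eq_cvg.
apply: filterS2 dk (kc _ (proj1 ch)) => x dkx dhx.
by apply/esym; exact: dE.
Unshelve. all: by end_near. Qed.

Lemma normr_rVE n (w : 'rV[R]_n) j : `|w 0 j| <= `|w|.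
Proof.
rewrite [in leRHS]/Num.Def.normr/= mx_normrE.
by apply: le_trans (le_bigmax _ _ (ord0, j)).
Qed.

Lemma normr_rV_le n (w : 'rV[R]_n) e : 0 <= e ->
  (forall j, `|w 0 j| <= e) -> `|w| <= e.
Proof.
move=> e0 H; rewrite [in leLHS]/Num.Def.normr/= mx_normrE.
by apply: bigmax_le => // -[i j] _; rewrite /= ord1.
Qed.

Lemma is_diff_line V (u w : V) (s : R^o) :
  is_diff s (fun s : R^o => u + s *: w) (fun s : R^o => s *: w).
Proof.
have [A B] := is_diffD (is_diff_cst u s) (is_diff_scalel s w).
apply: DiffDef; first exact: A.
by apply: (eq_trans B); apply/funext => x; rewrite /= -[LHS]/(0 + _) add0r.
Qed.

Lemma diff_comp_app (U V W : normedModType R) (k : U -> V) (h : V -> W) x v :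
  differentiable k x -> differentiable h (k x) ->
  'd (h \o k) x v = 'd h (k x) ('d k x v).
Proof. by move=> dk dh; have := diff_comp dk dh => ->. Qed.

Lemma is_derive_line V W (h : V -> W) (u w : V) (s : R) :
  differentiable h (u + s *: w) ->
  is_derive (s : R^o) 1 (fun s : R^o => h (u + s *: w)) ('d h (u + s *: w) w).
Proof.
move=> dh; have [dk Ek] := is_diff_line u w (s : R^o).
have dhk := differentiable_comp dk dh.
apply: DeriveDef; first exact: diff_derivable dhk.
have E1 := deriveE (1 : R^o) dhk; have E2 := diff_comp_app (1 : R^o) dk dh.
have E3 : 'd (fun s : R^o => u + s *: w) (s : R^o) (1 : R^o) = w by rewrite Ek scale1r.
by rewrite E3 in E2; exact: (eq_trans E1 E2).
Qed.

Lemma ball_segment V (u0 u u' : V) (r s : R) : ball u0 r u -> ball u0 r u' ->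
  s \in `[0, 1] -> ball u0 r (u + s *: (u' - u)).
Proof.
rewrite in_itv/= => Bu Bu' /andP[s0 s1]; move: Bu Bu'; rewrite -!ball_normE /ball_/= => Bu Bu'.
have E1 : u + s *: (u' - u) = (1 - s) *: u + s *: u'.
  by rewrite scalerBl scale1r scalerBr addrA addrAC.
have E2 : u0 = (1 - s) *: u0 + s *: u0 by rewrite -scalerDl subrK scale1r.
rewrite E1 {1}E2 opprD addrACA -!scalerBr.
apply: le_lt_trans (ler_normD _ _) _; rewrite !normrZ (ger0_norm s0) ger0_norm ?subr_ge0//.
have [->|sn0] := eqVneq s 0; first by rewrite subr0 mul1r mul0r addr0.
have sp : 0 < s by rewrite lt0r sn0.
have -> : r = (1 - s) * r + s * r by ring.
by apply: ler_ltD; [rewrite ler_wpM2l ?subr_ge0// ltW|rewrite ltr_pM2l].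
Qed.

(** Both points are free near [u0]: by the mean value theorem on the segment, one coordinate at a
    time, the increment of [h] is close to ['d h u0], which in turn differs little from ['d h u]. *)
Lemma c1_strict_diff n m (h : 'rV[R]_n -> 'rV[R]_m) u0 e : c1_at h u0 -> 0 < e ->
  exists2 V, nbhs u0 V & forall u u', V u -> V u' ->
    `|h u' - h u - 'd h u (u' - u)| <= e * `|u' - u|.
Proof.
(* The error is shared among the [n] partial derivatives; adding 1 keeps [N] positive when [n] is
   0. *)
move=> [dh ch] e0; pose N := (n%:R + 1 : R).
have N0 : 0 < N by rewrite /N ltr_wpDl.
have eN0 : 0 < e / 2 / N by rewrite !divr_gt0.
have near1 : \forall u \near u0, differentiable h u /\
    forall j : 'I_n, `|'D_(delta_mx 0 j) h u - 'D_(delta_mx 0 j) h u0| <= e / 2 / N.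
  near=> u; split; first by near: u.
  near: u; apply: filter_forall => j; have /cvgrPdist_le/(_ _ eN0) := ch (delta_mx 0 j).
  by apply: filterS => u; rewrite distrC.
have near2 : \forall u \near u0, differentiable h u /\
    forall w, `|'d h u w - 'd h u0 w| <= e / 2 * `|w|.
  apply: filterS near1 => u [du Hu]; split=> // w.
  have E1 := diff_rVE w du; have E2 := diff_rVE w (nbhs_singleton dh).
  have := congr2 (fun a b => `|a - b|) E1 E2; rewrite -sumrB => ->.
  apply: le_trans (ler_norm_sum _ _ _) _.
  apply: (@le_trans _ _ (\sum_(j < n) (`|w| * (e / 2 / N)))).
    apply: ler_sum => j _; rewrite -scalerBr normrZ.
    by apply: ler_pM => //; exact: normr_rVE.
  rewrite sumr_const card_ord -[X in X <= _]mulr_natr.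
  have -> : `|w| * (e / 2 / N) * n%:R = e / 2 * `|w| * (n%:R / N) by ring.
  apply: ler_piMr; first by rewrite mulr_ge0// ltW// divr_gt0.
  by rewrite ler_pdivrMr// mul1r /N lerDl.
have /nbhs_ballP[r /= r0 Br] := near2.
exists (ball u0 r); first exact: nbhsx_ballx.
move=> u u' Bu Bu'.
set w := u' - u.
have Bs (s : R) : s \in `[0, 1] -> ball u0 r (u + s *: w).
  by move=> s01; apply: ball_segment.
have main : `|h u' - h u - 'd h u0 w| <= e / 2 * `|w|.
  apply: normr_rV_le; first by rewrite mulr_ge0// ltW// divr_gt0.
  move=> k.
  (* The [k]-th coordinate along the segment without its linear part at [u0], so that its derivative
     is small. *)
  pose phi (s : R) := (h (u + s *: w)) 0 k - s * ('d h u0 w) 0 k.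
  have dphi (s : R) : s \in `[0, 1] ->
      is_derive s 1 phi (('d h (u + s *: w) w) 0 k - ('d h u0 w) 0 k).
    move=> s01; have [dhs _] := Br _ (Bs _ s01).
    have dl := is_derive_line dhs.
    apply: is_deriveB.
      have [D1 D2] := dl; have /derivable_mxP/(_ 0 k) D3 := D1.
      by apply: DeriveDef => //; rewrite -D2 derive_mx// mxE.
    have := @is_deriveM _ _ (id : R -> R) (cst (('d h u0 w) 0 k)) s 1 1 0 _ _.
    by rewrite /GRing.scale/= mulr0 add0r mulr1; apply.
  have cphi : {within `[0, 1], continuous phi}.
    apply: derivable_within_continuous => s /dphi [] //.
  have dphio (s : R) : s \in `]0, 1[ ->
      is_derive s 1 phi (('d h (u + s *: w) w) 0 k - ('d h u0 w) 0 k).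
    by move=> s01; apply: dphi; move: s01; rewrite !in_itv/= => /andP[? ?]; rewrite !ltW.
  have [c c01 E] := MVT_segment (ler01 : (0:R) <= 1) dphio cphi.
  have [_ /(_ w)] := Br _ (Bs _ c01); move=> /(le_trans (normr_rVE _ k)).
  have Ew : u + w = u' by rewrite /w addrC subrK.
  move: E; rewrite subr0 mulr1 /phi scale1r scale0r addr0 mul1r mul0r subr0 Ew.
  by rewrite !mxE addrAC => ->.
have [_ /(_ w) Hu] := Br _ Bu.
have AB (X A B : 'rV[R]_m) : X - A = (X - B) - (A - B) by rewrite opprB addrA subrK.
have E := congr1 (fun X => `|X|) (AB (h u' - h u) ('d h u w) ('d h u0 w)).
rewrite [leLHS]E.
apply: le_trans (ler_normB _ _) _; apply: le_trans (lerD main Hu) _.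
by rewrite -mulrDl -splitr.
Unshelve. all: by end_near. Qed.

Lemma c1_strict_diff_eq n m (h : 'rV[R]_n -> 'rV[R]_m) u0 e : c1_at h u0 -> 0 < e ->
  exists2 V, nbhs u0 V & forall u u' a b, V u -> V u' -> h u = a -> h u' = b ->
    `|b - a - 'd h u (u' - u)| <= e * `|u' - u|.
Proof.
move=> ch e0; have [V Vn H] := c1_strict_diff ch e0.
by exists V => // u u' a b Vu Vu' <- <-; exact: H.
Qed.

End LocalCalculus.

(** * Differentials in charts and the Riemannian norm *)

Section ManifoldBasics.
Context {R : realType} {n : nat} {M : topologicalType}.
Variable S : smooth_manifold R n M.
Implicit Types (i j k : chart_index S) (p q : M) (u v w : 'rV[R]_n).

Lemma chart_dom_nbhs i p : chart_dom i p -> nbhs p (chart_dom i).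
Proof. by move=> ip; apply: open_nbhs_nbhs; split=> //; exact: chart_dom_open. Qed.

Lemma open_chart_image i (A : set M) : open A ->
  open (chart i @` (chart_dom i `&` A)).
Proof.
move=> oA; rewrite openE => _ [p [ip Ap] <-].
have iu : (chart i @` chart_dom i) (chart i p) by exists p.
have H1 := open_nbhs_nbhs (conj (@chart_img_open _ _ _ S i) iu).
have H2 : \forall u \near chart i p, A (chart_inv i u).
  apply: (chart_inv_continuous iu); apply: open_nbhs_nbhs; split => //.
  by rewrite chartK.
apply: filterS2 H1 H2 => _ [q iq <-]; rewrite chartK// => Aq.
by exists q.
Qed.

Lemma chart_inv_cvg i p : chart_dom i p -> chart_inv i u @[u --> chart i p] --> p.
Proof.
move=> ip; have := @chart_inv_continuous _ _ _ S i (chart i p).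
rewrite /prop_for /continuous_at chartK//; apply; by exists p.
Qed.

Definition chrep (h : M -> M) i j : 'rV[R]_n -> 'rV[R]_n := chart j \o h \o chart_inv i.

Lemma C1_mapP (h : M -> M) : C1_map S h <-> continuous h /\
  forall i j p, chart_dom i p -> chart_dom j (h p) -> c1_at (chrep h i j) (chart i p).
Proof.
have oA j : continuous h -> open (h @^-1` chart_dom j).
  by move=> hc; apply: open_comp => [x _|]; [exact: hc|exact: chart_dom_open].
split=> -[hc H]; split=> // i j.
  move=> p ip jhp; have := H i j; rewrite class_C1P; last exact/open_chart_image/oA.
  by apply; exists p.
rewrite class_C1P; last exact/open_chart_image/oA.
by move=> _ [p [ip jp] <-]; exact: H.
Qed.

Lemma C1_map_id : C1_map S id.
Proof.
split=> [p|i j]; first exact: cvg_id.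
exact: (@chart_transition _ _ _ S i j 1).
Qed.

Lemma chrep_comp (f h : M -> M) i k j p : {for p, continuous h} ->
  chart_dom i p -> chart_dom k (h p) ->
  \forall u \near chart i p, (chrep f k j \o chrep h i k) u = chrep (f \o h) i j u.
Proof.
move=> hc ip kp; have H : \forall u \near chart i p, chart_dom k (h (chart_inv i u)).
  exact: (cvg_comp _ _ (chart_inv_cvg ip) hc _ (chart_dom_nbhs kp)).
by apply: filterS H => u; rewrite /chrep/= => ku; rewrite chartK.
Qed.

Lemma chrep_at (h : M -> M) i k p : chart_dom i p -> chrep h i k (chart i p) = chart k (h p).
Proof. by move=> ip; rewrite /chrep/= chartK. Qed.

Lemma C1_map_comp (f h : M -> M) : C1_map S f -> C1_map S h -> C1_map S (f \o h).
Proof.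
move=> /C1_mapP[fc Hf] /C1_mapP[hc Hh]; apply/C1_mapP; split.
  by move=> p; exact: (continuous_comp (hc p) (fc _)).
move=> i j p ip jp; have kp := chart_atP S (h p).
apply: (c1_at_near_eq (chrep_comp f j (hc p) ip kp)).
apply: c1_at_comp; first exact: Hh.
by rewrite chrep_at//; exact: Hf.
Qed.

Lemma C1_map_iter (f : M -> M) m : C1_map S f -> C1_map S (iter m f).
Proof.
move=> fC; elim: m => [|m IH]; first exact: C1_map_id.
exact: (C1_map_comp fC IH).
Qed.

Lemma chrep_diff (h : M -> M) i j p : C1_map S h -> chart_dom i p ->
  chart_dom j (h p) -> differentiable (chrep h i j) (chart i p).
Proof. by move=> /C1_mapP[_ H] ip jp; have [/nbhs_singleton] := H _ _ _ ip jp. Qed.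

Lemma diff_chrep_comp (f h : M -> M) i k j p w : C1_map S f -> C1_map S h ->
  chart_dom i p -> chart_dom k (h p) -> chart_dom j (f (h p)) ->
  'd (chrep (f \o h) i j) (chart i p) w =
  'd (chrep f k j) (chart k (h p)) ('d (chrep h i k) (chart i p) w).
Proof.
move=> fC hC ip kp jp; have dh := chrep_diff hC ip kp; have df := chrep_diff fC kp jp.
have df' : differentiable (chrep f k j) (chrep h i k (chart i p)) by rewrite chrep_at.
have [hc _] := hC.
have [_ E] := near_eq_diff (chrep_comp f j (hc p) ip kp) (differentiable_comp dh df').
have E2 := diff_comp_app w dh df'.
have E3 := congr1 (fun F => F w) E; apply: (eq_trans E3); apply: (eq_trans E2).
exact: (congr1 (fun u => 'd (chrep f k j) u ('d (chrep h i k) (chart i p) w)) (chrep_at h k ip)).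
Qed.

Lemma diff_chrep_id i p w : chart_dom i p -> 'd (chrep id i i) (chart i p) w = w.
Proof.
move=> ip; have iu : (chart i @` chart_dom i) (chart i p) by exists p.
have H1 := open_nbhs_nbhs (conj (@chart_img_open _ _ _ S i) iu).
have H : \forall u \near chart i p, id u = chrep id i i u.
  by apply: filterS H1 => _ [q iq <-]; rewrite chrep_at.
have [A B] := is_diff_id (chart i p).
have [_ E] := near_eq_diff H A.
have E3 := congr1 (fun F => F w) E; apply: (eq_trans E3).
by have E4 := congr1 (fun F => F w) B.
Qed.

(** Both sides are the differential of [h] from chart [i] to the preferred chart at [h p], factored
    through the preferred chart at [p] or through chart [j]. *)
Lemma tangent_of_chart (h : M -> M) i j p w : C1_map S h -> chart_dom i p ->
  chart_dom j (h p) ->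
  tangent_map S h p (of_chart i p w) =
  of_chart j (h p) ('d (chrep h i j) (chart i p) w).
Proof.
move=> hC ip jp.
have E1 := diff_chrep_comp w hC C1_map_id ip (chart_atP S p) (chart_atP S (h p)).
have E2 := diff_chrep_comp w C1_map_id hC ip jp (chart_atP S (h p)).
exact: (eq_trans (esym E1) E2).
Qed.

Lemma tangent_map_comp (f h : M -> M) p v : C1_map S f -> C1_map S h ->
  tangent_map S (f \o h) p v = tangent_map S f (h p) (tangent_map S h p v).
Proof. by move=> fC hC; apply: diff_chrep_comp => //; exact: chart_atP. Qed.

Lemma tangent_map_id p v : tangent_map S id p v = v.
Proof. by apply: diff_chrep_id; exact: chart_atP. Qed.

Lemma of_chartK i p w : chart_dom i p -> to_chart i p (of_chart i p w) = w.
Proof.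
move=> ip.
have E1 := diff_chrep_comp w C1_map_id C1_map_id ip (chart_atP S p) ip.
exact: (eq_trans (esym E1) (diff_chrep_id w ip)).
Qed.

Lemma to_chartK i p v : chart_dom i p -> of_chart i p (to_chart i p v) = v.
Proof.
move=> ip.
have E1 := diff_chrep_comp v C1_map_id C1_map_id (chart_atP S p) ip (chart_atP S p).
exact: (eq_trans (esym E1) (diff_chrep_id v (chart_atP S p))).
Qed.

Lemma of_chartD i p w1 w2 : of_chart i p (w1 + w2) = of_chart i p w1 + of_chart i p w2.
Proof. exact: linearD. Qed.
Lemma of_chartB i p w1 w2 : of_chart i p (w1 - w2) = of_chart i p w1 - of_chart i p w2.
Proof. exact: linearB. Qed.
Lemma of_chartZ i p (c : R) w : of_chart i p (c *: w) = c *: of_chart i p w.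
Proof. exact: linearZ. Qed.
Lemma of_chart0 i p : of_chart i p 0 = 0.
Proof. exact: linear0. Qed.
Lemma tangent_mapD f p v w :
  tangent_map S f p (v + w) = tangent_map S f p v + tangent_map S f p w.
Proof. exact: linearD. Qed.
Lemma tangent_mapB f p v w :
  tangent_map S f p (v - w) = tangent_map S f p v - tangent_map S f p w.
Proof. exact: linearB. Qed.
Lemma tangent_mapZ f p (c : R) v : tangent_map S f p (c *: v) = c *: tangent_map S f p v.
Proof. exact: linearZ. Qed.
Lemma tangent_map0 f p : tangent_map S f p 0 = 0.
Proof. exact: linear0. Qed.

Variable g : riemannian_metric S.

Lemma rformDl p v w z : rform g p (v + w) z = rform g p v z + rform g p w z.
Proof. by have := @rform_linear _ _ _ _ g p z 1 v w; rewrite !scale1r. Qed.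
Lemma rform0l p z : rform g p 0 z = 0.
Proof. by apply: (addrI (rform g p 0 z)); rewrite -rformDl !addr0. Qed.
Lemma rformZl p (c : R) v z : rform g p (c *: v) z = c * rform g p v z.
Proof. by have := @rform_linear _ _ _ _ g p z c v 0; rewrite rform0l !addr0. Qed.
Lemma rformDr p v w z : rform g p z (v + w) = rform g p z v + rform g p z w.
Proof. by rewrite !(@rform_sym _ _ _ _ g p z) rformDl. Qed.
Lemma rformZr p (c : R) v z : rform g p z (c *: v) = c * rform g p z v.
Proof. by rewrite !(@rform_sym _ _ _ _ g p z) rformZl. Qed.

Lemma rform_ge0 p v : 0 <= rform g p v v.
Proof. by have [->|/(rform_gt0 g p)/ltW//] := eqVneq v 0; rewrite rform0l. Qed.

Lemma rnorm_ge0 p v : 0 <= rnorm g p v. Proof. exact: sqrtr_ge0. Qed.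
Lemma rnorm_gt0 p v : v != 0 -> 0 < rnorm g p v.
Proof. by move=> /(rform_gt0 g p); rewrite -sqrtr_gt0. Qed.
Lemma rnorm0 p : rnorm g p 0 = 0. Proof. by rewrite /rnorm rform0l sqrtr0. Qed.
Lemma rnorm_le0 p v : rnorm g p v <= 0 -> v = 0.
Proof. by move=> H; apply/eqP; apply: contraTT H => /(rnorm_gt0 p); rewrite ltNge. Qed.
Lemma rnormZ p (c : R) v : rnorm g p (c *: v) = `|c| * rnorm g p v.
Proof. by rewrite /rnorm rformZl rformZr mulrA -expr2 sqrtrM ?sqr_ge0// sqrtr_sqr. Qed.
Lemma rnormN p v : rnorm g p (- v) = rnorm g p v.
Proof. by rewrite -scaleN1r rnormZ normrN1 mul1r. Qed.
Lemma rnorm_sqr p v : rnorm g p v ^+ 2 = rform g p v v.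
Proof. by rewrite sqr_sqrtr// rform_ge0. Qed.

Lemma rform_cauchy p v w : rform g p v w <= rnorm g p v * rnorm g p w.
Proof.
have [->|w0] := eqVneq w 0; first by rewrite rform_sym rform0l rnorm0 mulr0.
have ww := rform_gt0 g p w0.
(* Positivity at the component of [v] orthogonal to [w], scaled by the square norm of [w] to avoid a
   division. *)
have := rform_ge0 p (rform g p w w *: v + (- rform g p v w) *: w).
rewrite !(rformDl,rformDr,rformZl,rformZr) (rform_sym g p w v) => H.
have {}H : rform g p v w ^+ 2 <= rform g p v v * rform g p w w.
  rewrite -subr_ge0 -(pmulr_rge0 _ ww).
  by apply: le_trans H _; rewrite le_eqVlt; apply/orP; left; apply/eqP; ring.
apply: (le_trans (ler_norm _)); rewrite -(@ler_pXn2r _ 2)// ?nnegrE ?mulr_ge0 ?rnorm_ge0//.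
by rewrite exprMn !rnorm_sqr real_normK ?num_real.
Qed.

Lemma ler_rnormD p v w : rnorm g p (v + w) <= rnorm g p v + rnorm g p w.
Proof.
rewrite -(@ler_pXn2r _ 2)// ?nnegrE ?addr_ge0 ?rnorm_ge0// rnorm_sqr.
rewrite !(rformDl,rformDr) (rform_sym g p w v) sqrrD !rnorm_sqr.
have := rform_cauchy p v w; lra.
Qed.

Lemma ler_rnormB p v w : rnorm g p (v - w) <= rnorm g p v + rnorm g p w.
Proof. by rewrite -(rnormN p w) ler_rnormD. Qed.

Lemma ler_rnorm_dist p v w : rnorm g p v - rnorm g p w <= rnorm g p (v - w).
Proof. by rewrite lerBlDr -[X in rnorm _ _ X <= _](subrK w) ler_rnormD. Qed.

Lemma rform_rVE p (L : 'rV[R]_n -> 'rV[R]_n) w :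
  (forall a b, L (a + b) = L a + L b) -> (forall c a, L (c *: a) = c *: L a) -> L 0 = 0 ->
  rform g p (L w) (L w) = \sum_(k < n) \sum_(l < n)
     (w 0 k * w 0 l) * rform g p (L (delta_mx 0 k)) (L (delta_mx 0 l)).
Proof.
move=> LD LZ L0.
have E : L w = \sum_(k < n) w 0 k *: L (delta_mx 0 k).
  rewrite {1}(row_sum_delta w).
  rewrite (big_morph L LD L0).
  by apply: eq_bigr => k _; rewrite LZ.
have sl (I : eqType) (r : seq I) (F : I -> 'rV[R]_n) z :
    rform g p (\sum_(k <- r) F k) z = \sum_(k <- r) rform g p (F k) z.
  by apply: (big_morph (fun a => rform g p a z)) => [a b|]; rewrite ?rformDl ?rform0l.
have sr (I : eqType) (r : seq I) (F : I -> 'rV[R]_n) z :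
    rform g p z (\sum_(k <- r) F k) = \sum_(k <- r) rform g p z (F k).
  by rewrite rform_sym sl; apply: eq_bigr => k _; rewrite rform_sym.
rewrite [in LHS]E sl; apply: eq_bigr => k _.
rewrite rformZl sr mulr_sumr; apply: eq_bigr => l _.
by rewrite rformZr mulrA.
Qed.

(** Vectors at moving points are given by components in a fixed chart [i], where the metric is a
    quadratic form with continuous coefficients. *)
Lemma rnorm_cvg Z (F : set_system Z) (FF : Filter F) (q : Z -> M) (w : Z -> 'rV[R]_n)
    i p0 w0 :
  chart_dom i p0 -> q @ F --> p0 -> w @ F --> w0 ->
  rnorm g (q z) (of_chart i (q z) (w z)) @[z --> F] --> rnorm g p0 (of_chart i p0 w0).
Proof.
move=> ip qc wc; apply: continuous_cvg; first exact: sqrt_continuous.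
have E q w := @rform_rVE q (of_chart i q) w (@of_chartD i q) (@of_chartZ i q) (@of_chart0 i q).
rewrite E; under eq_fun do rewrite E.
apply: cvg_big => [|k _]; first exact: (@add_continuous R^o).
apply: cvg_big => [|l _]; first exact: (@add_continuous R^o).
apply: cvgM.
  apply: cvgM; [exact: (cvg_comp _ _ wc (@coord_continuous _ _ _ ord0 k w0))|
                exact: (cvg_comp _ _ wc (@coord_continuous _ _ _ ord0 l w0))].
have iu : (chart i @` chart_dom i) (chart i p0) by exists p0.
have C := @rform_smooth _ _ _ _ g i (delta_mx 0 k) (delta_mx 0 l) 0%N _ iu.
rewrite /prop_for /continuous_at chartK// in C.
have D := cvg_comp _ _ (cvg_comp _ _ qc (chart_continuous ip)) C.
apply: cvg_trans D; apply: near_eq_cvg.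
have : \forall z \near F, chart_dom i (q z) by exact: (qc _ (chart_dom_nbhs ip)).
by apply: filterS => z iz /=; rewrite chartK.
Qed.

Lemma tangent_cvg Z (F : set_system Z) (FF : Filter F) (h : M -> M) (q : Z -> M)
    (w : Z -> 'rV[R]_n) i p0 w0 : C1_map S h ->
  chart_dom i p0 -> q @ F --> p0 -> w @ F --> w0 ->
  rnorm g (h (q z)) (tangent_map S h (q z) (of_chart i (q z) (w z))) @[z --> F]
    --> rnorm g (h p0) (tangent_map S h p0 (of_chart i p0 w0)).
Proof.
move=> hC ip qc wc; have /C1_mapP[hc Hc] := hC.
have jp := chart_atP S (h p0); set j := chart_at S (h p0) in jp.
have hqc : (h \o q) @ F --> h p0 by apply: (cvg_comp _ _ qc); exact: hc.
have E0 := congr1 (rnorm g (h p0)) (tangent_of_chart w0 hC ip jp).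
apply: (cvg_to_eq (esym E0)).
have C1 : 'd (chrep h i j) (chart i (q z)) (w z) @[z --> F] -->
    'd (chrep h i j) (chart i p0) w0.
  exact: (diff_joint_cvg FF (Hc _ _ _ ip jp) (cvg_comp _ _ qc (chart_continuous ip)) wc).
have C2 := rnorm_cvg FF jp hqc C1.
apply: cvg_trans C2; apply: near_eq_cvg.
have H1 : \forall z \near F, chart_dom i (q z) by exact: (qc _ (chart_dom_nbhs ip)).
have H2 : \forall z \near F, chart_dom j (h (q z)) by exact: (hqc _ (chart_dom_nbhs jp)).
apply: filterS2 H1 H2 => z iz jz.
exact: (esym (congr1 (rnorm g (h (q z))) (tangent_of_chart (w z) hC iz jz))).
Qed.

Lemma sphere_compact m : compact [set w : 'rV[R]_m | `|w| = 1].
Proof.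
apply: bounded_closed_compact.
  by exists 1; split; rewrite ?num_real// => x x1 w /= ->; exact: ltW.
have -> : [set w : 'rV[R]_m | `|w| = 1] = (fun w : 'rV[R]_m => `|w|) @^-1` [set 1] by [].
apply: closed_comp => [w _|]; [exact: norm_continuous|exact: closed_eq].
Qed.

(** By homogeneity only components of norm 1 matter, and compactness of the sphere turns a property
    stable near each direction into one for all directions. Allowing any filter in the hypothesis
    lets it be checked by plain limits. *)
Lemma sphere_near i p0 I (F : set_system I) (FF : Filter F)
    (P : I -> M -> 'rV[R]_n -> Prop) : chart_dom i p0 ->
  (forall w0, w0 != 0 -> forall Z (H : set_system Z) (FH : Filter H)
    (w : Z -> 'rV[R]_n) (q : Z -> M) (k : Z -> I),
    w @ H --> w0 -> q @ H --> p0 -> k @ H `=>` F ->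
    \forall z \near H, P (k z) (q z) (of_chart i (q z) (w z))) ->
  (forall (k : I) p v (c : R), c != 0 -> P k p v -> P k p (c *: v)) ->
  \forall q \near p0 & k \near F, forall v, v != 0 -> P k q v.
Proof.
move=> ip H Hs.
have /compact_near_coveringP/(_ (M * I)%type (filter_prod (nbhs p0) F)
  (fun qk w => P qk.2 qk.1 (of_chart i qk.1 w)) _) := @sphere_compact n.
have H1 w0 : [set w : 'rV[R]_n | `|w| = 1] w0 ->
    \forall w' \near w0 & qk \near filter_prod (nbhs p0) F, P qk.2 qk.1 (of_chart i qk.1 w').
  move=> w01; apply: (H w0 _ _ (filter_prod (nbhs w0) (filter_prod (nbhs p0) F))
    _ fst (fun z => z.2.1) (fun z => z.2.2)).
  - by apply: contra_eq_neq w01 => ->; rewrite normr0 eq_sym oner_eq0.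
  - exact: cvg_fst.
  - exact: (cvg_comp _ _ cvg_snd cvg_fst).
  - exact: (cvg_comp _ _ cvg_snd cvg_snd).
move=> /(_ H1) H2.
have H3 : \forall q \near p0 & k \near F, chart_dom i q.
  exact: (cvg_fst (chart_dom_nbhs ip)).
apply: filterS2 H2 H3 => -[q k] /= Hq iq v v0.
have w0 : to_chart i q v != 0.
  by apply: contra_neq v0 => E; rewrite -(to_chartK v iq) E of_chart0.
have n0 : `|to_chart i q v| != 0 by rewrite normr_eq0.
have -> : v = `|to_chart i q v| *: of_chart i q (`|to_chart i q v|^-1 *: to_chart i q v).
  by rewrite -of_chartZ scalerA divff// scale1r to_chartK.
apply: Hs => //; apply: Hq => /=.
by rewrite normrZ normfV normr_id mulVf.
Qed.

Lemma tangent_near_compact (A : set M) I (F : set_system I) (FF : Filter F)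
    (P : I -> M -> 'rV[R]_n -> Prop) : compact A ->
  (forall p0 w0, A p0 -> w0 != 0 -> forall Z (H : set_system Z) (FH : Filter H)
    (w : Z -> 'rV[R]_n) (q : Z -> M) (k : Z -> I),
    w @ H --> w0 -> q @ H --> p0 -> k @ H `=>` F ->
    \forall z \near H, P (k z) (q z) (of_chart (chart_at S p0) (q z) (w z))) ->
  (forall (k : I) p v (c : R), c != 0 -> P k p v -> P k p (c *: v)) ->
  \forall k \near F, forall p, A p -> forall v, v != 0 -> P k p v.
Proof.
move=> /compact_near_coveringP cA H Hs; apply: cA => p0 Ap0.
apply: (@sphere_near (chart_at S p0)) => //; first exact: chart_atP.
by move=> w0 w00; exact: H.
Qed.

Lemma tangent_bound (h : M -> M) : compact [set: M] -> C1_map S h ->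
  \forall K \near +oo, forall p v, rnorm g (h p) (tangent_map S h p v) <= K * rnorm g p v.
Proof.
move=> cM hC.
suff : \forall K \near +oo, forall p, [set: M] p -> forall v, v != 0 ->
    rnorm g (h p) (tangent_map S h p v) <= K * rnorm g p v.
  apply: filterS => K HK p v; have [->|v0] := eqVneq v 0; last exact: HK.
  by rewrite tangent_map0 !rnorm0 mulr0.
apply: tangent_near_compact => //; last first.
  move=> K p v c c0; rewrite tangent_mapZ !rnormZ mulrCA.
  by rewrite ler_pM2l// normr_gt0.
move=> p0 w0 _ w00 Z H FH w q K wc qc Kc.
have ip := chart_atP S p0.
have C1 := tangent_cvg FH hC ip qc wc; have C2 := rnorm_cvg FH ip qc wc.
set a := rnorm _ _ _ in C1; set b := rnorm _ _ _ in C2.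
have b0 : 0 < b.
  apply: rnorm_gt0; apply: contra_neq w00 => E.
  by rewrite -(of_chartK w0 ip) E; exact: linear0.
have a0 : 0 <= a := rnorm_ge0 _ _.
have H1 : \forall z \near H, (a + 1) / (b / 2) <= K z.
    exact: (Kc _ (nbhs_pinfty_ge (num_real _))).
have H2 : \forall z \near H,
    rnorm g (h (q z)) (tangent_map S h (q z) (of_chart (chart_at S p0) (q z) (w z))) < a + 1.
  by apply: (cvgr_lt a) => //; lra.
have H3 : \forall z \near H, b / 2 < rnorm g (q z) (of_chart (chart_at S p0) (q z) (w z)).
  by apply: (cvgr_gt b) => //; lra.
apply: filterS3 H1 H2 H3 => z h1 h2 h3.
apply: (le_trans (ltW h2)); apply: (@le_trans _ _ (K z * (b / 2))).
  by rewrite -ler_pdivrMr// divr_gt0.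
rewrite ler_wpM2l ?ltW//; apply: lt_le_trans h1.
by rewrite divr_gt0 ?divr_gt0//; lra.
Qed.

(** On nonzero vectors the ratio of the two norms is positive and continuous in point and direction,
    hence bounded both ways near [p0]. *)
Lemma rnorm_chart_bound i p0 : chart_dom i p0 ->
  \forall q \near p0 & C \near +oo, forall w,
    `|w| <= C * rnorm g q (of_chart i q w) /\ rnorm g q (of_chart i q w) <= C * `|w|.
Proof.
move=> ip.
have H : \forall q \near p0 & C \near +oo, forall v, v != 0 ->
    `|to_chart i q v| <= C * rnorm g q v /\ rnorm g q v <= C * `|to_chart i q v|.
  apply: (@sphere_near i) => //; last first.
    move=> C q v c c0; rewrite rnormZ [to_chart i q (c *: v)]linearZ normrZ => -[A B].
    by rewrite mulrCA [C * (_ * _)]mulrCA !ler_pM2l ?normr_gt0//.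
  move=> w0 w00 Z H FH w q C wc qc Cc.
  have C2 := rnorm_cvg FH ip qc wc; set b := rnorm _ _ _ in C2.
  have b0 : 0 < b.
    apply: rnorm_gt0; apply: contra_neq w00 => E.
    by rewrite -(of_chartK w0 ip) E; exact: linear0.
  have C3 : `|w z| @[z --> H] --> `|w0| by apply: cvg_norm.
  set a := `|w0| in C3; have a0 : 0 < a by rewrite normr_gt0.
  have H1 : \forall z \near H, (2 * a) / (b / 2) <= C z.
    exact: (Cc _ (nbhs_pinfty_ge (num_real _))).
  have H2 : \forall z \near H, (2 * b) / (a / 2) <= C z.
    exact: (Cc _ (nbhs_pinfty_ge (num_real _))).
  have H3 : \forall z \near H, `|w z| < 2 * a by apply: (cvgr_lt a) => //; lra.
  have H4 : \forall z \near H, a / 2 < `|w z| by apply: (cvgr_gt a) => //; lra.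
  have H5 : \forall z \near H, rnorm g (q z) (of_chart i (q z) (w z)) < 2 * b.
    by apply: (cvgr_lt b) => //; lra.
  have H6 : \forall z \near H, b / 2 < rnorm g (q z) (of_chart i (q z) (w z)).
    by apply: (cvgr_gt b) => //; lra.
  have H7 : \forall z \near H, chart_dom i (q z) by exact: (qc _ (chart_dom_nbhs ip)).
  near=> z.
  have iz : chart_dom i (q z) by near: z.
  rewrite of_chartK//.
  have h1 : (2 * a) / (b / 2) <= C z by near: z.
  have h2 : (2 * b) / (a / 2) <= C z by near: z.
  have h3 : `|w z| < 2 * a by near: z.
  have h4 : a / 2 < `|w z| by near: z.
  have h5 : rnorm g (q z) (of_chart i (q z) (w z)) < 2 * b by near: z.
  have h6 : b / 2 < rnorm g (q z) (of_chart i (q z) (w z)) by near: z.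
  have Cz : 0 <= C z by apply: le_trans h1; rewrite ltW// !(divr_gt0,mulr_gt0).
  split.
    apply: (le_trans (ltW h3)); apply: (@le_trans _ _ (C z * (b / 2))).
      by rewrite -ler_pdivrMr// divr_gt0.
    by rewrite ler_wpM2l// ltW.
  apply: (le_trans (ltW h5)); apply: (@le_trans _ _ (C z * (a / 2))).
    by rewrite -ler_pdivrMr// divr_gt0.
  by rewrite ler_wpM2l// ltW.
have H3 : \forall q \near p0 & k \near (+oo : set_system R), chart_dom i q.
  exact: (cvg_fst (chart_dom_nbhs ip)).
apply: filterS2 H H3 => -[q C] /= Hq iq w.
have [->|w0] := eqVneq w 0; first by rewrite of_chart0 rnorm0 normr0 !mulr0.
have /Hq : of_chart i q w != 0.
  by apply: contra_neq w0 => E; rewrite -(of_chartK w iq) E; exact: linear0.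
by rewrite of_chartK.
Unshelve. all: by end_near. Qed.

End ManifoldBasics.

(** * Curve lengths and the Riemannian distance *)

Section CurveIntegrals.
Context {R : realType}.

Lemma le_of_eqe (x y : \bar R) : x = y -> (x <= y)%E.
Proof. by move=> ->. Qed.

Lemma le_of_eqr (x y : R) : x = y -> x <= y.
Proof. by move=> ->. Qed.

Lemma lee_invl_mul (C a : R) (x : \bar R) : 0 < C ->
  (a%:E <= C%:E * x)%E -> ((C^-1 * a)%:E <= x)%E.
Proof.
move=> C0; case: x => [r| |] //; last by rewrite gt0_muleNy ?lte_fin// leeNy_eq.
  by rewrite -EFinM !lee_fin ler_pdivrMl.
by move=> _; rewrite leey.
Qed.

Lemma continuous_measurable_EFin (D : set R) (nu : R -> R) : measurable D ->
  continuous nu -> measurable_fun D (fun s : R => (nu s)%:E).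
Proof.
move=> mD cnu; apply/measurable_EFinP; apply: measurable_funTS.
exact: continuous_measurable_fun.
Qed.

Lemma integral01_le (nu : R -> R) (K : R) : continuous nu -> (forall s, 0 <= nu s) ->
  (forall s, nu s <= K) ->
  (\int[lebesgue_measure]_(s in `[0%R, 1%R]) (nu s)%:E <= K%:E)%E.
Proof.
move=> cnu nu0 nuK.
have m01 : measurable (`[0%R, 1%R]%classic : set R) by [].
apply: (@le_trans _ _ (\int[lebesgue_measure]_(s in `[0%R, 1%R]) (cst K%:E s))%E).
  apply: ge0_le_integral => //.
  - by move=> s _; rewrite lee_fin.
  - exact: continuous_measurable_EFin.
  - by move=> s _; rewrite lee_fin.
have E1 := @integral_cst _ _ R lebesgue_measure _ m01 K%:E.
apply: (le_trans (le_of_eqe E1)).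
have L : lebesgue_measure (`[0%R, 1%R]%classic : set R) = 1%E.
  by apply: (eq_trans (lebesgue_measure_itv _)); rewrite /= lte_fin ltr01 -EFinD subr0.
apply: le_of_eqe; apply: (eq_trans (congr1 (fun x => K%:E * x)%E L)).
by rewrite mule1.
Qed.

(** The fundamental theorem of calculus on [0, a], followed by enlarging the interval to [0, 1], the
    integrand being nonnegative. *)
Lemma increment_le_integral (phi nu : R -> R) (C a : R) :
  0 <= a <= 1 -> 0 <= C -> continuous nu -> (forall s, 0 <= nu s) ->
  (forall s, s \in `[0, a] -> derivable phi s 1) ->
  (forall s, s \in `[0, a] -> {for s, continuous (derive1 phi)}) ->
  (forall s, s \in `[0, a] -> `|derive1 phi s| <= C * nu s) ->
  (`|phi a - phi 0|%:E <= C%:E * \int[lebesgue_measure]_(s in `[0%R, 1%R]) (nu s)%:E)%E.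
Proof.
move=> /andP[]; rewrite le_eqVlt => /predU1P[<- _ C0 cnu nu0 _ _ _|a0 a1 C0 cnu nu0 dphi cphi bphi].
  by rewrite subrr normr0 mule_ge0// ?lee_fin// integral_ge0// => s _; rewrite lee_fin.
have m01 : measurable (`[0%R, 1%R]%classic : set R) by [].
have m0a : measurable (`[0%R, a]%classic : set R) by [].
have inoo s : s \in `]0, a[ -> s \in `[0, a].
  by rewrite !in_itv/= => /andP[? ?]; rewrite !ltW.
have cont s : s \in `[0, a] -> {for s, continuous phi}.
  by move=> /dphi /derivable1_diffP /differentiable_continuous.
have c' : {within `[0, a], continuous (derive1 phi)}.
  by apply: continuous_in_subspaceT => s; rewrite inE/=; exact: cphi.
have E := @continuous_FTC2 R (derive1 phi) phi 0 a a0 c' _ _.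
have {E} E : (\int[lebesgue_measure]_(s in `[0%R, a]) (derive1 phi s)%:E)%E = ((phi a)%:E - (phi 0)%:E)%E.
  apply: E => //; split; first by move=> s /inoo /dphi.
    by apply: cvg_at_right_filter; apply: cont; rewrite in_itv/= lexx ltW.
  by apply: cvg_at_left_filter; apply: cont; rewrite in_itv/= lexx ltW.
have mphi : measurable_fun `[0%R, a] (fun s : R => (derive1 phi s)%:E).
  by apply/measurable_EFinP; exact: subspace_continuous_measurable_fun.
have -> : (`|phi a - phi 0|%:E = `|\int[lebesgue_measure]_(s in `[0%R, a]) (derive1 phi s)%:E|)%E.
  by rewrite E -EFinB.
have J := @le_abse_integral _ _ R lebesgue_measure _ _ m0a mphi; apply: (le_trans J).
apply: (@le_trans _ _ (\int[lebesgue_measure]_(s in `[0%R, a]) (C%:E * (nu s)%:E))%E).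
  apply: ge0_le_integral => //.
  - by apply: (measurableT_comp _ mphi); exact: abse_measurable.
  - have := @continuous_measurable_EFin `[0%R, a] (fun s => C * nu s) m0a.
    by apply; move=> s; apply: cvgM; [exact: cvg_cst|exact: cnu].
rewrite ge0_integralZl//; last 2 first.
  - exact: continuous_measurable_EFin.
  - by move=> s _; rewrite lee_fin.
apply: lee_wpmul2l => //; apply: ge0_subset_integral => //.
- exact: continuous_measurable_EFin.
- by move=> s _; rewrite lee_fin.
- by move=> s /=; rewrite !in_itv/= => /andP[-> sa]; exact: le_trans sa a1.
Qed.

End CurveIntegrals.

(** * Comparison of the Riemannian distance with distances in charts *)

Section CurvesInCharts.
Context {R : realType} {n : nat} {M : topologicalType}.
Variable S : smooth_manifold R n M.
Implicit Types (i j k : chart_index S) (p q : M) (u v w : 'rV[R]_n).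

Lemma curve_chart_c1 (c : R -> M) i (s : R) : C1_curve S c -> chart_dom i (c s) ->
  @c1_at R R^o 'rV[R]_n (chart i \o c) s.
Proof.
move=> [cc Hc] ics; have := Hc i; rewrite class_C1P; first by apply.
by apply: open_comp => [x _|]; [exact: cc|exact: chart_dom_open].
Qed.

Lemma velocity_chart (c : R -> M) i (s : R) : C1_curve S c -> chart_dom i (c s) ->
  velocity S c s = of_chart i (c s) ('D_(1 : R^o) (chart i \o c : R^o -> _) (s : R^o)).
Proof.
move=> cC ics; have [dphi _] := curve_chart_c1 cC ics.
have {dphi} dphi := nbhs_singleton dphi.
have jcs := chart_atP S (c s); set j := chart_at S (c s) in jcs.
have dtr : differentiable (chrep id i j) ((chart i \o c : R^o -> _) (s : R^o)).
  exact: (chrep_diff (C1_map_id S) ics jcs).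
have [cc _] := cC.
have H : \forall s' \near (s : R^o), (chrep id i j \o (chart i \o c)) s' = (chart j \o c) s'.
  have H : \forall s' \near (s : R^o), chart_dom i (c s') by exact: (cc s _ (chart_dom_nbhs ics)).
  by apply: filterS H => s' is'; rewrite /= chrep_at.
have [dj Ej] := near_eq_diff H (differentiable_comp dphi dtr).
have E1 := derive1E (chart j \o c : R^o -> _) (s : R^o).
have E2 := deriveE (1 : R^o) dj.
have E3 := congr1 (fun F => F (1 : R^o)) Ej.
have E4 := diff_comp_app (1 : R^o) dphi dtr.
have E5 := congr1 ('d (chrep id i j) ((chart i \o c : R^o -> _) (s : R^o))) (deriveE (1 : R^o) dphi).
exact: (eq_trans E1 (eq_trans E2 (eq_trans E3 (eq_trans E4 (esym E5))))).
Qed.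

Variable g : riemannian_metric S.

Lemma speed_continuous (c : R -> M) : C1_curve S c ->
  continuous (fun s => rnorm g (c s) (velocity S c s)).
Proof.
move=> cC s; have ics := chart_atP S (c s); set i := chart_at S (c s) in ics.
have [cc _] := cC; have [_ Dc] := curve_chart_c1 cC ics.
have E0 := congr1 (rnorm g (c s)) (velocity_chart cC ics).
apply: (cvg_to_eq (esym E0)).
have C2 := rnorm_cvg (g := g) (nbhs_filter s) ics (cc s) (Dc (1 : R^o)).
apply: cvg_trans C2; apply: near_eq_cvg.
have H : \forall s' \near s, chart_dom i (c s') by exact: (cc s _ (chart_dom_nbhs ics)).
apply: filterS H => s' is'.
exact: (esym (congr1 (rnorm g (c s')) (velocity_chart cC is'))).
Qed.

Lemma curve_length_ge0 c : (0 <= curve_length g c)%E.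
Proof. by apply: integral_ge0 => s _; rewrite lee_fin rnorm_ge0. Qed.

Lemma rdist_ge0 p q : (0 <= rdist g p q)%E.
Proof. by apply: le_ereal_inf_tmp => _ [c _ <-]; exact: curve_length_ge0. Qed.

(** A reparametrization of the whole line with values in [0, 1]: [C1_curve] asks for curves on all
    of R, and a segment run in this way stays in a chart ball at all times. *)
Definition smooth_step (s : R) : R := (1 - cos (pi * s)) / 2.

Lemma smooth_step0 : smooth_step 0 = 0.
Proof. by rewrite /smooth_step mulr0 cos0 subrr mul0r. Qed.
Lemma smooth_step1 : smooth_step 1 = 1.
Proof. by rewrite /smooth_step mulr1 cospi opprK -[1 + 1]/(2%:R) divff. Qed.
Lemma smooth_step_itv s : 0 <= smooth_step s <= 1.
Proof.
have := cos_le1 (pi * s); have := cos_geN1 (pi * s); rewrite /smooth_step => A B.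
by apply/andP; split; lra.
Qed.

Lemma is_derive_smooth_step (s : R) :
  is_derive s 1 smooth_step (pi / 2 * sin (pi * s)).
Proof.
rewrite /smooth_step.
apply: is_derive_eq; rewrite /GRing.scale/=; ring.
Qed.

Lemma smooth_step_path u w (x v : R^o) :
  differentiable (fun x : R^o => u + smooth_step x *: w) x /\
  'd (fun x : R^o => u + smooth_step x *: w) x v = (v * (pi / 2 * sin (pi * x))) *: w.
Proof.
have [D1 E1] := is_derive_smooth_step x.
have D2 : differentiable (smooth_step : R^o -> R^o) x by apply/derivable1_diffP.
have [D3 E3] := is_diff_line u w (smooth_step x : R^o).
split; first exact: (differentiable_comp D2 D3).
have E4 := diff_comp_app v D2 D3; apply: (eq_trans E4).
have E5 := congr1 (fun F => F ('d (smooth_step : R^o -> R^o) x v)) E3.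
apply: (eq_trans E5); congr (_ *: _).
have E6 : 'd (smooth_step : R^o -> R^o) x v = v *: 'd (smooth_step : R^o -> R^o) x (1 : R^o).
  have -> : v = v *: (1 : R^o) by rewrite /GRing.scale/= mulr1.
  by rewrite linearZ /= /GRing.scale/= mulr1.
apply: (eq_trans E6); congr (_ * _).
exact: (eq_trans (esym (deriveE (1 : R^o) D2)) E1).
Qed.

Lemma smooth_step_path_c1 u w (x : R) :
  @c1_at R R^o 'rV[R]_n (fun x : R^o => u + smooth_step x *: w) x.
Proof.
split; first by near=> y; exact: (smooth_step_path u w y 0).1.
move=> v.
have E (y : R^o) : 'D_v (fun x : R^o => u + smooth_step x *: w) y = (v * (pi / 2 * sin (pi * y))) *: w.
  have [A B] := smooth_step_path u w y v; exact: (eq_trans (deriveE v A) B).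
have -> : 'D_v (fun x : R^o => u + smooth_step x *: w) =
    (fun y => (v * (pi / 2 * sin (pi * y))) *: w) by apply/funext.
have C : (fun y : R => v * (pi / 2 * sin (pi * y))) y @[y --> x] --> v * (pi / 2 * sin (pi * x)).
  apply: cvgM; first exact: cvg_cst.
  apply: cvgM; first exact: cvg_cst.
  apply: continuous_cvg; first exact: continuous_sin.
  by apply: cvgM; [exact: cvg_cst|exact: cvg_id].
exact: (cvgZ C (cvg_cst w)).
Unshelve. all: by end_near. Qed.

Lemma chart_segment i (u0 u u' : 'rV[R]_n) (r : R) :
  ball u0 r `<=` chart i @` chart_dom i -> ball u0 r u -> ball u0 r u' ->
  let c (s : R) := chart_inv i (u + smooth_step s *: (u' - u)) in
  [/\ C1_curve S c, c 0 = chart_inv i u, c 1 = chart_inv i u' &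
   forall s, chart_dom i (c s) /\ chart i (c s) = u + smooth_step s *: (u' - u)].
Proof.
move=> Bi Bu Bu' c.
have Bs s : ball u0 r (u + smooth_step s *: (u' - u)).
  by apply: ball_segment => //; rewrite in_itv/=; exact: smooth_step_itv.
have cs s : chart_dom i (c s) /\ chart i (c s) = u + smooth_step s *: (u' - u).
  by rewrite /c; have [p ip <-] := Bi _ (Bs s); rewrite chartK.
have pc s := c1_at_continuous (smooth_step_path_c1 u (u' - u) s).
have cc : continuous c.
  move=> s; apply: (continuous_comp (pc s)).
  by apply: chart_inv_continuous; exact: Bi.
split=> //.
- split=> // j; rewrite class_C1P; last first.
    by apply: open_comp => [x _|]; [exact: cc|exact: chart_dom_open].
  move=> s js; have [ics Ecs] := cs s.
  have /C1_mapP[_ /(_ i j _ ics js)] := C1_map_id S; rewrite Ecs => trc.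
  exact: (c1_at_comp (smooth_step_path_c1 u (u' - u) s) trc).
- by rewrite /c smooth_step0 scale0r addr0.
- by rewrite /c smooth_step1 scale1r addrC subrK.
Qed.

(** The straight segment in the chart competes in the infimum, and its speed is controlled by
    [rnorm_chart_bound]. *)
Lemma rdist_le_chart i p0 : chart_dom i p0 -> exists2 C : R, 0 < C &
  exists2 V : set M, nbhs p0 V & forall q q', V q -> V q' ->
    chart_dom i q /\ (rdist g q q' <= (C * `|chart i q - chart i q'|)%:E)%E.
Proof.
move=> ip.
have [[W F] /= [Wp0 [C1 [_ C1F]]] WF] := rnorm_chart_bound g ip.
pose C := Num.max C1 1 + 1.
have C0 : 0 < C by rewrite /C ltr_pwDr// le_max ler01 orbT.
have FC : F C by apply: C1F; rewrite /C ltr_pwDr// le_max lexx.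
have iu : (chart i @` chart_dom i) (chart i p0) by exists p0.
have H1 := open_nbhs_nbhs (conj (@chart_img_open _ _ _ S i) iu).
have H2 : \forall u \near chart i p0, W (chart_inv i u) by exact: (chart_inv_cvg ip Wp0).
have H12 : \forall u \near chart i p0, (chart i @` chart_dom i) u /\ W (chart_inv i u).
  exact: filterI H1 H2.
have /nbhs_ballP[r /= r0 Br] := H12.
(* The factor 2 bounds pi / 2, the largest slope of [smooth_step]. *)
exists (C * 2); first by rewrite mulr_gt0.
exists [set q | chart_dom i q /\ ball (chart i p0) r (chart i q)].
  apply: filterI; first exact: chart_dom_nbhs.
  exact: (chart_continuous ip (nbhsx_ballx _ _ r0)).
move=> q q' [iq Bq] [iq' Bq']; split=> //.
have Bi : ball (chart i p0) r `<=` chart i @` chart_dom i by move=> u /Br[].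
pose c (s : R) := chart_inv i (chart i q + smooth_step s *: (chart i q' - chart i q)).
have [cC c0 c1 cs] : [/\ C1_curve S c, c 0 = chart_inv i (chart i q),
    c 1 = chart_inv i (chart i q') & forall s, chart_dom i (c s) /\
    chart i (c s) = chart i q + smooth_step s *: (chart i q' - chart i q)].
  exact: chart_segment Bi Bq Bq'.
apply: ge_ereal_inf; exists (curve_length g c).
  by exists c => //; split=> //; rewrite ?c0 ?c1 (chartK iq, chartK iq').
apply: integral01_le; [exact: speed_continuous|by move=> s; exact: rnorm_ge0|move=> s].
have [ics Ecs] := cs s.
have -> := velocity_chart cC ics.
have Wcs : W (c s).
  have : ball (chart i p0) r (chart i (c s)).
    by rewrite Ecs; apply: ball_segment => //; rewrite in_itv/=; exact: smooth_step_itv.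
  by move=> /Br[_]; rewrite /= chartK.
have [_ bd] := WF (c s, C) (conj Wcs FC) ('D_(1 : R^o) (chart i \o c : R^o -> _) (s : R^o)).
apply: (le_trans bd).
have fE : (chart i \o c) = (fun x : R^o => chart i q + smooth_step x *: (chart i q' - chart i q)).
  by apply/funext => x /=; have [_ ->] := cs x.
have [A B] := smooth_step_path (chart i q) (chart i q' - chart i q) (s : R^o) (1 : R^o).
have E : 'D_(1 : R^o) (chart i \o c : R^o -> _) (s : R^o) =
  (1 * (pi / 2 * sin (pi * s))) *: (chart i q' - chart i q).
  by rewrite fE; exact: (eq_trans (deriveE (1 : R^o) A) B).
rewrite E normrZ mul1r [`|chart i q - _|]distrC mulrA; apply: ler_wpM2r => //.
apply: ler_wpM2l; [exact: ltW|rewrite normrM].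
have /andP[p1 p2] := pihalf_02 R.
have s1 : `|sin (pi * s)| <= 1 by rewrite ler_norml sin_le1 sin_geN1.
rewrite gtr0_norm//; apply: (@le_trans _ _ (2 * 1)); last by rewrite mulr1.
by apply: ler_pM => //; exact: ltW.
Qed.

Lemma chart_increment (c : R -> M) i (C a : R) (k : 'I_n) : C1_curve S c -> 0 <= a <= 1 -> 0 <= C ->
  (forall s, s \in `[0, a] -> chart_dom i (c s) /\
     forall w, `|w| <= C * rnorm g (c s) (of_chart i (c s) w)) ->
  (`|chart i (c a) ord0 k - chart i (c 0) ord0 k|%:E <= C%:E * curve_length g c)%E.
Proof.
move=> cC a01 C0 H.
have dE (s : R) : chart_dom i (c s) ->
    derivable (fun s : R^o => chart i (c s) ord0 k : R^o) s 1 /\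
    derive1 (fun s : R^o => chart i (c s) ord0 k : R^o) s =
    ('D_(1 : R^o) (chart i \o c : R^o -> _) (s : R^o)) ord0 k.
  move=> ics; have [/nbhs_singleton dphi _] := curve_chart_c1 cC ics.
  have D1 := @diff_derivable _ _ _ _ _ (1 : R^o) dphi.
  have /derivable_mxP/(_ ord0 k) D2 := D1; split=> //.
  by rewrite derive1E derive_mx// mxE.
apply: (@increment_le_integral R (fun s => chart i (c s) ord0 k)) => //.
- exact: speed_continuous.
- by move=> s; exact: rnorm_ge0.
- by move=> s /H[/dE[]].
- move=> s /H[ics _]; have [_ Dc] := curve_chart_c1 cC ics; have [cc _] := cC.
  have E0 := (dE s ics).2.
  apply: (cvg_to_eq (esym E0)).
  have C2 := cvg_comp _ _ (Dc (1 : R^o)) (@coord_continuous _ _ _ ord0 k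
     ('D_(1 : R^o) (chart i \o c : R^o -> _) (s : R^o))).
  apply: cvg_trans C2; apply: near_eq_cvg.
  have H' : \forall s' \near s, chart_dom i (c s') by exact: (cc s _ (chart_dom_nbhs ics)).
  by apply: filterS H' => s' is'; apply/esym; have [_ ->] := dE _ is'.
- move=> s /H[ics bd]; have [_ E0] := dE s ics.
  have E1 := velocity_chart cC ics.
  have E2 : derive1 (fun s0 : R => chart i (c s0) ord0 k) s =
    ('D_(1 : R^o) (chart i \o c : R^o -> _) (s : R^o)) ord0 k by exact: E0.
  rewrite E2; apply: (le_trans (normr_rVE _ k)); apply: (le_trans (bd _)).
  by have -> := E1.
Qed.

(** Closedness in [M], not just in the chart, prevents a curve from leaving the chart domain while
    its coordinates remain in the half ball. It comes from compactness and the Hausdorff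
    property. *)
Lemma ball_closed_half_image i (u0 : 'rV[R]_n) (r : R) : 0 < r ->
  ball u0 r `<=` chart i @` chart_dom i ->
  closed (chart_inv i @` [set u | `|u0 - u| <= r / 2]).
Proof.
move=> r0 Bi; apply: compact_closed; first exact: (manifold_hausdorff S).
apply: continuous_compact.
  apply: continuous_in_subspaceT => u; rewrite inE/= => ur.
  apply: chart_inv_continuous; apply: Bi; rewrite -ball_normE /ball_/=.
  by apply: le_lt_trans ur _; lra.
apply: bounded_closed_compact.
  exists (`|u0| + r / 2); split; first by rewrite num_real.
  move=> x xr u /= ur; apply: le_trans (ltW xr).
  have -> : u = u0 - (u0 - u) by rewrite opprB addrC subrK.
  by apply: le_trans (ler_normB _ _) _; rewrite lerD2l.
have r2 : 0 < r / 2 by rewrite divr_gt0.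
have := @closed_ball_closed _ _ u0 (r / 2).
by rewrite closed_ballE.
Qed.

(** A first exit argument: until then the coordinates have moved by at most [r / 4] from a point
    within [r / 4] of [u0], so the curve is in the closed half ball, which lies inside the open
    ball. *)
Lemma short_curve_in_chart i (u0 : 'rV[R]_n) (r C : R) (c : R -> M) : 0 < r -> 0 < C ->
  ball u0 r `<=` chart i @` chart_dom i ->
  (forall q, chart_dom i q -> ball u0 r (chart i q) ->
     forall w, `|w| <= C * rnorm g q (of_chart i q w)) ->
  C1_curve S c -> chart_dom i (c 0) -> `|u0 - chart i (c 0)| <= r / 4 ->
  (C%:E * curve_length g c <= (r / 4)%:E)%E ->
  [/\ chart_dom i (c 1), ball u0 r (chart i (c 1)) &
   (`|chart i (c 0) - chart i (c 1)|%:E <= C%:E * curve_length g c)%E].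
Proof.
move=> r0 C0 Bi bd cC ic0 B0 short; have [cc _] := cC.
pose O := [set q | chart_dom i q /\ ball u0 r (chart i q)].
have nO q : O q -> nbhs q O.
  move=> [iq Bq]; apply: filterI; first exact: chart_dom_nbhs.
  by apply: (chart_continuous iq); apply: open_nbhs_nbhs; split=> //; exact: ball_open.
have lfin : curve_length g c \is a fin_num.
  rewrite ge0_fin_numE ?curve_length_ge0// ltey; apply/eqP => E.
  by move: short; rewrite E gt0_muley ?lte_fin// leye_eq.
set l := fine (curve_length g c); have lE : curve_length g c = l%:E by rewrite fineK.
rewrite lE -EFinM lee_fin in short; rewrite lE -EFinM.
have l0 : 0 <= C * l by apply: mulr_ge0; [exact: ltW|rewrite /l fine_ge0// curve_length_ge0].
have incr (a : R) : 0 <= a <= 1 -> (forall s, s \in `[0, a] -> O (c s)) ->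
    `|chart i (c 0) - chart i (c a)| <= C * l.
  move=> a01 Oa; rewrite distrC; apply: normr_rV_le => // k; rewrite !mxE -lee_fin EFinM -lE.
  by apply: chart_increment => // [|s /Oa[? ?]]; [exact: ltW|split=> //; exact: bd].
suff Oall s : s \in `[0, 1] -> O (c s).
  have [i1 B1] : O (c 1) by apply: Oall; rewrite in_itv/= ler01 lexx.
  by split=> //; rewrite lee_fin; apply: incr; rewrite ?lexx ?ler01.
(* [N] consists of the bad times. The curve is good at [inf N] by closedness, hence also just after
   it by openness, which contradicts the infimum. *)
apply: contrapT => s01; pose N := [set s : R | s \in `[0, 1] /\ ~ O (c s)].
have {s01} N0 : N !=set0 by move: s01 => /not_implyP[? ?]; exists s.
have Nlb : lbound N 0 by move=> x [+ _]; rewrite in_itv/= => /andP[].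
have Nhl : has_lbound N by exists 0.
have inf0 : 0 <= inf N by apply: lb_le_inf.
have infle x : N x -> inf N <= x by move=> Nx; exact: ge_inf.
have inf1 : inf N <= 1.
  have [x Nx] := N0; apply: le_trans (infle _ Nx) _.
  by have [+ _] := Nx; rewrite in_itv/= => /andP[].
have Olt x : 0 <= x -> x < inf N -> O (c x).
  move=> x0 xi; apply: contrapT => nOx; have : N x.
    by split=> //; rewrite in_itv/= x0/=; exact: ltW (lt_le_trans xi inf1).
  by move=> /infle; rewrite leNgt xi.
have OI : O (c (inf N)).
  have [I0|In0] := eqVneq (inf N) 0.
    by rewrite I0; split=> //; rewrite -ball_normE /ball_/=; apply: le_lt_trans B0 _; lra.
  have I0 : 0 < inf N by rewrite lt0r In0.
  pose K := chart_inv i @` [set u | `|u0 - u| <= r / 2].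
  have clK : closed K := ball_closed_half_image r0 Bi.
  have KO : K `<=` O.
    move=> _ [u ur <-]; have Bu : ball u0 r u.
      by rewrite -ball_normE /ball_/=; apply: le_lt_trans ur _; lra.
    by have [q iq qu] := Bi _ Bu; rewrite -qu chartK//; split=> //; rewrite qu.
  have Klt x : 0 <= x -> x < inf N -> K (c x).
    move=> x0 xi; have [ix _] := Olt _ x0 xi; exists (chart i (c x)); last by rewrite chartK.
    have x1 : x <= 1 by exact: ltW (lt_le_trans xi inf1).
    have := incr x; rewrite x0 x1 => /(_ isT) H.
    have {}H : `|chart i (c 0) - chart i (c x)| <= C * l.
      by apply: H => s'; rewrite in_itv/= => /andP[s0 sx]; apply: Olt => //; exact: le_lt_trans xi.
    change (`|u0 - chart i (c x)| <= r / 2).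
    have -> : u0 - chart i (c x) = (u0 - chart i (c 0)) + (chart i (c 0) - chart i (c x)).
      by rewrite addrA subrK.
    apply: le_trans (ler_normD _ _) _; apply: le_trans (lerD B0 (le_trans H short)) _; lra.
  apply: KO; apply: contrapT => nK.
  have /nbhs_ballP[e /= e0 Be] : \forall s \near inf N, ~ K (c s).
    have nb : nbhs (c (inf N)) (~` K) by apply: open_nbhs_nbhs; split=> //; exact: closed_openC.
    exact: (cc (inf N) _ nb).
  pose x := Num.max (inf N - e / 2) (inf N / 2).
  have xi : x < inf N by rewrite /x gt_max; apply/andP; split; lra.
  have x0 : 0 <= x by rewrite /x le_max; apply/orP; right; rewrite divr_ge0.
  apply: (Be x) (Klt _ x0 xi); rewrite -ball_normE /ball_/= gtr0_norm ?subr_gt0//.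
  have : inf N - e / 2 <= x by rewrite /x le_max lexx.
  lra.
have /nbhs_ballP[e /= e0 Be] : \forall s \near inf N, O (c s) by exact: (cc (inf N) _ (nO _ OI)).
have [x Nx xe] : exists2 x, N x & x < inf N + e by apply: inf_adherent.
have [_ nOx] := Nx; apply: nOx; apply: Be; rewrite -ball_normE /ball_/=.
have xi := infle _ Nx; rewrite distrC ger0_norm ?subr_ge0//; lra.
Qed.

(** Every curve short enough to matter stays in the chart. [C] is fixed before [V], so that the
    neighbourhood can be shrunk at no cost in the constant. *)
Lemma rdist_ge_chart i p0 : chart_dom i p0 -> exists2 C : R, 0 < C &
  forall V : set M, nbhs p0 V -> \forall q \near p0 & rho \near (0 : R)^'+,
    forall q', (rdist g q q' <= rho%:E)%E ->
      [/\ V q', chart_dom i q, chart_dom i q' &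
       (`|chart i q - chart i q'|%:E <= C%:E * rdist g q q')%E].
Proof.
move=> ip.
have [[W F] /= [Wp0 [C1 [_ C1F]]] WF] := rnorm_chart_bound g ip.
pose C := Num.max C1 1 + 1.
have C0 : 0 < C by rewrite /C ltr_pwDr// le_max ler01 orbT.
have FC : F C by apply: C1F; rewrite /C ltr_pwDr// le_max lexx.
exists C => // V Vp0.
have iu : (chart i @` chart_dom i) (chart i p0) by exists p0.
have H1 := open_nbhs_nbhs (conj (@chart_img_open _ _ _ S i) iu).
have H2 : \forall u \near chart i p0, (V `&` W) (chart_inv i u).
  by apply: (chart_inv_cvg ip); exact: filterI.
have H12 : \forall u \near chart i p0, (chart i @` chart_dom i) u /\ (V `&` W) (chart_inv i u).
  exact: filterI H1 H2.
have /nbhs_ballP[r /= r0 Br] := H12.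
have Bi : ball (chart i p0) r `<=` chart i @` chart_dom i by move=> u /Br[].
have bd q : chart_dom i q -> ball (chart i p0) r (chart i q) ->
     forall w, `|w| <= C * rnorm g q (of_chart i q w).
  move=> iq /Br[_ [_ ]]; rewrite chartK// => Wq w.
  by have [] := WF (q, C) (conj Wq FC) w.
have r4 : 0 < r / 4 by rewrite divr_gt0.
have G1 : \forall q \near p0, chart_dom i q /\ ball (chart i p0) (r / 4) (chart i q).
  apply: filterI; first exact: chart_dom_nbhs.
  exact: (chart_continuous ip (nbhsx_ballx _ _ r4)).
have rC : 0 < r / 4 / C by rewrite divr_gt0.
have G2 : \forall rho \near (0 : R)^'+, rho < r / 4 / C by exact: nbhs_right_lt.
exists ([set q | chart_dom i q /\ ball (chart i p0) (r / 4) (chart i q)], [set rho | rho < r / 4 / C]) => //.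
move=> -[q rho] /= [[iq Bq] rhoC] q' dq.
have Bq' : `|chart i p0 - chart i q| <= r / 4 by move: Bq; rewrite -ball_normE /ball_/= => /ltW.
have main c : C1_curve S c -> c 0 = q -> c 1 = q' -> (C%:E * curve_length g c <= (r / 4)%:E)%E ->
  [/\ chart_dom i q', ball (chart i p0) r (chart i q') &
   (`|chart i q - chart i q'|%:E <= C%:E * curve_length g c)%E].
  move=> cC c0 c1 cl; rewrite -c0 -c1; apply: short_curve_in_chart => //; by rewrite c0.
have [l [c [cC c0 c1] <-] clt] : exists2 l, [set curve_length g c | c in
    [set c : R -> M | [/\ C1_curve S c, c 0 = q & c 1 = q']]] l & (l < (r / 4 / C)%:E)%E.
  by apply: ereal_inf_lt; apply: le_lt_trans dq _; rewrite lte_fin.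
have short (c' : R -> M) : (curve_length g c' <= (r / 4 / C)%:E)%E ->
    (C%:E * curve_length g c' <= (r / 4)%:E)%E.
  move=> H; have E : C * (r / 4 / C) = r / 4 by rewrite mulrC divfK ?gt_eqF.
  by rewrite -E EFinM lee_pmul2l.
have [iq' Bq'r incr] := main c cC c0 c1 (short _ (ltW clt)).
split=> //; first by have [_ []] := Br _ Bq'r; rewrite chartK.
have -> : (`|chart i q - chart i q'|%:E = C%:E * (C^-1 * `|chart i q - chart i q'|)%:E)%E.
  by rewrite -EFinM mulrA divff ?mul1r ?gt_eqF.
apply: lee_wpmul2l; [by rewrite lee_fin ltW|apply: le_ereal_inf_tmp] => _ [c' [c'C c'0 c'1] <-].
apply: (lee_invl_mul C0).
(* A long competitor is harmless: it is longer than the short curve [c], for which the estimate is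
   known. *)
have [sh|lg] := leP (curve_length g c') (r / 4 / C)%:E.
  have [_ _ E] := main c' c'C c'0 c'1 (short _ sh); exact: E.
have C0' : (0 <= C%:E)%E by rewrite lee_fin ltW.
exact: (le_trans incr (lee_wpmul2l C0' (ltW (lt_trans clt lg)))).
Qed.

End CurvesInCharts.

(** Points near [p0] together with small positive radii. By compactness of [M], a property that
    holds along this filter at each [p0] holds at all points for every small radius; see
    [compact_small]. *)
Definition local_small (R : realType) (M : topologicalType) (p0 : M) : set_system (M * R) :=
  filter_prod (nbhs p0) (at_right (0 : R)).

#[global] Instance local_small_filter (R : realType) (M : topologicalType) (p0 : M) :
  Filter (@local_small R M p0).
Proof. exact: filter_prod_filter. Qed.

Section LocalSmall.
Context {R : realType} {M : topologicalType}.

Lemma nbhs_setT (p : M) : nbhs p setT. Proof. exact: filterT. Qed.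

Lemma nbhs_setI (p : M) A B : nbhs p A -> nbhs p B -> nbhs p (A `&` B).
Proof. exact: filterI. Qed.

Lemma local_small_fst (p0 : M) (P : M -> Prop) : nbhs p0 P ->
  local_small p0 (fun z : M * R => P z.1).
Proof.
by move=> H; exists (P, setT) => //=; [split=> //; exact: filterT|move=> [x y] []].
Qed.

Lemma local_small_snd (p0 : M) (P : R -> Prop) : at_right (0 : R) P ->
  local_small p0 (fun z : M * R => P z.2).
Proof.
by move=> H; exists (setT, P) => //=; [split=> //; exact: filterT|move=> [x y] []].
Qed.

Lemma local_small_between (p0 : M) (e : R) : 0 < e ->
  local_small p0 (fun z : M * R => 0 < z.2 < e).
Proof.
move=> e0; apply: (@local_small_snd p0 (fun x => 0 < x < e)).
near=> rho; apply/andP; split; near: rho.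
  exact: nbhs_right_gt.
exact: nbhs_right_lt.
Unshelve. all: by end_near. Qed.

Lemma local_small_cvg_fst (p0 : M) : fst @ (@local_small R M p0) --> p0.
Proof. exact: cvg_fst. Qed.

Lemma compact_small (P : R -> M -> Prop) : compact [set: M] ->
  (forall p0, local_small p0 (fun z : M * R => P z.2 z.1)) ->
  \forall rho \near (0 : R)^'+, forall p, P rho p.
Proof.
move=> cM H; have := cM; rewrite compact_near_coveringP.
move=> /(_ R (at_right (0 : R)) P _ (fun p _ => H p)).
by apply: filterS => k A p; exact: A.
Qed.

End LocalSmall.

Lemma sub_subl (V : zmodType) (c a b : V) : a - b = (c - b) - (c - a).
Proof. by rewrite opprB [RHS]addrC addrA subrK. Qed.

(** * Uniform properties of the distance on a compact manifold *)

Section ManifoldDistance.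
Context {R : realType} {n : nat} {M : topologicalType}.
Variable S : smooth_manifold R n M.
Variable g : riemannian_metric S.
Hypothesis cM : compact [set: M].
Implicit Types (i j k : chart_index S) (p q : M) (u v w : 'rV[R]_n).

Lemma rdist_refl p : rdist g p p = 0%E.
Proof.
have [C C0 [V Vp H]] := rdist_le_chart g (chart_atP S p).
have Vpp := nbhs_singleton Vp.
have [_] := H _ _ Vpp Vpp; rewrite subrr normr0 mulr0 => A.
by apply/eqP; rewrite eq_le A rdist_ge0.
Qed.

Lemma finite_nbhs_cover (U : M -> set M) : (forall p, nbhs p (U p)) ->
  exists (I : finType) (e : I -> M), forall p, exists a : I, U (e a) p.
Proof.
move=> Up.
(* The filter of finite sets directed by inclusion: the compactness criterion then yields one finite
   set that serves all points. *)
pose F : set_system (seq M) := fun P => exists s0 : seq M, forall s : seq M, {subset s0 <= s} -> P s.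
have FF : Filter F.
  split.
  - by exists [::].
  - move=> P Q [s1 P1] [s2 P2]; exists (s1 ++ s2) => s ss; split.
      by apply: P1 => x xs; apply: ss; rewrite mem_cat xs.
    by apply: P2 => x xs; apply: ss; rewrite mem_cat xs orbT.
  - by move=> P Q PQ [s1 P1]; exists s1 => s ss; apply: PQ; exact: P1.
have := cM; move=> /compact_near_coveringP /(_ _ F (fun (s : seq M) p => exists2 a, a \in s & U a p) FF) [].
  move=> p _; exists (U p, [set s : seq M | p \in s]) => /=.
    by split; [exact: Up|exists [:: p] => s ps; apply: ps; rewrite inE].
  by move=> [q s] /= [Uq ps]; exists p.
move=> s /(_ s (fun x xs => xs)) H.
exists 'I_(size s), (tnth (in_tuple s)) => p.
have [a /(nthP a)[m ms <-] Uap] := H p I.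
by exists (Ordinal ms); rewrite (tnth_nth a).
Qed.

(** A chart around each point such that a property along points tending to [p0] need only be proved
    for each fixed chart around [p0]. The preferred charts [chart_at] may fail this, as infinitely
    many of them can occur near [p0]. *)
Definition chart_selector (kappa : M -> chart_index S) :=
  (forall p, chart_dom (kappa p) p) /\
  forall Z (F : set_system Z) (FF : Filter F) (h : Z -> M) p0
    (P : chart_index S -> Z -> Prop), h @ F --> p0 ->
    (forall i, chart_dom i p0 -> F (fun z => P i z)) -> F (fun z => P (kappa (h z)) z).

(** Finitely many closed neighbourhoods inside chart domains cover [M]. Those that miss [p0] are
    avoided near [p0], so the charts selected there all have [p0] in their domain. *)
Lemma chart_selector_exists : exists kappa, chart_selector kappa.
Proof.
have hM := manifold_hausdorff S.
have UH p : {U : set M | [/\ nbhs p U, closed U & U `<=` chart_dom (chart_at S p)]}.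
  apply: cid.
  have [B Bp cB] := @compact_regular M p setT hM cM filterT _ (chart_dom_nbhs (chart_atP S p)).
  exists (closure B); split=> //; last exact: closed_closure.
  by apply: filterS Bp; exact: subset_closure.
pose U p := sval (UH p).
have [I [e cov]] := @finite_nbhs_cover U (fun p => let: And3 A _ _ := svalP (UH p) in A).
pose c p := sval (cid (cov p)); have cP p : U (e (c p)) p := svalP (cid (cov p)).
exists (fun p => chart_at S (e (c p))); split.
  by move=> p; have [_ _] := svalP (UH (e (c p))); apply; exact: cP.
move=> Z F FF h p0 P hp0 H.
have : F (fun z => forall a : I, U (e a) (h z) -> P (chart_at S (e a)) z).
  apply: filter_forall => a; have [Una Uc Ud] := svalP (UH (e a)).
  have [Up0|nUp0] := pselect (U (e a) p0).
    by apply: filterS (H _ (Ud _ Up0)) => z.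
  have : F (fun z => ~ U (e a) (h z)).
    by apply: (hp0 (~` U (e a))); apply: open_nbhs_nbhs; split=> //; exact: closed_openC.
  by apply: filterS => z.
by apply: filterS => z; apply; exact: cP.
Qed.

Lemma rdist_chart_equiv i p0 : chart_dom i p0 -> exists2 C : R, 0 < C &
  forall V : set M, nbhs p0 V -> local_small p0 (fun z : M * R =>
    [/\ chart_dom i z.1, V z.1 & forall q' q'' r, r <= z.2 ->
      (rdist g z.1 q' <= r%:E)%E -> (rdist g z.1 q'' <= r%:E)%E ->
      [/\ V q', V q'', chart_dom i q', chart_dom i q'' &
      [/\ (`|chart i z.1 - chart i q'|%:E <= C%:E * rdist g z.1 q')%E,
       `|chart i z.1 - chart i q'| <= C * r &
       (rdist g q' q'' <= (C * `|chart i q' - chart i q''|)%:E)%E]]]).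
Proof.
move=> ip; have [C1 C10 [V1 V1p H1]] := rdist_le_chart g ip.
have [C2 C20 H2] := rdist_ge_chart g ip.
pose C := Num.max C1 C2.
have C0 : 0 < C by rewrite lt_max C10.
exists C => // V Vp.
have H5 : local_small p0 (fun z : M * R => forall q', (rdist g z.1 q' <= z.2%:E)%E ->
      [/\ (V `&` V1) q', chart_dom i z.1, chart_dom i q' &
       (`|chart i z.1 - chart i q'|%:E <= C2%:E * rdist g z.1 q')%E]).
  exact: (H2 _ (filterI Vp V1p)).
have H3 := @local_small_fst R _ _ _ Vp.
have H4 := @local_small_fst R _ _ _ (chart_dom_nbhs ip).
apply: filterS3 H3 H4 H5 => -[q rho] /= Vq iq H; split=> //.
move=> q' q'' r rrho dq' dq''.
have le1 (x : M) : (rdist g q x <= r%:E -> rdist g q x <= rho%:E)%E.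
  by move=> /le_trans; apply; rewrite lee_fin.
have [[Vq' V1q'] _ iq' E1] := H q' (le1 _ dq').
have [[Vq'' V1q''] _ iq'' _] := H q'' (le1 _ dq'').
have E2 : (`|chart i q - chart i q'|%:E <= C%:E * rdist g q q')%E.
  apply: (le_trans E1); apply: lee_wpmul2r; first exact: rdist_ge0.
  by rewrite lee_fin le_max lexx orbT.
split=> //; split=> //.
  rewrite -lee_fin EFinM; apply: (le_trans E2); apply: lee_wpmul2l => //.
  by rewrite lee_fin ltW.
have [_ E3] := H1 _ _ V1q' V1q''; apply: (le_trans E3).
by rewrite lee_fin ler_wpM2r// le_max lexx.
Qed.

(** The substitute for symmetry and the triangle inequality. One small [rho] is both the admissible
    radius and, inverted, the constant. *)
Lemma rdist_quasi_triangle : \forall rho \near (0 : R)^'+, forall x y z r, r <= rho ->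
  (rdist g x y <= r%:E)%E -> (rdist g x z <= r%:E)%E -> (rdist g y z <= (rho^-1 * r)%:E)%E.
Proof.
apply: compact_small => // p0.
have [C C0 H] := rdist_chart_equiv (chart_atP S p0).
have H1 := H setT (nbhs_setT p0).
have CC0 : 0 < (C * (2 * C))^-1 by rewrite invr_gt0 !mulr_gt0.
have H2 := local_small_between p0 CC0.
apply: filterS2 H1 H2 => -[x rho] /= [_ _ H1] /andP[rho0 rhoC] y z r rr dy dz.
have r0 : 0 <= r by rewrite -lee_fin (le_trans (rdist_ge0 g x y)).
have [_ _ _ _ [_ A D]] := H1 y z r rr dy dz.
have [_ _ _ _ [_ B _]] := H1 z y r rr dz dy.
apply: (le_trans D); rewrite lee_fin; apply: (@le_trans _ _ (C * (2 * C) * r)).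
  rewrite -mulrA; apply: ler_wpM2l; [exact: ltW|rewrite -mulrA mulr_natl mulr2n].
  have -> : chart (chart_at S p0) y - chart (chart_at S p0) z =
     (chart (chart_at S p0) x - chart (chart_at S p0) z) -
     (chart (chart_at S p0) x - chart (chart_at S p0) y).
    exact: sub_subl.
  by apply: (le_trans (ler_normB _ _)); exact: lerD.
apply: ler_wpM2r => //; rewrite -[leLHS]invrK lef_pV2 ?posrE ?ltW//.
Qed.

Lemma rdist_unif_continuous (h : M -> M) (e : R) : continuous h -> 0 < e ->
  \forall rho \near (0 : R)^'+, forall p q, (rdist g p q <= rho%:E)%E ->
    (rdist g (h p) (h q) <= e%:E)%E.
Proof.
move=> hc e0; apply: compact_small => // p0.
have [C1 C10 [V1 V1p H1]] := rdist_le_chart g (chart_atP S (h p0)).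
set j := chart_at S (h p0) in H1.
pose d := e / (2 * C1); have d0 : 0 < d by rewrite divr_gt0// mulr_gt0.
pose V := [set q | V1 (h q) /\ ball (chart j (h p0)) d (chart j (h q))].
have Vp : nbhs p0 V.
  apply: filterI; first exact: hc.
  have A := cvg_comp _ _ (hc p0) (chart_continuous (chart_atP S (h p0))).
  exact: (A _ (nbhsx_ballx _ _ d0)).
have [C C0 H] := rdist_chart_equiv (chart_atP S p0).
apply: filterS (H V Vp) => -[p rho] /= [_ Vp' H2] q dq.
have [Vq _ _ _ _] := H2 q q rho (lexx _) dq dq.
have [_ D] := H1 _ _ Vp'.1 Vq.1; apply: (le_trans D); rewrite lee_fin.
have [[_ Bp] [_ Bq]] := (Vp', Vq).
have : `|chart j (h p) - chart j (h q)| <= d + d.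
  have -> : chart j (h p) - chart j (h q) =
     (chart j (h p0) - chart j (h q)) - (chart j (h p0) - chart j (h p)).
    exact: sub_subl.
  apply: (le_trans (ler_normB _ _)); move: Bp Bq; rewrite -!ball_normE /ball_/= => Bp Bq.
  by apply: lerD; exact: ltW.
move=> /(ler_wpM2l (ltW C10)) /le_trans; apply.
by rewrite /d le_eqVlt; apply/orP; left; apply/eqP; field; rewrite gt_eqF.
Qed.

(** * Displacements between nearby points *)

Section Displacement.
Variable kappa : M -> chart_index S.
Hypothesis kappaP : chart_selector kappa.

(* A substitute for the inverse of the exponential map at [p]; see [displacement_rdist]. *)
Definition displacement p q : 'rV[R]_n :=
  of_chart (kappa p) p (chart (kappa p) q - chart (kappa p) p).

(** Both estimates pass through the norm of the chart, with constants [C] and [C2]; for [rho] below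
    the inverse of their product, [rho^-1] can be the constant. *)
Lemma displacement_rdist : \forall rho \near (0 : R)^'+, forall p q, (rdist g p q <= rho%:E)%E ->
  (rdist g p q <= (rho^-1 * rnorm g p (displacement p q))%:E)%E /\
  ((rnorm g p (displacement p q))%:E <= (rho^-1)%:E * rdist g p q)%E.
Proof.
apply: compact_small => // p0.
apply: (kappaP.2 (M * R)%type (@local_small R M p0) _ (fun z : M * R => z.1) p0 (fun i z => forall q,
  (rdist g z.1 q <= z.2%:E)%E ->
  (rdist g z.1 q <= (z.2^-1 * rnorm g z.1 (of_chart i z.1 (chart i q - chart i z.1)))%:E)%E /\
  ((rnorm g z.1 (of_chart i z.1 (chart i q - chart i z.1)))%:E <= (z.2^-1)%:E * rdist g z.1 q)%E)).
  exact: local_small_cvg_fst.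
move=> i ip.
have [C C0 H] := rdist_chart_equiv ip; have H1 := H setT (nbhs_setT p0).
have [[W F] /= [Wp0 [C1 [_ C1F]]] WF] := rnorm_chart_bound g ip.
pose C2 := Num.max C1 1 + 1.
have C20 : 0 < C2 by rewrite /C2 ltr_pwDr// le_max ler01 orbT.
have FC : F C2 by apply: C1F; rewrite /C2 ltr_pwDr// le_max lexx.
have CC0 : 0 < (C * C2)^-1 by rewrite invr_gt0 !mulr_gt0.
have H2 := local_small_between p0 CC0.
have H3 := @local_small_fst R _ _ _ Wp0.
apply: filterS3 H1 H2 H3 => -[p rho] /= [_ _ H1] /andP[rho0 rhoC] Wp q dq.
have rC : C * C2 <= rho^-1.
  by rewrite -[leLHS]invrK lef_pV2 ?posrE ?ltW// invr_gt0 mulr_gt0.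
have [A B] := WF (p, C2) (conj Wp FC) (chart i q - chart i p); rewrite /= in A B.
have pp : (rdist g p p <= rho%:E)%E by rewrite rdist_refl lee_fin ltW.
have [_ _ _ _ [_ _ D]] := H1 p q rho (lexx _) pp dq.
have [_ _ _ _ [E _ _]] := H1 q p rho (lexx _) dq pp.
rewrite distrC in D; split.
  apply: (le_trans D); rewrite lee_fin; apply: (@le_trans _ _ (C * (C2 * rnorm g p
      (of_chart i p (chart i q - chart i p))))); first by rewrite ler_wpM2l// ltW.
  by rewrite mulrA ler_wpM2r// rnorm_ge0.
apply: (@le_trans _ _ (C2%:E * (C%:E * rdist g p q))%E).
  apply: (@le_trans _ _ (C2 * `|chart i q - chart i p|)%:E); first by rewrite lee_fin.
  rewrite EFinM; apply: lee_wpmul2l; first by rewrite lee_fin ltW.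
  by rewrite distrC.
rewrite muleA -EFinM; apply: lee_wpmul2r; first exact: rdist_ge0.
by rewrite lee_fin mulrC.
Unshelve. all: by end_near. Qed.

(** In charts at [p] and [h p] this is strict differentiability; [chart_selector], applied at source
    and target, reduces it to fixed charts around [p0] and [h p0]. *)
Lemma displacement_linearization (h : M -> M) (eta : R) : C1_map S h -> 0 < eta ->
  \forall rho \near (0 : R)^'+, forall p q, (rdist g p q <= rho%:E)%E ->
    rnorm g (h p) (displacement (h p) (h q) - tangent_map S h p (displacement p q))
      <= eta * rnorm g p (displacement p q).
Proof.
move=> hC eta0; have /C1_mapP[hc Hc] := hC; apply: compact_small => // p0.
apply: (kappaP.2 (M * R)%type (@local_small R M p0) _ (fun z : M * R => z.1) p0 (fun i z => forall q,
  (rdist g z.1 q <= z.2%:E)%E ->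
  rnorm g (h z.1) (displacement (h z.1) (h q) -
     tangent_map S h z.1 (of_chart i z.1 (chart i q - chart i z.1)))
   <= eta * rnorm g z.1 (of_chart i z.1 (chart i q - chart i z.1)))).
  exact: local_small_cvg_fst.
move=> i ip.
apply: (kappaP.2 (M * R)%type (@local_small R M p0) _ (fun z : M * R => h z.1) (h p0) (fun j z => forall q,
  (rdist g z.1 q <= z.2%:E)%E ->
  rnorm g (h z.1) (of_chart j (h z.1) (chart j (h q) - chart j (h z.1)) -
     tangent_map S h z.1 (of_chart i z.1 (chart i q - chart i z.1)))
   <= eta * rnorm g z.1 (of_chart i z.1 (chart i q - chart i z.1)))).
  exact: (cvg_comp _ _ (@local_small_cvg_fst R M p0) (hc p0)).
move=> j jp.
have [[W F] /= [Wp0 [C1 [_ C1F]]] WF] := rnorm_chart_bound g ip.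
have [[W' F'] /= [Wp0' [C1' [_ C1F']]] WF'] := rnorm_chart_bound g jp.
pose C2 := Num.max (Num.max C1 C1') 1 + 1.
have C20 : 0 < C2 by rewrite /C2 ltr_pwDr// le_max ler01 orbT.
have FC : F C2 by apply: C1F; rewrite /C2 ltr_pwDr// !le_max lexx.
have FC' : F' C2 by apply: C1F'; rewrite /C2 ltr_pwDr// !le_max lexx orbT.
(* Passing to the chart norm at [p] and back from it at [h p] costs a factor [C2] each. *)
have e0 : 0 < eta / (C2 * C2) by rewrite divr_gt0// mulr_gt0.
have [U Un HU] := c1_strict_diff_eq (Hc i j p0 ip jp) e0.
have V1 : \forall q \near p0, U (chart i q) by exact: (chart_continuous ip Un).
have V2 : \forall q \near p0, chart_dom j (h q) by exact: (hc p0 _ (chart_dom_nbhs jp)).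
have V3 : \forall q \near p0, W' (h q) by exact: (hc p0 _ Wp0').
have [C C0 H] := rdist_chart_equiv ip.
have H1 := H _ (nbhs_setI (nbhs_setI V1 V2) (nbhs_setI V3 Wp0)).
apply: filterS H1 => -[p rho] /= [iq [[Up jhp] [W'p Wp]] H1] q dq.
have [[[Uq jhq] _] _ iqq _ _] := H1 q q rho (lexx _) dq dq.
have E1 := tangent_of_chart (chart i q - chart i p) hC iq jhp.
have E2 := HU _ _ _ _ Up Uq (chrep_at h j iq) (chrep_at h j iqq).
have E3 := eq_trans (congr1 (fun X => of_chart j (h p) (chart j (h q) - chart j (h p)) - X) E1)
  (esym (of_chartB j (h p) (chart j (h q) - chart j (h p))
     ('d (chrep h i j) (chart i p) (chart i q - chart i p)))).
apply: (le_trans (le_of_eqr (congr1 (rnorm g (h p)) E3))).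
have [_ A] := WF' (h p, C2) (conj W'p FC') (chart j (h q) - chart j (h p) -
     'd (chrep h i j) (chart i p) (chart i q - chart i p)).
apply: (le_trans A).
have [B _] := WF (p, C2) (conj Wp FC) (chart i q - chart i p); rewrite /= in B.
have A1 := le_trans E2 (ler_wpM2l (ltW e0) B).
apply: (le_trans (ler_wpM2l (ltW C20) A1)).
rewrite le_eqVlt; apply/orP; left; apply/eqP; field.
by rewrite gt_eqF.
Qed.

End Displacement.

(** A colour is the index of a chart from a finite cover and a cell of a grid of mesh 1 / (k + 1) in
    it. By pigeonhole, colours bound the size of separated sets. *)
Lemma rdist_coloring : exists N : nat, forall k : nat, exists (T : finType) (c : M -> T),
  (#|T| <= N * k.+1 ^ n)%N /\ forall p q, c p = c q -> (rdist g p q <= (N%:R / k.+1%:R)%:E)%E.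
Proof.
have UH p : {CV : R * set M | [/\ 0 < CV.1, nbhs p CV.2 & forall q q', CV.2 q -> CV.2 q' ->
    `|chart (chart_at S p) q - chart (chart_at S p) p| < 1 /\
    (rdist g q q' <= (CV.1 * `|chart (chart_at S p) q - chart (chart_at S p) q'|)%:E)%E]}.
  apply: cid; have ip := chart_atP S p.
  have [C C0 [V Vp H]] := rdist_le_chart g ip.
  exists (C, V `&` [set q | ball (chart (chart_at S p) p) 1 (chart (chart_at S p) q)]).
  split=> //=.
    by apply: filterI => //; apply: (chart_continuous ip); exact: nbhsx_ballx.
  move=> q q' [Vq Bq] [Vq' _]; split; last by have [] := H _ _ Vq Vq'.
  by move: Bq; rewrite -ball_normE /ball_/= distrC.
have [I [e cov]] := @finite_nbhs_cover (fun p => (sval (UH p)).2)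
   (fun p => let: And3 _ A _ := svalP (UH p) in A).
pose c p := sval (cid (cov p)).
pose CC a := (sval (UH (e a))).1.
pose B := (Num.truncn (\sum_a CC a) + 1)%N.
(* [N] has to bound both the Lipschitz constants and the factor in the number of cells. *)
pose N := (B + #|I| * 2 ^ n)%N.
have CCB a : CC a <= N%:R.
  have CC0 b : 0 <= CC b by have [/ltW] := svalP (UH (e b)).
  have A : CC a <= \sum_a CC a by rewrite (bigD1 a)//= lerDl sumr_ge0.
  apply: (le_trans A); apply: (@le_trans _ _ B%:R).
    by rewrite /B addn1; apply: ltW; exact: truncnS_gt.
  by rewrite ler_nat leq_addr.
exists N => k.
exists (I * {ffun 'I_n -> 'I_(2 * k.+1)})%type.
pose x p := chart (chart_at S (e (c p))) p - chart (chart_at S (e (c p))) (e (c p)).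
have x1 p (j : 'I_n) : `|x p ord0 j| < 1.
  have [_ _ H] := svalP (UH (e (c p))).
  have Vp : (sval (UH (e (c p)))).2 p := svalP (cid (cov p)).
  by have [A _] := H p p Vp Vp; exact: le_lt_trans (normr_rVE _ j) A.
(* Coordinates relative to the centre lie in (-1, 1); shifted by 1 they fall into 2 (k + 1)
   cells. *)
pose t p (j : 'I_n) := Num.truncn ((x p ord0 j + 1) * k.+1%:R).
have xpos p (j : 'I_n) : 0 <= (x p ord0 j + 1) * k.+1%:R.
  rewrite mulr_ge0//; have := x1 p j; rewrite ltr_norml => /andP[+ _]; lra.
have tlt p (j : 'I_n) : (t p j < 2 * k.+1)%N.
  rewrite truncn_lt_nat// natrM ltr_pM2r ?ltr0n//.
  have := x1 p j; rewrite ltr_norml => /andP[_ +]; lra.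
exists (fun p => (c p, [ffun j => Ordinal (tlt p j)])); split.
  rewrite card_prod card_ffun !card_ord expnMn mulnA /N leq_mul2r; apply/orP; right.
  exact: leq_addl.
move=> p q [Ec /ffunP Et].
have [_ _ H] := svalP (UH (e (c p))).
have Vp : (sval (UH (e (c p)))).2 p := svalP (cid (cov p)).
have Vq : (sval (UH (e (c p)))).2 q by rewrite Ec; exact: svalP (cid (cov q)).
have [_ D] := H p q Vp Vq; apply: (le_trans D); rewrite lee_fin.
apply: ler_pM => //; [by have [/ltW] := svalP (UH (e (c p)))|exact: CCB|].
apply: normr_rV_le => // j; rewrite !mxE.
have := Et j; rewrite !ffunE => /(congr1 val) /= E.
have /andP[p1 p2] := truncn_itv (xpos p j); have /andP[q1 q2] := truncn_itv (xpos q j).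
rewrite -/(t p j) in p1 p2; rewrite -/(t q j) -E in q1 q2.
have xE : chart (chart_at S (e (c p))) p ord0 j - chart (chart_at S (e (c p))) q ord0 j =
   x p ord0 j - x q ord0 j.
  by rewrite /x -Ec !mxE; ring.
rewrite xE -[leRHS]mul1r ler_pdivlMr ?ltr0n// -(@ger0_norm _ k.+1%:R)// -normrM.
rewrite ler_norml; rewrite -natr1 in p2 q2; apply/andP; split; lra.
Qed.

End ManifoldDistance.

(** * Lyapunov norms and cones *)

Section Sequences.
Context {R : realType}.

(** Here [k] counts steps into the past, and [a], [b] are the stable and unstable sizes. If the cone
    condition fails at 0 it fails at every [k]; the stable part then dominates the error and grows
    geometrically into the past, against its bound [B]. *)
Lemma cone_sequence (a b : nat -> R) (B lam al eta : R) :
  0 < lam < 1 -> 0 < al <= 1 -> 0 <= eta <= al * (1 - lam) / 8 ->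
  (forall k, 0 <= a k <= B) -> (forall k, 0 <= b k) ->
  (forall k, a k <= lam * a k.+1 + eta * (a k.+1 + b k.+1)) ->
  (forall k, b k.+1 <= lam * (b k + eta * (a k.+1 + b k.+1))) ->
  a 0%N <= al * b 0%N.
Proof.
move=> /andP[l0 l1] /andP[al0 al1] /andP[e0 e1] aB b0 Ha Hb.
rewrite leNgt; apply/negP => bad.
have e2 : eta <= (1 - lam) / 8.
  apply: (le_trans e1); rewrite ler_wpM2r ?invr_ge0// ler_piMl// subr_ge0 ltW//.
(* Contrapositive: a forward step maps the cone into itself. *)
have step k : al * b k < a k -> al * b k.+1 < a k.+1.
  move=> H; rewrite ltNge; apply/negP => H1.
  have /andP[a0 _] := aB k.+1; have := Ha k; have := Hb k; have := b0 k; have := b0 k.+1.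
  move=> B1 B0 Hbk Hak.
  have ab : a k.+1 + b k.+1 <= 2 * b k.+1.
    have : al * b k.+1 <= b k.+1 by rewrite ler_piMl.
    lra.
  have h1 : eta * (a k.+1 + b k.+1) <= eta * (2 * b k.+1) by rewrite ler_wpM2l.
  have h2 : lam * a k.+1 <= lam * (al * b k.+1) by rewrite ler_wpM2l// ltW.
  have h3 : lam * (eta * (a k.+1 + b k.+1)) <= eta * (2 * b k.+1).
    apply: le_trans h1; rewrite ler_piMl//; last exact: ltW.
    by rewrite mulr_ge0// addr_ge0.
  have h4 : eta * (2 * b k.+1) <= (1 - lam) / 8 * (2 * b k.+1).
    by rewrite ler_wpM2r// mulr_ge0.
  have h5 : eta * (2 * b k.+1) <= al * (1 - lam) / 8 * (2 * b k.+1).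
    by rewrite ler_wpM2r// mulr_ge0.
  have h6 : a k <= al * ((lam + (1 - lam) / 4) * b k.+1).
    apply: (le_trans Hak); apply: (le_trans (lerD h2 (le_trans h1 h5))).
    by rewrite le_eqVlt; apply/orP; left; apply/eqP; field.
  have h7 : (lam + (1 - lam) / 4) * b k.+1 <= b k.
    have h8 : (1 - (1 - lam) / 4) * b k.+1 <= lam * b k.
      rewrite mulrDr in Hbk; have := le_trans Hbk (lerD (lexx _) (le_trans h3 h4)).
      rewrite mulrBl mul1r => h; lra.
    have h9 : (lam + (1 - lam) / 4) * b k.+1 <= (1 - (1 - lam) / 4) * b k.+1.
      apply: ler_wpM2r => //; lra.
    apply: (le_trans h9); apply: (le_trans h8).
    by rewrite ler_piMl// ltW.
  have : a k <= al * b k by apply: (le_trans h6); rewrite ler_wpM2l// ltW.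
  by rewrite leNgt H.
have all k : al * b k < a k by elim: k => // k; exact: step.
(* A rate between [lam] and 1 leaves room for the error. *)
pose lam' := (1 + lam) / 2.
have l'0 : 0 < lam' by rewrite /lam'; lra.
have l'1 : lam' < 1 by rewrite /lam'; lra.
have grow k : a k <= lam' * a k.+1.
  apply: (le_trans (Ha k)); have := all k.+1; have /andP[a0 _] := aB k.+1 => H.
  have h1 : eta * (a k.+1 + b k.+1) <= (1 - lam) / 4 * a k.+1.
    have h2 : eta * (a k.+1 + b k.+1) <= al * (1 - lam) / 8 * (a k.+1 + b k.+1).
      by rewrite ler_wpM2r// addr_ge0.
    apply: (le_trans h2).
    have h3 : al * (a k.+1 + b k.+1) <= 2 * a k.+1.
      have : al * a k.+1 <= a k.+1 by rewrite ler_piMl.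
      rewrite mulrDr; lra.
    have -> : al * (1 - lam) / 8 * (a k.+1 + b k.+1) = (1 - lam) / 8 * (al * (a k.+1 + b k.+1)) by ring.
    have -> : (1 - lam) / 4 * a k.+1 = (1 - lam) / 8 * (2 * a k.+1) by field.
    apply: ler_wpM2l => //; lra.
  have : 0 <= (1 - lam) / 4 * a k.+1 by rewrite mulr_ge0//; lra.
  rewrite /lam' => ?; lra.
have bound k : a 0%N <= lam' ^+ k * B.
  have : a 0%N <= lam' ^+ k * a k.
    elim: k => [|k IH]; first by rewrite expr0 mul1r.
    by apply: (le_trans IH); rewrite exprSr -mulrA ler_pM2l ?exprn_gt0.
  move=> /le_trans; apply; rewrite ler_pM2l ?exprn_gt0//.
  by have /andP[_] := aB k.
have a00 : 0 < a 0%N by apply: le_lt_trans bad; rewrite mulr_ge0// ltW.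
have lim : (fun k => lam' ^+ k * B) @ \oo --> 0 * B.
  by apply: cvgM; [apply: cvg_expr; rewrite ger0_norm// ltW|exact: cvg_cst].
rewrite mul0r in lim.
have [k Hk] := filter_ex (cvgr_lt 0 lim _ a00).
by have := lt_le_trans Hk (bound k); rewrite ltxx.
Qed.

End Sequences.

Section HyperbolicDynamics.
Context {R : realType} {n : nat} {M : topologicalType}.
Variable S : smooth_manifold R n M.
Variable g : riemannian_metric S.
Variables f finv : M -> M.
Hypothesis fC : C1_map S f.
Hypothesis finvC : C1_map S finv.
Hypothesis fK : cancel f finv.
Hypothesis finvK : cancel finv f.
Implicit Types (p q : M) (u v w : 'rV[R]_n).

Lemma tangent_finv_f p v : tangent_map S finv (f p) (tangent_map S f p v) = v.
Proof.
rewrite -tangent_map_comp//; have -> : finv \o f = id by apply/funext => x /=; rewrite fK.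
exact: tangent_map_id.
Qed.

Lemma tangent_f_finv p v : tangent_map S f (finv p) (tangent_map S finv p v) = v.
Proof.
rewrite -tangent_map_comp//; have -> : f \o finv = id by apply/funext => x /=; rewrite finvK.
exact: tangent_map_id.
Qed.

Lemma tangent_iterS (h : M -> M) k p v : C1_map S h ->
  tangent_map S (iter k.+1 h) p v = tangent_map S h (iter k h p) (tangent_map S (iter k h) p v).
Proof. by move=> hC; exact: tangent_map_comp hC (C1_map_iter k hC). Qed.

Lemma tangent_iterSr (h : M -> M) k p v : C1_map S h ->
  tangent_map S (iter k.+1 h) p v = tangent_map S (iter k h) (h p) (tangent_map S h p v).
Proof.
move=> hC; have -> : iter k.+1 h = iter k h \o h by apply/funext => x; rewrite iterSr.
exact: tangent_map_comp (C1_map_iter k hC) hC.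
Qed.

Lemma tangent_iter_finv_f k p v :
  tangent_map S (iter k finv) (iter k f p) (tangent_map S (iter k f) p v) = v.
Proof.
elim: k p v => [|k IH] p v; first by rewrite !tangent_map_id.
by rewrite tangent_iterSr// tangent_iterS// iterS fK tangent_finv_f IH.
Qed.

Lemma tangent_iter_f_finv k p v :
  tangent_map S (iter k f) (iter k finv p) (tangent_map S (iter k finv) p v) = v.
Proof.
elim: k p v => [|k IH] p v; first by rewrite !tangent_map_id.
by rewrite tangent_iterSr// tangent_iterS// iterS finvK tangent_f_finv IH.
Qed.

Lemma iter_finv_f k p : iter k finv (iter k f p) = p.
Proof. by elim: k p => // k IH p; rewrite iterSr iterS fK IH. Qed.

Lemma iter_f_finv k p : iter k f (iter k finv p) = p.
Proof. by elim: k p => // k IH p; rewrite iterSr iterS finvK IH. Qed.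

(** * Lyapunov norms *)

Section AdaptedNorm.
Variable h : M -> M.
Hypothesis hC : C1_map S h.
Variables C lam : R.
Hypothesis lam01 : 0 < lam < 1.

(** On such vectors the supremum in [lyap] is finite. The map [h] will be [f] on the stable and
    [finv] on the unstable bundle. *)
Definition contracted p v := forall k : nat,
  rnorm g (iter k h p) (tangent_map S (iter k h) p v) <= C * lam ^+ k * rnorm g p v.

(* The Lyapunov norm absorbs the constant [C], so that a single step of [h] already contracts it. *)
Definition lyap p v : R :=
  sup [set lam ^- k * rnorm g (iter k h p) (tangent_map S (iter k h) p v) | k in [set: nat]].

Let lam0 : 0 < lam. Proof. by have /andP[] := lam01. Qed.

Lemma lyap_set0 p v : [set lam ^- k * rnorm g (iter k h p) (tangent_map S (iter k h) p v) | k in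
  [set: nat]] !=set0.
Proof. by exists (lam ^- 0 * rnorm g (iter 0 h p) (tangent_map S (iter 0 h) p v)), 0%N. Qed.

Lemma lyap_ub p v : contracted p v -> ubound [set lam ^- k * rnorm g (iter k h p)
  (tangent_map S (iter k h) p v) | k in [set: nat]] (C * rnorm g p v).
Proof.
move=> H _ [k _ <-]; rewrite mulrC ler_pdivrMr ?exprn_gt0//.
by apply: (le_trans (H k)); rewrite mulrAC.
Qed.

Lemma lyap_le p v : contracted p v -> lyap p v <= C * rnorm g p v.
Proof. by move=> H; apply: ge_sup; [exact: lyap_set0|exact: lyap_ub]. Qed.

Lemma lyap_term p v k : contracted p v ->
  lam ^- k * rnorm g (iter k h p) (tangent_map S (iter k h) p v) <= lyap p v.
Proof.
by move=> H; apply: sup_ubound; [exists (C * rnorm g p v); exact: lyap_ub|exists k].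
Qed.

Lemma lyap_ge p v : contracted p v -> rnorm g p v <= lyap p v.
Proof.
by move=> H; have := lyap_term 0 H; rewrite expr0 invr1 mul1r tangent_map_id.
Qed.

Lemma lyap_ge0 p v : contracted p v -> 0 <= lyap p v.
Proof. by move=> /lyap_ge; apply: le_trans; exact: rnorm_ge0. Qed.

Lemma lyapD p v w : contracted p v -> contracted p w -> lyap p (v + w) <= lyap p v + lyap p w.
Proof.
move=> Hv Hw; apply: ge_sup; first exact: lyap_set0.
move=> _ [k _ <-]; rewrite tangent_mapD.
apply: le_trans (lerD (lyap_term k Hv) (lyap_term k Hw)).
by rewrite -mulrDr; apply: ler_wpM2l; [rewrite invr_ge0 exprn_ge0// ltW|exact: ler_rnormD].
Qed.

(** The terms of the supremum at [h p] are those at [p] with index shifted by one, times [lam]. *)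
Lemma lyap_step p v : contracted p v -> lyap (h p) (tangent_map S h p v) <= lam * lyap p v.
Proof.
move=> H; apply: ge_sup; first exact: lyap_set0.
move=> _ [k _ <-]; rewrite -tangent_iterSr// -iterSr mulrC ler_pdivrMr ?exprn_gt0//.
rewrite mulrAC -exprS mulrC -ler_pdivrMr ?exprn_gt0// mulrC.
exact: lyap_term.
Qed.

Lemma lyap0 p : lyap p 0 = 0.
Proof.
have H : contracted p 0 by move=> k; rewrite tangent_map0 !rnorm0 mulr0.
apply/eqP; rewrite eq_le lyap_ge0// andbT.
by apply: (le_trans (lyap_le H)); rewrite rnorm0 mulr0.
Qed.

End AdaptedNorm.

End HyperbolicDynamics.

(** * Pressure *)

Section SeqSums.
Context {R : realType} {T : choiceType}.

Lemma esum_le_seqP (F : set T) (a : T -> \bar R) (y : \bar R) : (forall x, (0 <= a x)%E) ->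
  (\esum_(x in F) a x <= y)%E <->
  forall s : seq T, uniq s -> {in s, forall x, F x} -> (\sum_(x <- s) a x <= y)%E.
Proof.
move=> a0; split=> [H s us sF|H].
  apply: le_trans H; apply: esum_ge; exists [set` s]; last by rewrite -fsbig_seq.
  by split; [exact: finite_seq|move=> x /= xs; exact: sF].
apply: ge_ereal_sup => _ [A [fA AF] <-].
rewrite fsbig_finite//; apply: H; first exact: finmap.fset_uniq.
by move=> x; rewrite in_fset_set// inE; exact: AF.
Qed.

End SeqSums.

Section PressureBounds.
Context {R : realType} {n : nat} {M : topologicalType}.
Variable S : smooth_manifold R n M.
Variable g : riemannian_metric S.
Variable f : M -> M.
Variable L : set M.

Definition orbit_weight (phi : M -> \bar R) k x : \bar R :=
  expeR (\sum_(j < k) phi (iter j f x))%E.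

(* The pressure is at most [a] iff this holds for every [b > a]; see [pressure_leP]. *)
Definition subexp_bound (w : nat -> M -> \bar R) (b : R) :=
  forall eps : R, 0 < eps -> \forall k \near \oo, forall s : seq M, uniq s ->
    {in s, forall x, L x} -> Defs.separated g f k eps [set` s] ->
    (\sum_(x <- s) w k x <= (expR (k%:R * b))%:E)%E.

Lemma separated_sub k eps (F G : set M) : G `<=` F -> Defs.separated g f k eps F ->
  Defs.separated g f k eps G.
Proof. by move=> GF H x y /GF Fx /GF Fy; exact: H. Qed.

Lemma lne_le_expR (y : \bar R) (c : R) : (0 <= y)%E ->
  (lne y <= c%:E)%E = (y <= (expR c)%:E)%E.
Proof.
move=> y0; have E : lne (expR c)%:E = c%:E by rewrite lne_EFin ?expR_gt0// expRK.
rewrite -{1}E lee_lne//; first by rewrite in_itv/= leey y0.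
by rewrite in_itv/= leey lee_fin expR_ge0.
Qed.

Lemma pressure_at_le (phi : M -> \bar R) (eps a : R) :
  (pressure_at g f L phi eps <= a%:E)%E <-> forall b, a < b ->
    \forall k \near \oo, forall s : seq M, uniq s ->
    {in s, forall x, L x} -> Defs.separated g f k eps [set` s] ->
    (\sum_(x <- s) orbit_weight phi k x <= (expR (k%:R * b))%:E)%E.
Proof.
pose Z k := ereal_sup [set (\esum_(x in F) orbit_weight phi k x)%E | F in
      [set F : set M | F `<=` L /\ Defs.separated g f k eps F]].
have w0 k x : (0 <= orbit_weight phi k x)%E by exact: expeR_ge0.
have Z0 k : (0 <= Z k)%E.
  apply: ereal_sup_ubound; exists set0; last by rewrite esum_set0.
  by split=> // x y.
have ZP k y : (Z k <= y)%E <-> forall s : seq M, uniq s ->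
    {in s, forall x, L x} -> Defs.separated g f k eps [set` s] ->
    (\sum_(x <- s) orbit_weight phi k x <= y)%E.
  split=> [H s us sL ss|H].
    apply: le_trans H; apply: (@le_trans _ _ (\esum_(x in [set` s]) orbit_weight phi k x)%E).
      by apply: esum_ge; exists [set` s]; [split=> //; exact: finite_seq|rewrite -fsbig_seq].
    by apply: ereal_sup_ubound; exists [set` s] => //; split=> // x /= /sL.
  apply: ge_ereal_sup => _ [F [FL Fs] <-]; apply/esum_le_seqP => // s us sF.
  apply: H => // [x /sF/FL//|]; apply: separated_sub Fs => x /=; exact: sF.
have kP k (b : R) : (0 < k)%N -> ((k%:R^-1)%:E * lne (Z k) <= b%:E)%E <->
    (Z k <= (expR (k%:R * b))%:E)%E.
  move=> k0; have k0' : 0 < k%:R :> R by rewrite ltr0n.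
  by rewrite -lne_le_expR// lee_pdivrMl.
rewrite /pressure_at -/Z; split=> [H b ab|H].
  have : (limn_esup (fun k => (k%:R^-1)%:E * lne (Z k))%E < b%:E)%E.
    by apply: le_lt_trans H _; rewrite lte_fin.
  move=> /ereal_inf_lt[_ [A A0 <-] supA].
  (* At [k = 0] the factor [k^-1] is 0, and a bound on the quotient says nothing. *)
  have A1 : \forall k \near \oo, (0 < k)%N by exists 1%N.
  apply: filterS2 A0 A1 => k Ak k0; apply/ZP/kP => //.
  by apply: ltW; apply: le_lt_trans supA; apply: ereal_sup_ubound; exists k.
apply/lee_addgt0Pr => e e0; rewrite -EFinD.
have A0 := H (a + e); rewrite ltrDl in A0; have {}A0 := A0 e0.
have A1 : \forall k \near \oo, (0 < k)%N by exists 1%N.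
have A2 : \forall k \near \oo, ((k%:R^-1)%:E * lne (Z k) <= (a + e)%:E)%E.
  by apply: filterS2 A0 A1 => k Hk k0; apply/kP => //; apply/ZP.
apply: ge_ereal_inf; exists (ereal_sup ((fun k => (k%:R^-1)%:E * lne (Z k))%E @`
    [set k | ((k%:R^-1)%:E * lne (Z k) <= (a + e)%:E)%E])).
  by eexists; first exact: A2.
by apply: ge_ereal_sup => _ [k Hk <-].
Qed.

Lemma pressure_at_nonincreasing phi (e1 e2 : R) : e1 <= e2 ->
  (pressure_at g f L phi e2 <= pressure_at g f L phi e1)%E.
Proof.
move=> e12.
apply: le_ereal_inf_tmp => _ [A A0 <-].
apply: ge_ereal_inf; eexists; first by exists A.
apply: ge_ereal_sup => _ [k Ak <-].
apply: (@le_trans _ _ ((k%:R^-1)%:E * lne (ereal_sup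
    [set (\esum_(x in F) expeR (\sum_(j < k) phi (iter j f x)))%E | F in
      [set F : set M | F `<=` L /\ Defs.separated g f k e1 F]]))%E); last first.
  by apply: ereal_sup_ubound; exists k.
apply: lee_wpmul2l; first by rewrite lee_fin.
have pos e : (0 <= ereal_sup
    [set (\esum_(x in F) expeR (\sum_(j < k) phi (iter j f x)))%E | F in
      [set F : set M | F `<=` L /\ Defs.separated g f k e F]])%E.
  apply: ereal_sup_ubound; exists set0; last by rewrite esum_set0.
  by split=> // x y.
rewrite lee_lne ?in_itv/= ?leey ?pos//.
apply: ge_ereal_sup => y [F [FL Fs] Fy]; apply: ereal_sup_ubound; exists F => //; split=> //.
move=> x z Fx Fz xz; apply: le_lt_trans (Fs x z Fx Fz xz).
by rewrite lee_fin.
Qed.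

(** As the scale decreases the pressure at that scale increases, so the limit is a supremum and each
    scale can be bounded separately. *)
Lemma pressure_leP phi (a : R) : (pressure g f L phi <= a%:E)%E <->
  forall b, a < b -> subexp_bound (orbit_weight phi) b.
Proof.
have cv := @nonincreasing_at_right_cvge R (pressure_at g f L phi) 0 +oo%O isT.
have E : pressure g f L phi = ereal_sup (pressure_at g f L phi @` `]0, +oo[).
  apply: cvg_lim => //; apply: cv.
  by move=> x y _ _ xy; exact: pressure_at_nonincreasing.
rewrite E; split=> [H b ab eps eps0|H].
  apply: (pressure_at_le phi eps a).1 => //; apply: le_trans H.
  by apply: ereal_sup_ubound; exists eps => //=; rewrite in_itv/= eps0.
apply: ge_ereal_sup => _ [eps /= eps0 <-]; rewrite in_itv/= andbT in eps0.
by apply/pressure_at_le => b ab; exact: H.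
Qed.

Lemma subexp_bound_le w b c : b <= c -> subexp_bound w b -> subexp_bound w c.
Proof.
move=> bc H eps e0; apply: filterS (H eps e0) => k Hk s us sL ss.
apply: (le_trans (Hk s us sL ss)); rewrite lee_fin ler_expR.
by rewrite ler_wpM2l.
Qed.

Lemma pressure_lt0P phi : (pressure g f L phi < 0)%E <->
  exists2 c : R, 0 < c & subexp_bound (orbit_weight phi) (- c).
Proof.
split=> [H|[c c0 H]]; last first.
  apply: (@le_lt_trans _ _ (- c)%:E); last by rewrite lte_fin oppr_lt0.
  by apply/pressure_leP => b cb; apply: subexp_bound_le H; exact: ltW.
have [c c0 Hc] : exists2 c : R, 0 < c & (pressure g f L phi <= (- c)%:E)%E.
  case: (pressure g f L phi) H => [r| |] //.
    rewrite lte_fin => r0; exists (- r); rewrite ?oppr_gt0//.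
    by rewrite opprK.
  by move=> _; exists 1 => //; rewrite leNye.
exists (c / 2); first by rewrite divr_gt0.
by apply: (pressure_leP phi (- c)).1 => //; lra.
Qed.

End PressureBounds.

Lemma iter_closed (T : Type) (A : set T) (h : T -> T) : (forall p, A p -> A (h p)) ->
  forall k p, A p -> A (iter k h p).
Proof. by move=> Ah k p Ap; elim: k => // k; exact: Ah. Qed.

(** * Orbit weights of the unstable potential and their dependence on the exponent *)

Section Weights.
Context {R : realType} {n : nat} {M : topologicalType}.
Variable S : smooth_manifold R n M.
Variable g : riemannian_metric S.
Variable f : M -> M.
Variable L : set M.
Hypothesis Lf : forall p, L p -> L (f p).
Variable Eu : M -> {vspace 'rV[R]_n}.
Hypothesis Eu0f : forall p, L p -> Eu (f p) = 0%VS <-> Eu p = 0%VS.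
Variable K : R.
Hypothesis K1 : 1 <= K.
Hypothesis HK : forall p v, rnorm g (f p) (tangent_map S f p v) <= K * rnorm g p v.
Hypothesis HK' : forall p v, rnorm g p v <= K * rnorm g (f p) (tangent_map S f p v).
Implicit Types (p q x : M) (v : 'rV[R]_n) (t b : R).

Let K0 : 0 < K. Proof. exact: lt_le_trans K1. Qed.

Lemma Eu_iter k p : L p -> Eu (iter k f p) = 0%VS <-> Eu p = 0%VS.
Proof.
by move=> Lp; elim: k => // k <-; rewrite iterS; apply: Eu0f; exact: iter_closed.
Qed.

Lemma min_norm_trivial p : Eu p = 0%VS -> min_norm g f p (Eu p) = +oo%E.
Proof.
move=> E0; rewrite /min_norm E0.
have -> : [set v : 'rV[R]_n | v \in 0%VS /\ v != 0] = set0.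
  by apply/seteqP; split=> // v /= [+ v0]; rewrite memv0 (negbTE v0).
by rewrite image_set0 ereal_inf0.
Qed.

Lemma min_norm_geP p (m : R) : (m%:E <= min_norm g f p (Eu p))%E <->
  forall v, v \in Eu p -> m * rnorm g p v <= rnorm g (f p) (tangent_map S f p v).
Proof.
split=> [H v vE|H].
  have [->|v0] := eqVneq v 0; first by rewrite tangent_map0 !rnorm0 mulr0.
  rewrite -ler_pdivlMr ?rnorm_gt0// -lee_fin; apply: (le_trans H).
  by apply: ereal_inf_lbound; exists v.
apply: le_ereal_inf_tmp => _ [v [vE v0] <-].
by rewrite lee_fin ler_pdivlMr ?rnorm_gt0//; exact: H.
Qed.

(** Meaningful only where [Eu p] is nonzero; elsewhere the minimum norm is [+oo], and [fine] returns
    a default value. *)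
Definition log_min_norm p : R := ln (fine (min_norm g f p (Eu p))).

Lemma min_normE p : Eu p <> 0%VS ->
  [/\ min_norm g f p (Eu p) = (expR (log_min_norm p))%:E,
     K^-1 <= expR (log_min_norm p), expR (log_min_norm p) <= K &
     forall v, v \in Eu p ->
       expR (log_min_norm p) * rnorm g p v <= rnorm g (f p) (tangent_map S f p v)].
Proof.
move=> E0; have K'0 : 0 < K^-1 by rewrite invr_gt0.
have lo : (K^-1%:E <= min_norm g f p (Eu p))%E.
  by apply/min_norm_geP => v _; rewrite mulrC ler_pdivrMr// mulrC.
have hi : (min_norm g f p (Eu p) <= K%:E)%E.
  have v0 : vpick (Eu p) != 0 by rewrite vpick0; apply/eqP.
  apply: (@le_trans _ _ (rnorm g (f p) (tangent_map S f p (vpick (Eu p))) /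
    rnorm g p (vpick (Eu p)))%:E).
    by apply: ereal_inf_lbound; exists (vpick (Eu p)) => //; split=> //; exact: memv_pick.
  by rewrite lee_fin ler_pdivrMr ?rnorm_gt0.
have [m mE] : exists m, min_norm g f p (Eu p) = m%:E.
  case: (min_norm _ _ _ _) lo hi => [m| |] //; first by exists m.
have mK : K^-1 <= m by rewrite -lee_fin -mE.
have Ep : expR (log_min_norm p) = m.
  by rewrite /log_min_norm mE/= lnK// posrE; exact: lt_le_trans mK.
by rewrite Ep; split=> //; [rewrite -lee_fin -mE|apply/min_norm_geP; rewrite mE].
Qed.

Lemma log_min_norm_le p : Eu p <> 0%VS -> log_min_norm p <= ln K.
Proof.
move=> /min_normE[_ _ H _]; rewrite -ler_expR lnK ?posrE//.
Qed.

Definition birkhoff k x : R := \sum_(j < k) log_min_norm (iter j f x).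

Lemma birkhoffS k x : birkhoff k.+1 x = birkhoff k x + log_min_norm (iter k f x).
Proof. by rewrite /birkhoff big_ord_recr. Qed.

Lemma birkhoff_le k x : L x -> Eu x <> 0%VS -> birkhoff k x <= k%:R * ln K.
Proof.
move=> Lx E0; elim: k => [|k IH]; first by rewrite /birkhoff big_ord0 mul0r.
rewrite birkhoffS -natr1 mulrDl mul1r; apply: lerD => //.
by apply: log_min_norm_le; rewrite (Eu_iter k Lx).
Qed.

Lemma birkhoff_ge (mu : R) k x : 0 < mu ->
  (forall p, L p -> (mu%:E <= min_norm g f p (Eu p))%E) -> L x -> Eu x <> 0%VS ->
  k%:R * ln mu <= birkhoff k x.
Proof.
move=> mu0 H Lx E0; elim: k => [|k IH]; first by rewrite /birkhoff big_ord0 mul0r.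
rewrite birkhoffS -natr1 mulrDl mul1r; apply: lerD => //.
have Ek : Eu (iter k f x) <> 0%VS by rewrite (Eu_iter k Lx).
have := H _ (iter_closed Lf k Lx); have [-> _ _ _] := min_normE Ek.
by rewrite lee_fin -{1}(@lnK _ mu)// ler_expR.
Qed.

Definition uweight t := orbit_weight f (unstable_potential g f Eu t).

Lemma uweight_ge0 t k x : (0 <= uweight t k x)%E. Proof. exact: expeR_ge0. Qed.

Lemma uweightE t k x : L x -> Eu x <> 0%VS ->
  uweight t k x = (expR (- t * birkhoff k x))%:E.
Proof.
move=> Lx E0; rewrite /uweight /orbit_weight.
rewrite (eq_bigr (fun j : 'I_k => (- t * log_min_norm (iter j f x))%:E)).
  by rewrite sumEFin /= /birkhoff mulr_sumr.
move=> j _; rewrite /unstable_potential.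
have Ek : Eu (iter j f x) <> 0%VS by rewrite (Eu_iter j Lx).
have [-> _ _ _] := min_normE Ek.
by rewrite lne_EFin ?expR_gt0// expRK.
Qed.

Lemma uweight_potential0 k x : uweight 0 k x = 1%E.
Proof.
rewrite /uweight /orbit_weight big1 ?expeR0// => j _.
by rewrite /unstable_potential oppr0 mul0e.
Qed.

(** For [t] other than 0 the first summand is already infinite; at [k = 0] the empty sum would give
    weight 1 instead. *)
Lemma uweight_trivial t k x : L x -> Eu x = 0%VS -> (0 < k)%N ->
  uweight t k x = if t == 0 then 1%E else if 0 < t then 0%E else +oo%E.
Proof.
move=> Lx E0 k0; have [->|t0] := eqVneq t 0; first exact: uweight_potential0.
have E (j : 'I_k) : unstable_potential g f Eu t (iter j f x) = ((- t)%:E * +oo)%E.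
  rewrite /unstable_potential min_norm_trivial//.
  by apply/(Eu_iter j Lx).
rewrite /uweight /orbit_weight (eq_bigr (fun=> (- t)%:E * +oo)%E); last by move=> j _; exact: E.
case: k k0 {E} => // k _; rewrite big_const_ord.
case: ltP => [tp|tn].
  have -> : ((- t)%:E * +oo = -oo :> \bar R)%E by rewrite lt0_muley// lte_fin oppr_lt0.
  by rewrite iterS addNye.
have tn' : t < 0 by rewrite lt_neqAle t0.
have -> : ((- t)%:E * +oo = +oo :> \bar R)%E by rewrite gt0_muley// lte_fin oppr_gt0.
have -> : iter k.+1 (adde +oo%E) 0%E = +oo%E :> \bar R.
  by elim: k => [//|k IH]; rewrite iterS IH.
by [].
Qed.

(** Each step contributes at most [mu] to the power [s - t]. Where [Eu x] vanishes, the weights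
    [+oo], 1 and 0 decrease with the exponent as well. *)
Lemma uweight_le_mono (mu s t : R) k x : 0 < mu ->
  (forall p, L p -> (mu%:E <= min_norm g f p (Eu p))%E) -> L x -> (0 < k)%N -> s <= t ->
  (uweight t k x <= (expR (- (t - s) * (k%:R * ln mu)))%:E * uweight s k x)%E.
Proof.
move=> mu0 H Lx k0 st; have [E0|E0] := pselect (Eu x = 0%VS); last first.
  rewrite !uweightE// -EFinM lee_fin -expRD ler_expR.
  have B := birkhoff_ge k mu0 H Lx E0.
  have : (t - s) * (k%:R * ln mu) <= (t - s) * birkhoff k x by rewrite ler_wpM2l// subr_ge0.
  rewrite !mulNr !mulrBl; lra.
rewrite !uweight_trivial//.
have [t0|t0] := eqVneq t 0.
  have [s0|s0] := eqVneq s 0; first by rewrite t0 s0 subrr oppr0 mul0r expR0 mul1e.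
  have sn : s < 0 by rewrite lt_neqAle s0 -t0.
  by rewrite ltNge (ltW sn)/= gt0_muley ?lte_fin ?expR_gt0// leey.
have [tp|tn] := ltP 0 t.
  apply: mule_ge0; first by rewrite lee_fin expR_ge0.
  by case: ifP => // _; case: ifP.
have sn : s < 0 by apply: le_lt_trans st _; rewrite lt_neqAle t0.
by rewrite lt_eqF// ltNge (ltW sn)/= gt0_muley ?lte_fin ?expR_gt0.
Qed.

(** The reverse estimate is confined to nonzero [Eu x]: otherwise the weight can drop from 1 to
    0. *)
Lemma uweight_ge_mono (s t : R) k x : L x -> Eu x <> 0%VS -> s <= t ->
  (uweight s k x <= (expR ((t - s) * (k%:R * ln K)))%:E * uweight t k x)%E.
Proof.
move=> Lx E0 st; rewrite !uweightE// -EFinM lee_fin -expRD ler_expR.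
have B := birkhoff_le k Lx E0.
have : (t - s) * birkhoff k x <= (t - s) * (k%:R * ln K) by rewrite ler_wpM2l// subr_ge0.
rewrite !mulNr !mulrBl; lra.
Qed.

Lemma uweight_trivial_le1 (s : R) k x : L x -> Eu x = 0%VS -> (0 < k)%N -> 0 <= s ->
  (uweight s k x <= 1)%E.
Proof.
move=> Lx E0 k0 s0; rewrite uweight_trivial//; case: eqP => // /eqP sn.
have -> : 0 < s by rewrite lt_def sn s0.
exact: lee01.
Qed.

Lemma subexp_shift (mu s t b : R) : 0 < mu ->
  (forall p, L p -> (mu%:E <= min_norm g f p (Eu p))%E) -> s <= t ->
  subexp_bound g f L (uweight s) b -> subexp_bound g f L (uweight t) (b - (t - s) * ln mu).
Proof.
move=> mu0 H st Q eps e0; have k0 : \forall k \near \oo, (0 < k)%N by exists 1%N.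
apply: filterS2 k0 (Q eps e0) => k k0 Hk sq us sL ss.
apply: (@le_trans _ _ (\sum_(x <- sq) (expR (- (t - s) * (k%:R * ln mu)))%:E * uweight s k x)%E).
  rewrite !big_seq; apply: lee_sum => x xs.
  by apply: uweight_le_mono => //; exact: sL.
rewrite -ge0_sume_distrr; last by move=> x _; exact: uweight_ge0.
apply: (@le_trans _ _ ((expR (- (t - s) * (k%:R * ln mu)))%:E * (expR (k%:R * b))%:E)%E).
  by apply: lee_wpmul2l; [rewrite lee_fin expR_ge0|exact: Hk].
rewrite -EFinM lee_fin -expRD ler_expR le_eqVlt; apply/orP; left; apply/eqP; ring.
Qed.

Lemma entropy_ge0 b : L !=set0 -> subexp_bound g f L (uweight 0) b -> 0 <= b.
Proof.
move=> [x Lx] Q; have k0 : \forall k \near \oo, (0 < k)%N by exists 1%N.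
have [k [k0' Hk]] := filter_ex (filterI k0 (Q 1 ltr01)).
have := Hk [:: x] isT; rewrite big_seq1 uweight_potential0 => H.
have : (1%:E <= (expR (k%:R * b))%:E :> \bar R)%E.
  apply: H; first by move=> y; rewrite inE => /eqP ->.
  by move=> y z /=; rewrite !inE => /eqP -> /eqP ->.
rewrite lee_fin -{1}(@expR0 R) ler_expR => H1.
by rewrite -(@pmulr_rge0 _ k%:R)// ltr0n.
Qed.

End Weights.

(** * Separated sets: size and maximality *)

Section SeparatedSets.
Context {R : realType} {n : nat} {M : topologicalType}.
Variable S : smooth_manifold R n M.
Variable g : riemannian_metric S.
Variable f : M -> M.
Implicit Types (p q x y : M).

Lemma bowen_dist_le k (e : R) p q : 0 <= e ->
  (forall j, (j < k)%N -> (rdist g (iter j f p) (iter j f q) <= e%:E)%E) ->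
  (bowen_dist g f k p q <= e%:E)%E.
Proof.
move=> e0 H; rewrite /bowen_dist; elim/big_ind: _ => [|u v ue ve|j _].
- by rewrite lee_fin.
- by rewrite ge_max ue ve.
- exact: H.
Qed.

Lemma bowen_dist_ge k (e : R) p q : (bowen_dist g f k p q <= e%:E)%E ->
  forall j, (j < k)%N -> (rdist g (iter j f p) (iter j f q) <= e%:E)%E.
Proof.
move=> H j jk; apply: le_trans H.
exact: (@le_bigmax _ _ _ 0%E (fun j : 'I_k => rdist g (iter j f p) (iter j f q)) (Ordinal jk)).
Qed.

Lemma separated_size k (e : R) (s : seq M) (T : finType) (c : M -> T) : uniq s ->
  Defs.separated g f k e [set` s] ->
  {in s &, forall p q, c p = c q -> (bowen_dist g f k p q <= e%:E)%E} -> (size s <= #|T|)%N.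
Proof.
move=> us sep H; have ci : {in s &, injective c}.
  move=> p q ps qs E; apply: contrapT => pq.
  have := sep p q ps qs pq; rewrite ltNge => /negP; apply; exact: H.
rewrite -(size_map c); have um : uniq (map c s) by rewrite map_inj_in_uniq.
by rewrite -(card_uniqP um); exact: max_card.
Qed.

(** A separated set of largest size exists by the bound [B]. A point that cannot be added is a
    member or is close to one, in one of the two orders, as exact symmetry of the distance is not
    established. *)
Lemma maximal_separated (A : set M) k (e : R) (B : nat) :
  (forall s : seq M, uniq s -> {in s, forall x, A x} -> Defs.separated g f k e [set` s] ->
     (size s <= B)%N) ->
  exists s : seq M, [/\ uniq s, {in s, forall x, A x}, Defs.separated g f k e [set` s] &
    forall y, A y -> exists2 z, z \in s & z = y \/
      (bowen_dist g f k z y <= e%:E)%E \/ (bowen_dist g f k y z <= e%:E)%E].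
Proof.
move=> HB.
pose P m := `[< exists s : seq M, [/\ uniq s, {in s, forall x, A x},
   Defs.separated g f k e [set` s] & size s = m] >].
have P0 : exists m, P m.
  by exists 0%N; apply/asboolP; exists [::]; split.
have PB m : P m -> (m <= B)%N by move=> /asboolP[s [us sA ss <-]]; exact: HB.
case: (ex_maxnP P0 PB) => m /asboolP[s [us sA ss sm]] mmax.
exists s; split=> // y Ay; apply: contrapT => nex.
have ny : y \notin s.
  by apply/negP => ys; apply: nex; exists y => //; left.
suff : P m.+1 by move=> /mmax; rewrite ltnn.
apply/asboolP; exists (y :: s); split.
- by rewrite /= ny.
- by move=> x; rewrite inE => /orP[/eqP ->|/sA].
- move=> x z /=; rewrite !inE => /orP[/eqP ->|xs] /orP[/eqP ->|zs] xz //.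
  + by rewrite ltNge; apply/negP => h; apply: nex; exists z => //; right; right.
  + by rewrite ltNge; apply/negP => h; apply: nex; exists x => //; right; left.
  + exact: ss.
- by rewrite /= sm.
Qed.

End SeparatedSets.

(** * The zero of the pressure under uniform expansion *)

Section PressureZero.
Context {R : realType} {n : nat} {M : topologicalType}.
Variable S : smooth_manifold R n M.
Variable g : riemannian_metric S.
Variable f : M -> M.
Variable L : set M.
Hypothesis Lf : forall p, L p -> L (f p).
Variable Eu : M -> {vspace 'rV[R]_n}.
Hypothesis Eu0f : forall p, L p -> Eu (f p) = 0%VS <-> Eu p = 0%VS.
Variable K : R.
Hypothesis K1 : 1 <= K.
Hypothesis HK : forall p v, rnorm g (f p) (tangent_map S f p v) <= K * rnorm g p v.
Hypothesis HK' : forall p v, rnorm g p v <= K * rnorm g (f p) (tangent_map S f p v).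
Hypothesis L0 : L !=set0.
Hypothesis entropy_finite : exists b, subexp_bound g f L (uweight g f Eu 0) b.
Hypothesis trivial_separated : forall e : R, 0 < e -> exists N : nat, forall k (s : seq M),
  uniq s -> {in s, forall x, L x} -> {in s, forall x, Eu x = 0%VS} ->
  Defs.separated g f k e [set` s] -> (size s <= N)%N.

Local Notation w := (uweight g f Eu).
Local Notation Q t b := (subexp_bound g f L (w t) b).

(** Lowering the exponent costs at most [ln K] per step where [Eu] is nonzero. The other points, at
    most [N] of weight at most 1, account for the maximum with 0, and [delta] absorbs the
    constants. *)
Lemma subexp_back (s t b delta : R) : 0 <= s <= t -> Q t b -> 0 < delta ->
  Q s (Num.max (b + (t - s) * ln K) 0 + delta).
Proof.
move=> /andP[s0 st] H d0 eps e0; have [N HN] := trivial_separated e0.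
have k0 : \forall k \near \oo, (0 < k)%N by exists 1%N.
(* Chosen so that exp (k delta) >= 1 + k delta >= 1 + N. *)
have kN : \forall k \near \oo, N%:R / delta <= k%:R by exact: nbhs_infty_ger.
apply: filterS3 k0 kN (H eps e0) => k k0 kN Hk sq us sL ss.
set B := Num.max _ _.
pose P := fun x : M => Eu x != 0%VS.
rewrite (bigID P)/=.
have h1 : (\sum_(x <- sq | P x) w s k x <= (expR (k%:R * (b + (t - s) * ln K)))%:E)%E.
  apply: (@le_trans _ _ (\sum_(x <- sq | P x) (expR ((t - s) * (k%:R * ln K)))%:E * w t k x)%E).
    rewrite big_seq_cond [leRHS]big_seq_cond; apply: lee_sum => x /andP[xs Px].
    by apply: (uweight_ge_mono Lf Eu0f K1 HK HK') => //; [exact: sL|exact/eqP].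
  rewrite -ge0_sume_distrr; last by move=> x _; exact: uweight_ge0.
  apply: (@le_trans _ _ ((expR ((t - s) * (k%:R * ln K)))%:E * (expR (k%:R * b))%:E)%E).
    apply: lee_wpmul2l; first by rewrite lee_fin expR_ge0.
    rewrite -big_filter; apply: Hk; first exact: filter_uniq.
      by move=> x; rewrite mem_filter => /andP[_]; exact: sL.
    by apply: separated_sub ss => x /=; rewrite mem_filter => /andP[].
  rewrite -EFinM lee_fin -expRD ler_expR le_eqVlt; apply/orP; left; apply/eqP; ring.
have h2 : (\sum_(x <- sq | ~~ P x) w s k x <= N%:R%:E)%E.
  rewrite -big_filter; apply: (@le_trans _ _ (\sum_(x <- [seq x <- sq | ~~ P x]) 1%:E)%E).
    rewrite !big_seq; apply: lee_sum => x; rewrite mem_filter negbK => /andP[/eqP Ex xs].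
    by have A := @uweight_trivial_le1 R n M S g f L Lf Eu Eu0f s k x (sL x xs) Ex k0 s0; exact: A.
  rewrite sumEFin lee_fin big_const_seq count_predT iter_addr_0 ler_nat.
  apply: (HN k); first exact: filter_uniq.
  - by move=> x; rewrite mem_filter => /andP[_]; exact: sL.
  - by move=> x; rewrite mem_filter negbK => /andP[/eqP].
  - by apply: separated_sub ss => x /=; rewrite mem_filter => /andP[].
apply: (le_trans (leeD h1 h2)); rewrite -EFinD lee_fin.
have B1 : b + (t - s) * ln K <= B by rewrite le_max lexx.
have B0 : 0 <= B by rewrite le_max lexx orbT.
have e1 : expR (k%:R * (b + (t - s) * ln K)) <= expR (k%:R * B).
  by rewrite ler_expR ler_wpM2l.
have e2 : 1 <= expR (k%:R * B) by rewrite -{1}(@expR0 R) ler_expR mulr_ge0.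
rewrite [in leRHS]mulrDr [in leRHS]expRD; apply: (@le_trans _ _ (expR (k%:R * B) * (1 + N%:R))).
  by rewrite [leRHS]mulrDr mulr1; apply: lerD => //; rewrite ler_peMl.
apply: ler_wpM2l; first exact: expR_ge0.
apply: le_trans (expR_ge1Dx _); rewrite lerD2l.
by rewrite -ler_pdivrMr.
Qed.

(** The zero is the infimum of the exponents [t >= 0] of nonpositive pressure. The upper estimate
    for increasing exponents gives strict decrease, the lower one shows that the pressure at the
    infimum is exactly 0. *)
Lemma pressure_zero_exists (mu : R) : 1 < mu ->
  (forall p, L p -> (mu%:E <= min_norm g f p (Eu p))%E) ->
  exists2 tstar : R, 0 <= tstar & unique_pressure_zero g f L Eu tstar.
Proof.
move=> mu1 Hmu; have mu0 : 0 < mu by exact: lt_trans mu1.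
have lmu : 0 < ln mu by rewrite ln_gt0.
have lK : 0 <= ln K by rewrite ln_ge0.
have shift s t b : s <= t -> Q s b -> Q t (b - (t - s) * ln mu).
  by move=> st; apply: (subexp_shift Lf Eu0f K1 HK HK') => //.
have Pz t : pressure g f L (unstable_potential g f Eu t) = 0%E <->
    (forall b, 0 < b -> Q t b) /\ ~ (exists2 c : R, 0 < c & Q t (- c)).
  split=> [E|[H1 H2]].
    split; first by apply: (pressure_leP g f L _ 0).1; rewrite E.
    by move=> /pressure_lt0P; rewrite E ltxx.
  apply/eqP; rewrite eq_le; apply/andP; split; first exact: (pressure_leP g f L _ 0).2.
  by rewrite leNgt; apply/negP => /pressure_lt0P.
have strict s t : s < t -> (forall b, 0 < b -> Q s b) -> exists2 c : R, 0 < c & Q t (- c).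
  move=> st H; have x0 : 0 < (t - s) * ln mu by rewrite mulr_gt0// subr_gt0.
  exists ((t - s) * ln mu / 2); first by rewrite divr_gt0.
  have -> : - ((t - s) * ln mu / 2) = (t - s) * ln mu / 2 - (t - s) * ln mu by field.
  by apply: shift; [exact: ltW|apply: H; rewrite divr_gt0].
pose T := [set t : R | 0 <= t /\ forall b, 0 < b -> Q t b].
have [b0 Qb0] := entropy_finite.
have b00 : 0 <= b0 by exact: entropy_ge0 Qb0.
have T0 : T !=set0.
  (* The entropy bound [b0] is used up at rate [ln mu] per unit of the exponent. *)
  exists (b0 / ln mu); split=> [|b bp]; first by rewrite divr_ge0// ltW.
  have q0 : 0 <= b0 / ln mu by rewrite divr_ge0// ltW.
  have := shift 0 (b0 / ln mu) b0 q0 Qb0; rewrite subr0 divfK ?gt_eqF// subrr.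
  by apply: subexp_bound_le; exact: ltW.
have Tlb : has_lbound T by exists 0 => t [].
pose ts := inf T.
have ts0 : 0 <= ts by apply: lb_le_inf => // t [].
have tsle t : T t -> ts <= t by move=> Tt; exact: ge_inf.
have P1 b : 0 < b -> Q ts b.
  (* Adding 1 to [ln K] keeps the denominator positive when [K = 1]. *)
  move=> bp; have e0 : 0 < b / 4 / (ln K + 1) by rewrite !divr_gt0// ltr_wpDl.
  have [t [t0 Qt] tlt] := inf_adherent e0 (conj T0 Tlb).
  have tt := tsle t (conj t0 Qt); rewrite -/ts in tlt.
  have b4 : 0 < b / 4 by rewrite divr_gt0.
  have rg : 0 <= ts <= t by rewrite ts0 tt.
  have := subexp_back rg (Qt _ b4) b4; apply: subexp_bound_le.
  have h : (t - ts) * ln K <= b / 4.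
    apply: (@le_trans _ _ (b / 4 / (ln K + 1) * (ln K + 1))); last by rewrite divfK// gt_eqF// ltr_wpDl.
    apply: ler_pM => //; [by rewrite subr_ge0|by rewrite lerBlDl ltW|by rewrite lerDl].
  rewrite -lerBrDr ge_max; apply/andP; split; lra.
(* Negative pressure at [ts] would leave room for a smaller exponent in [T], or, at [ts = 0],
   contradict the nonnegativity of entropy. *)
have P2 : ~ (exists2 c : R, 0 < c & Q ts (- c)).
  move=> [c c0 Qc].
  have tsn : ts != 0.
    apply/eqP => E; rewrite E in Qc; have := entropy_ge0 L0 Qc; rewrite oppr_ge0 leNgt c0//.
  have tsp : 0 < ts by rewrite lt0r tsn.
  pose s := Num.max 0 (ts - c / (ln K + 1)).
  have lK1 : 0 < ln K + 1 by rewrite ltr_wpDl.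
  have s0 : 0 <= s by rewrite le_max lexx.
  have sts : s < ts by rewrite gt_max tsp/= ltrBlDr ltrDl divr_gt0.
  have h : (ts - s) * ln K <= c.
    apply: (@le_trans _ _ (c / (ln K + 1) * (ln K + 1))); last by rewrite divfK// gt_eqF.
    apply: ler_pM => //; [by rewrite subr_ge0 ltW| |by rewrite lerDl].
    by rewrite lerBlDl -lerBlDr /s le_max lexx orbT.
  have : T s.
    split=> // b bp; have rg : 0 <= s <= ts by rewrite s0 (ltW sts).
    have := subexp_back rg Qc bp; apply: subexp_bound_le.
    rewrite -lerBrDr subrr ge_max lexx andbT; lra.
  by move=> /tsle; rewrite leNgt sts.
exists ts => //; split; first by apply/Pz.
move=> s /Pz[Q1 Q2]; apply: contrapT => /eqP; rewrite neq_lt => /orP[lt|lt].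
  by apply: Q2; exact: strict lt P1.
by apply: P2; exact: strict lt Q1.
Qed.

End PressureZero.

(** * Box dimension *)

Section BoxDimension.
Context {R : realType} {n : nat} {M : topologicalType}.
Variable S : smooth_manifold R n M.
Variable g : riemannian_metric S.
Implicit Types (x y z : M) (W : set M).

Lemma covering_number_ge0 W (r : R) : (0 <= covering_number g W r)%E.
Proof. by apply: le_ereal_inf_tmp => _ [s _ <-]; rewrite lee_fin. Qed.

(** Every small radius has the form [C1 * expR (- tau)], and the constants disappear after division
    by [- ln r]. *)
Lemma upper_box_dim_le W (t C1 C2 : R) : 0 < C1 -> 0 < C2 ->
  (\forall tau \near +oo, exists2 s : seq M, (size s)%:R <= C2 * expR (t * tau) &
     forall y, W y -> exists2 z, z \in s & (rdist g z y <= (C1 * expR (- tau))%:E)%E) ->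
  (upper_box_dim g W <= t%:E)%E.
Proof.
move=> C10 C20 [tau0 [_ H]].
apply/lee_addgt0Pr => e e0; rewrite -EFinD.
(* The constant part of the logarithm of [C2 * expR (t * tau)] for [tau = ln C1 - ln r]. *)
pose c' := ln C2 + t * ln C1.
pose A := [set r : R | [/\ 0 < r, r < C1 * expR (- tau0), 0 < - ln r & c' / e <= - ln r]].
have A0 : nbhs (0 : R)^'+ A.
  have a1 : \forall r \near (0 : R)^'+, 0 < r by exact: nbhs_right_gt.
  have a2 : \forall r \near (0 : R)^'+, r < C1 * expR (- tau0).
    by apply: nbhs_right_lt; rewrite mulr_gt0// expR_gt0.
  have a3 : \forall r \near (0 : R)^'+, r < 1 by exact: nbhs_right_lt.
  have a4 : \forall r \near (0 : R)^'+, r < expR (- (c' / e)).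
    by apply: nbhs_right_lt; rewrite expR_gt0.
  apply: filterS2 (filterI a1 a2) (filterI a3 a4) => r [r0 r1] [r2 r3]; split=> //.
    by rewrite oppr_gt0 ln_lt0// r0.
  by rewrite lerNr -ler_expR lnK// ltW.
apply: ge_ereal_inf; eexists; first by exists A; first exact: A0.
apply: ge_ereal_sup => _ [r [r0 r1 lr clr] <-].
rewrite lee_pdivrMr// -EFinM lne_le_expR; last exact: covering_number_ge0.
pose tau := ln C1 - ln r.
have rE : C1 * expR (- tau) = r.
  by rewrite /tau opprB expRD expRN !lnK// mulrCA divff ?mulr1// gt_eqF.
have [|s ss sc] := H tau.
  have : ln r < ln (C1 * expR (- tau0)) by rewrite ltr_ln ?posrE ?mulr_gt0 ?expR_gt0.
  by rewrite lnM ?posrE ?expR_gt0// expRK /tau; lra.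
apply: (@le_trans _ _ (size s)%:R%:E).
  apply: ereal_inf_lbound; exists s => // y Wy /=.
  by have [z zs d] := sc y Wy; exists z => //; rewrite -rE.
rewrite lee_fin; apply: (le_trans ss).
rewrite -[X in X * _](@lnK _ C2)// -expRD ler_expR.
have : c' <= e * - ln r by rewrite mulrC -ler_pdivrMr.
rewrite /c' /tau mulrDl mulrBr; lra.
Qed.

Lemma geometric_sum_le (x : R) m : 0 < x < 1 -> \sum_(k < m) x ^+ k <= (1 - x)^-1.
Proof.
move=> /andP[x0 x1]; have d0 : 0 < 1 - x by rewrite subr_gt0.
rewrite -[leRHS]mul1r ler_pdivlMr//.
have -> : (\sum_(k < m) x ^+ k) * (1 - x) = 1 - x ^+ m.
  elim: m => [|m IH]; first by rewrite big_ord0 mul0r expr0 subrr.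
  by rewrite big_ord_recr/= mulrDl IH exprSr; ring.
by rewrite gerBl exprn_ge0// ltW.
Qed.

Hypothesis rdist_self : forall p, rdist g p p = 0%E.

(** * Covers by Bowen balls of variable length *)

Section Cover.
Variable f : M -> M.
Variable W : set M.
Variables eps t gam kap Kc Ks rs : R.
(** Two choices occur: a Birkhoff sum of log minimum norms minus a linear correction, and a linear
    function of [k] when the zero of the pressure is 0. *)
Variable B : nat -> M -> R.
Hypothesis eps0 : 0 < eps.
Hypothesis t0 : 0 < t.
Hypothesis gam0 : 0 < gam.
Hypothesis kap0 : 0 < kap.
Hypothesis Kc0 : 0 < Kc.
Hypothesis Ks0 : 0 < Ks.
Hypothesis rs0 : 0 < rs.
Hypothesis quasi_sym : forall p q r, r <= rs -> (rdist g p q <= r%:E)%E ->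
  (rdist g q p <= (Ks * r)%:E)%E.
Hypothesis contraction : forall y z k, W y -> W z -> (0 < k)%N ->
  (forall j, (j < k)%N -> (rdist g (iter j f y) (iter j f z) <= eps%:E)%E) ->
  (rdist g y z <= (Kc * expR (- B k y))%:E)%E.
Hypothesis B_step : forall k y, W y -> B k.+1 y <= B k y + kap.
Hypothesis B_ub : forall k y, W y -> B k y <= k%:R * kap.
Hypothesis weight_sum : \forall k \near \oo, forall s : seq M, uniq s ->
  {in s, forall x, W x} -> Defs.separated g f k eps [set` s] ->
  \sum_(y <- s) expR (- t * B k y) <= expR (- (k%:R * gam)).

(* Points of W are grouped by the first time k at which B k y passes tau; a maximal separated subset of each group is counted with its weight exp (- t * B k y), which is comparable to exp (- t * tau). *)
Lemma box_dim_cover : (upper_box_dim g W <= t%:E)%E.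
Proof.
have [n0 _ Hn0] := weight_sum.
pose n1 := maxn n0 1; have n10 : (0 < n1)%N by rewrite leq_max orbT.
have Hn1 k : (n1 <= k)%N -> forall s : seq M, uniq s ->
    {in s, forall x, W x} -> Defs.separated g f k eps [set` s] ->
    \sum_(y <- s) expR (- t * B k y) <= expR (- (k%:R * gam)).
  by move=> nk; apply: Hn0; rewrite /=; apply: leq_trans nk; rewrite leq_max leqnn.
pose xx := expR (- gam).
have xx01 : 0 < xx < 1 by rewrite expR_gt0 expR_lt1// oppr_lt0.
have xxd : 0 < 1 - xx by have /andP[_] := xx01; rewrite subr_gt0.
apply: (@upper_box_dim_le W t (Kc * (1 + Ks)) (expR (t * kap) * (1 - xx)^-1)).
- by rewrite mulr_gt0// addr_gt0.
- by rewrite mulr_gt0 ?expR_gt0// invr_gt0.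
have n1' : \forall tau \near (+oo : set_system R), n1%:R * kap <= tau by apply: nbhs_pinfty_ge; exact: num_real.
have rs' : \forall tau \near (+oo : set_system R), ln (Kc / rs) <= tau by apply: nbhs_pinfty_ge; exact: num_real.
apply: filterS2 n1' rs' => tau n1tau rstau.
have small : Kc * expR (- tau) <= rs.
  rewrite expRN ler_pdivrMr ?expR_gt0// mulrC -ler_pdivrMr// -[leLHS]lnK ?posrE ?divr_gt0//.
  by rewrite ler_expR.
pose Y k := [set y | [/\ W y, tau <= B k y & B k y <= tau + kap]].
pose E := expR (t * (tau + kap)).
(* On [Y k] each weight is at least exp (- t (tau + kap)), so a bound on the sum of the weights
   bounds the number of points. *)
have sizeY k : (n1 <= k)%N -> forall s : seq M, uniq s -> {in s, forall x, Y k x} ->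
    Defs.separated g f k eps [set` s] -> (size s)%:R <= E * xx ^+ k.
  move=> nk s us sY ss.
  have h1 : (size s)%:R * expR (- t * (tau + kap)) <= \sum_(y <- s) expR (- t * B k y).
    rewrite mulrC mulr_natr -iter_addr_0 -(count_predT s) -big_const_seq.
    rewrite !big_seq; apply: ler_sum => y /sY[_ _ By].
    by rewrite ler_expR !mulNr lerN2 ler_pM2l.
  have h2 := le_trans h1 (Hn1 k nk s us (fun x xs => let: And3 a _ _ := sY x xs in a) ss).
  have -> : xx ^+ k = expR (- (k%:R * gam)) by rewrite /xx -expRM_natl mulrN.
  rewrite mulrC -ler_pdivrMr ?expR_gt0//; apply: le_trans h2.
  by rewrite /E -expRN mulNr.
have cover m : exists2 s : seq M, (size s)%:R <= E * \sum_(k < m) xx ^+ k &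
    forall y k, (n1 <= k < m)%N -> Y k y ->
      exists2 z, z \in s & (rdist g z y <= (Kc * (1 + Ks) * expR (- tau))%:E)%E.
  elim: m => [|m [s ss sc]].
    exists [::]; first by rewrite big_ord0 mulr0.
    by move=> y k; rewrite ltn0 andbF.
  have [nm|nm] := leqP n1 m; last first.
    exists s.
      apply: (le_trans ss); rewrite big_ord_recr/= mulrDr lerDl.
      by rewrite mulr_ge0 ?expR_ge0 ?exprn_ge0 ?expR_ge0.
    move=> y k /andP[nk km] Yy; apply: (sc y k) => //; rewrite nk/=.
    by move: km; rewrite ltnS leq_eqVlt => /predU1P[E'|//]; move: nm; rewrite -E' ltnNge nk.
  have [|s' [us' sY' ss' smax]] := @maximal_separated R n M S g f (Y m) m eps (Num.truncn (E * xx ^+ m)).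
    move=> s' us' sY' ss'; rewrite truncn_ge_nat; first exact: sizeY.
    by rewrite mulr_ge0 ?expR_ge0 ?exprn_ge0 ?expR_ge0.
  exists (s ++ s').
    rewrite size_cat natrD big_ord_recr/= mulrDr; apply: lerD => //.
    exact: sizeY.
  move=> y k /andP[nk]; rewrite ltnS leq_eqVlt => /predU1P[->|km] Yy; last first.
    have [|z zs d] := sc y k _ Yy; first by rewrite nk.
    by exists z => //; rewrite mem_cat zs.
  have [z zs Hz] := smax y Yy; exists z; first by rewrite mem_cat zs orbT.
  have [Wy By _] := Yy; have [Wz Bz _] := sY' z zs.
  have m0 : (0 < m)%N by exact: leq_trans nm.
  have ct u : tau <= B m u -> Kc * expR (- B m u) <= Kc * expR (- tau).
    by move=> h; rewrite ler_pM2l// ler_expR lerN2.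
  have Ke : 0 <= Kc * expR (- tau) by rewrite mulr_ge0 ?expR_ge0// ltW.
  (* Balls are centred at [z]. If closeness is known only in the order [y], [z], quasi-symmetry
     costs the factor [Ks]. *)
  case: Hz => [E'|[d|d]].
  - rewrite -E'; have zz : (rdist g z z <= (Kc * expR (- B m z))%:E)%E.
      by apply: contraction => // j jm; rewrite rdist_self lee_fin ltW.
    apply: (le_trans zz); rewrite lee_fin; apply: (le_trans (ct z Bz)).
    by rewrite mulrAC ler_peMr// lerDl ltW.
  - have zy := contraction Wz Wy m0 (bowen_dist_ge d).
    apply: (le_trans zy); rewrite lee_fin; apply: (le_trans (ct z Bz)).
    by rewrite mulrAC ler_peMr// lerDl ltW.
  - have yz := contraction Wy Wz m0 (bowen_dist_ge d).
    have yz' : (rdist g y z <= (Kc * expR (- tau))%:E)%E.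
      by apply: (le_trans yz); rewrite lee_fin ct.
    apply: (le_trans (quasi_sym small yz')); rewrite lee_fin.
    have -> : Kc * (1 + Ks) * expR (- tau) = (1 + Ks) * (Kc * expR (- tau)) by ring.
    by rewrite ler_wpM2r// lerDr.
(* By this time every point has passed [tau]: for a one-point separated set the weight bound says
   [k * gam <= t * B k y]. *)
pose ktop := maxn n1 (Num.truncn (t * tau / gam)).+1.
have [s ss sc] := cover ktop.+1.
exists s.
  apply: (le_trans ss).
  have -> : expR (t * kap) * (1 - xx)^-1 * expR (t * tau) = E * (1 - xx)^-1.
    by rewrite mulrAC -expRD /E -mulrDr addrC.
  by rewrite ler_pM2l ?expR_gt0// geometric_sum_le.
move=> y Wy.
have Bge k : (n1 <= k)%N -> k%:R * gam <= t * B k y.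
  move=> nk; have := Hn1 k nk [:: y] isT; rewrite big_seq1 ler_expR => H.
  have {}H : - t * B k y <= - (k%:R * gam).
    apply: H => [x|x z /=]; first by rewrite inE => /eqP ->.
    by rewrite !inE => /eqP -> /eqP ->.
  by rewrite mulNr lerN2 in H.
pose P k := (n1 <= k)%N && (tau <= B k y).
have Ptop : P ktop.
  rewrite /P leq_max leqnn/= -(ler_pM2l t0); apply: le_trans (Bge ktop _); last first.
    by rewrite leq_max leqnn.
  rewrite -ler_pdivrMr//; apply: ltW; apply: (lt_le_trans (truncnS_gt _)).
  by rewrite ler_nat leq_max leqnn orbT.
have exP : exists k, P k by exists ktop.
case: (ex_minnP exP) => k /andP[nk Bk] kmin.
apply: (sc y k); first by rewrite nk ltnS; exact: kmin.
(* At a first passage after [n1] the overshoot is at most one step [kap]; at [k = n1] the choice of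
   [tau] keeps [B] below [tau]. *)
split=> //; have [E'|kn] := eqVneq k n1.
  apply: (le_trans (B_ub _ Wy)); rewrite E'; apply: (le_trans n1tau).
  by rewrite lerDl ltW.
have nk' : (n1 < k)%N by rewrite ltn_neqAle eq_sym kn.
case: k {nk Bk kn} kmin nk' => [//|k] kmin nk'.
apply: (le_trans (B_step k Wy)); rewrite lerD2r leNgt; apply/negP => lt.
have : P k by rewrite /P -ltnS nk' ltW.
by move=> /kmin; rewrite ltnn.
Qed.

End Cover.

End BoxDimension.

(** * Hyperbolic sets *)

Section HyperbolicSet.
Context {R : realType} {n : nat} {M : topologicalType}.
Variable S : smooth_manifold R n M.
Variable g : riemannian_metric S.
Hypothesis cM : compact [set: M].
Variables f finv : M -> M.
Hypothesis fC : C1_map S f.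
Hypothesis finvC : C1_map S finv.
Hypothesis fK : cancel f finv.
Hypothesis finvK : cancel finv f.
Variable kappa : M -> chart_index S.
Hypothesis kappaP : chart_selector kappa.
Variable L : set M.
Hypothesis Lf : forall p, L p -> L (f p).
Hypothesis Lfinv : forall p, L p -> L (finv p).
Variables Es Eu : M -> {vspace 'rV[R]_n}.
Hypothesis EsuT : forall p, L p -> (Es p + Eu p = fullv)%VS.
Hypothesis Esu0 : forall p, L p -> (Es p :&: Eu p = 0)%VS.
Hypothesis EsD : Df_invariant S f L Es.
Hypothesis EuD : Df_invariant S f L Eu.
Variables C lam : R.
Hypothesis C0 : 0 < C.
Hypothesis lam01 : 0 < lam < 1.
Hypothesis Hs : forall p k v, L p -> v \in Es p ->
  rnorm g (iter k f p) (tangent_map S (iter k f) p v) <= C * lam ^+ k * rnorm g p v.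
Hypothesis Hu : forall p k v, L p -> v \in Eu p ->
  rnorm g (iter k finv p) (tangent_map S (iter k finv) p v) <= C * lam ^+ k * rnorm g p v.
Implicit Types (p q : M) (u v w : 'rV[R]_n).

Let lam0 : 0 < lam. Proof. by have /andP[] := lam01. Qed.

Lemma subbundle_f (E : M -> {vspace 'rV[R]_n}) p v : Df_invariant S f L E -> L p ->
  v \in E p -> tangent_map S f p v \in E (f p).
Proof.
move=> HE Lp vE; have : (tangent_map S f p @` [set` E p]) (tangent_map S f p v) by exists v.
by rewrite HE.
Qed.

Lemma subbundle_finv (E : M -> {vspace 'rV[R]_n}) p v : Df_invariant S f L E -> L p ->
  v \in E p -> tangent_map S finv p v \in E (finv p).
Proof.
move=> HE Lp vE; have Lq := Lfinv Lp.
have : [set` E (f (finv p))] v by rewrite /= finvK.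
rewrite -HE// => -[u uE <-]; have := tangent_finv_f fC finvC fK (finv p) u.
by rewrite finvK => ->.
Qed.

Lemma subbundle_iter (E : M -> {vspace 'rV[R]_n}) k p v : Df_invariant S f L E -> L p ->
  v \in E p -> tangent_map S (iter k f) p v \in E (iter k f p).
Proof.
move=> HE Lp vE; elim: k => [|k IH]; first by rewrite tangent_map_id.
by rewrite tangent_iterS//; apply: subbundle_f => //; exact: iter_closed.
Qed.

Lemma subbundle_iter_finv (E : M -> {vspace 'rV[R]_n}) k p v : Df_invariant S f L E -> L p ->
  v \in E p -> tangent_map S (iter k finv) p v \in E (iter k finv p).
Proof.
move=> HE Lp vE; elim: k => [|k IH]; first by rewrite tangent_map_id.
by rewrite tangent_iterS//; apply: subbundle_finv => //; exact: iter_closed.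
Qed.

(** * Projections along the splitting and Lyapunov norms of the components *)

Definition sproj p v : 'rV[R]_n := daddv_pi (Es p) (Eu p) v.
Definition uproj p v : 'rV[R]_n := daddv_pi (Eu p) (Es p) v.

Lemma sproj_in p v : sproj p v \in Es p. Proof. exact: memv_pi. Qed.
Lemma uproj_in p v : uproj p v \in Eu p. Proof. exact: memv_pi. Qed.

Lemma sprojD p v w : sproj p (v + w) = sproj p v + sproj p w. Proof. exact: linearD. Qed.
Lemma uprojD p v w : uproj p (v + w) = uproj p v + uproj p w. Proof. exact: linearD. Qed.

Lemma proj_add p v : L p -> sproj p v + uproj p v = v.
Proof.
by move=> Lp; apply: daddv_pi_add; [exact: Esu0|rewrite EsuT// memvf].
Qed.

Lemma sproj_s p v : L p -> v \in Es p -> sproj p v = v.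
Proof. by move=> Lp vE; apply: daddv_pi_id => //; exact: Esu0. Qed.
Lemma uproj_u p v : L p -> v \in Eu p -> uproj p v = v.
Proof. by move=> Lp vE; apply: daddv_pi_id => //; rewrite capvC; exact: Esu0. Qed.

Lemma uproj_s p v : L p -> v \in Es p -> uproj p v = 0.
Proof.
move=> Lp vE; have := proj_add v Lp; rewrite sproj_s// => H.
by apply: (addrI v); rewrite H addr0.
Qed.
Lemma sproj_u p v : L p -> v \in Eu p -> sproj p v = 0.
Proof.
move=> Lp vE; have := proj_add v Lp; rewrite uproj_u// => H.
by apply: (addIr v); rewrite H add0r.
Qed.

Lemma sproj_f p v : L p -> sproj (f p) (tangent_map S f p v) = tangent_map S f p (sproj p v).
Proof.
move=> Lp; rewrite -{1}(proj_add v Lp) tangent_mapD sprojD.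
have E1 := sproj_s (Lf Lp) (subbundle_f EsD Lp (sproj_in p v)).
have E2 := sproj_u (Lf Lp) (subbundle_f EuD Lp (uproj_in p v)).
by rewrite E1 E2 addr0.
Qed.

Lemma uproj_f p v : L p -> uproj (f p) (tangent_map S f p v) = tangent_map S f p (uproj p v).
Proof.
move=> Lp; rewrite -{1}(proj_add v Lp) tangent_mapD uprojD.
have E1 := uproj_s (Lf Lp) (subbundle_f EsD Lp (sproj_in p v)).
have E2 := uproj_u (Lf Lp) (subbundle_f EuD Lp (uproj_in p v)).
by rewrite E1 E2 add0r.
Qed.

(** The unstable counterpart [unorm] is built from [finv], since [Eu] contracts backward. Each
    component then changes by the factor [lam] in a single step. *)
Definition snorm p v := lyap g f lam p (sproj p v).
Definition unorm p v := lyap g finv lam p (uproj p v).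

Lemma sproj_contracted p v : L p -> contracted g f C lam p (sproj p v).
Proof. by move=> Lp k; apply: Hs => //; exact: sproj_in. Qed.
Lemma uproj_contracted p v : L p -> contracted g finv C lam p (uproj p v).
Proof. by move=> Lp k; apply: Hu => //; exact: uproj_in. Qed.

Lemma snorm_ge0 p v : L p -> 0 <= snorm p v.
Proof. by move=> Lp; exact: (lyap_ge0 lam01 (sproj_contracted v Lp)). Qed.
Lemma unorm_ge0 p v : L p -> 0 <= unorm p v.
Proof. by move=> Lp; exact: (lyap_ge0 lam01 (uproj_contracted v Lp)). Qed.

Lemma snormD p v w : L p -> snorm p (v + w) <= snorm p v + snorm p w.
Proof.
by move=> Lp; rewrite /snorm sprojD; apply: (lyapD lam01); exact: sproj_contracted.
Qed.
Lemma unormD p v w : L p -> unorm p (v + w) <= unorm p v + unorm p w.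
Proof.
by move=> Lp; rewrite /unorm uprojD; apply: (lyapD lam01); exact: uproj_contracted.
Qed.

Lemma rnorm_le_su p v : L p -> rnorm g p v <= snorm p v + unorm p v.
Proof.
move=> Lp; rewrite -{1}(proj_add v Lp); apply: (le_trans (ler_rnormD _ _ _ _)).
apply: lerD; first exact: (lyap_ge lam01 (sproj_contracted v Lp)).
exact: (lyap_ge lam01 (uproj_contracted v Lp)).
Qed.

Lemma snorm_f p v : L p -> snorm (f p) (tangent_map S f p v) <= lam * snorm p v.
Proof.
by move=> Lp; rewrite /snorm sproj_f//; apply: (lyap_step fC lam01); exact: sproj_contracted.
Qed.

Lemma unorm_f p v : L p -> unorm p v <= lam * unorm (f p) (tangent_map S f p v).
Proof.
move=> Lp; rewrite /unorm uproj_f//.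
have H := uproj_contracted (tangent_map S f p v) (Lf Lp); rewrite uproj_f// in H.
have := lyap_step finvC lam01 H; rewrite fK (tangent_finv_f fC finvC fK).
exact.
Qed.

Lemma tangent_bounds : exists K : R, [/\ 1 <= K,
  forall p v, rnorm g (f p) (tangent_map S f p v) <= K * rnorm g p v &
  forall p v, rnorm g p v <= K * rnorm g (f p) (tangent_map S f p v)].
Proof.
have H1 := tangent_bound g cM fC; have H2 := tangent_bound g cM finvC.
have H3 : \forall K \near +oo, (1 : R) <= K by exact: nbhs_pinfty_ge.
have [K [A [B D]]] := filter_ex (filterI H3 (filterI H1 H2)).
exists K; split=> // p v; have := D (f p) (tangent_map S f p v).
by rewrite fK (tangent_finv_f fC finvC fK).
Qed.

(* The angle between the two bundles is bounded below because a short vector with long components would have to grow arbitrarily fast. *)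
Lemma sproj_bounded : exists2 K : R, 1 <= K &
  forall p v, L p -> rnorm g p (sproj p v) <= K * rnorm g p v.
Proof.
have [K [K1 HK _]] := tangent_bounds.
have lim : (fun k => C * lam ^+ k) @ \oo --> C * 0.
  apply: cvgM; [exact: cvg_cst|apply: cvg_expr].
  by rewrite ger0_norm ?ltW//; have /andP[] := lam01.
rewrite mulr0 in lim.
have [k _ /(_ k (leqnn k)) /= Ck] : \forall k \near \oo, C * lam ^+ k < 1 / 2.
  by apply: (cvgr_lt 0) => //; rewrite divr_gt0.
have K0 : 0 <= K by lra.
have Kk v p : rnorm g (iter k f p) (tangent_map S (iter k f) p v) <= K ^+ k * rnorm g p v.
  elim: (k) => [|m IH]; first by rewrite tangent_map_id expr0 mul1r.
  rewrite tangent_iterS// iterS; apply: (le_trans (HK _ _)).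
  by rewrite exprS -mulrA ler_wpM2l.
(* Solving the inequalities [h1] to [h4] for the stable part gives 4/3 + 2/3 K^k, rounded up
   here. *)
exists (K ^+ k + 2) => [|p v Lp].
  by rewrite ler_wpDl ?exprn_ge0//; lra.
set s := sproj p v; set u := uproj p v.
have Ev : s + u = v by exact: proj_add.
have h1 : rnorm g (iter k f p) (tangent_map S (iter k f) p s) <= 1 / 2 * rnorm g p s.
  apply: (le_trans (Hs k Lp (sproj_in p v))); apply: ler_wpM2r; first exact: rnorm_ge0.
  exact: ltW.
have h2 : rnorm g p u <= 1 / 2 * rnorm g (iter k f p) (tangent_map S (iter k f) p u).
  have uE : tangent_map S (iter k f) p u \in Eu (iter k f p).
    by apply: subbundle_iter => //; exact: uproj_in.
  have := Hu k (iter_closed Lf k Lp) uE.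
  rewrite (iter_finv_f fK) (tangent_iter_finv_f fC finvC fK) => /le_trans; apply.
  by apply: ler_wpM2r; [exact: rnorm_ge0|exact: ltW].
have h3 : rnorm g (iter k f p) (tangent_map S (iter k f) p u) <=
    K ^+ k * rnorm g p v + rnorm g (iter k f p) (tangent_map S (iter k f) p s).
  have Eu' : u = v - s by rewrite -Ev addrAC subrr add0r.
  rewrite {1}Eu' tangent_mapB; apply: (le_trans (ler_rnormB _ _ _ _)).
  by rewrite lerD2r.
have h4 : rnorm g p s <= rnorm g p v + rnorm g p u.
  have {1}-> : s = v - u by rewrite -Ev addrK.
  exact: ler_rnormB.
have := rnorm_ge0 g p s; have := rnorm_ge0 g p v; have := rnorm_ge0 g p u.
have : 0 <= K ^+ k * rnorm g p v by rewrite mulr_ge0 ?exprn_ge0 ?rnorm_ge0.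
rewrite mulrDl; lra.
Qed.

Lemma su_norm_bounded : exists2 K : R, 1 <= K &
  forall p v, L p -> snorm p v <= K * rnorm g p v /\ unorm p v <= K * rnorm g p v.
Proof.
have [K K1 HK] := sproj_bounded.
exists (Num.max 1 (C * (K + 1))); first by rewrite le_max lexx.
move=> p v Lp.
have h1 := HK p v Lp; have h2 : rnorm g p (uproj p v) <= (K + 1) * rnorm g p v.
  have -> : uproj p v = v - sproj p v by apply/eqP; rewrite eq_sym subr_eq addrC proj_add.
  apply: (le_trans (ler_rnormB _ _ _ _)); rewrite mulrDl mul1r; lra.
have h3 : rnorm g p (sproj p v) <= (K + 1) * rnorm g p v.
  by apply: (le_trans h1); rewrite ler_wpM2r ?rnorm_ge0//; lra.
have h4 : C * ((K + 1) * rnorm g p v) <= Num.max 1 (C * (K + 1)) * rnorm g p v.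
  by rewrite mulrA ler_wpM2r ?rnorm_ge0// le_max lexx orbT.
split; apply: le_trans h4.
  apply: (le_trans (lyap_le lam01 (sproj_contracted v Lp))).
  by rewrite ler_pM2l.
apply: (le_trans (lyap_le lam01 (uproj_contracted v Lp))).
by rewrite ler_pM2l.
Qed.

(** * Cones and expansion along local unstable sets *)

Local Notation disp p q := (displacement kappa p q).

(** The one-step estimates of the tangent map, perturbed by the linearization error. The unstable
    one is read backward, from [f p] to [p], so its error stands inside the factor [lam]. *)
Lemma su_norm_step (eta : R) : 0 < eta -> \forall rho \near (0 : R)^'+, forall p q, L p ->
  (rdist g p q <= rho%:E)%E ->
  snorm (f p) (disp (f p) (f q)) <= lam * snorm p (disp p q) +
    eta * (snorm p (disp p q) + unorm p (disp p q)) /\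
  unorm p (disp p q) <= lam * (unorm (f p) (disp (f p) (f q)) +
    eta * (snorm p (disp p q) + unorm p (disp p q))).
Proof.
move=> eta0; have [K K1 HK] := su_norm_bounded.
have K0 : 0 < K by lra.
have := @displacement_linearization R n M S g cM kappa kappaP f _ fC (divr_gt0 eta0 K0).
apply: filterS => rho H p q Lp dpq; have {}H := H p q dpq.
set v := disp p q in H *; set v' := disp (f p) (f q) in H *.
set e := v' - tangent_map S f p v in H.
have Ev : v' = tangent_map S f p v + e by rewrite /e addrC subrK.
have He : K * rnorm g (f p) e <= eta * (snorm p v + unorm p v).
  apply: (@le_trans _ _ (K * (eta / K * rnorm g p v))); first by rewrite ler_pM2l.
  have -> : K * (eta / K * rnorm g p v) = eta * rnorm g p v by field; rewrite gt_eqF.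
  by rewrite ler_pM2l// rnorm_le_su.
have [Se Ue] := HK (f p) e (Lf Lp).
split.
  rewrite Ev; apply: (le_trans (snormD _ _ (Lf Lp))); apply: lerD; first exact: snorm_f.
  exact: le_trans Se He.
apply: (le_trans (unorm_f v Lp)); rewrite ler_pM2l//.
have -> : tangent_map S f p v = v' + - e by rewrite Ev addrK.
apply: (le_trans (unormD _ _ (Lf Lp))); rewrite lerD2l.
have [_ Une] := HK (f p) (- e) (Lf Lp); rewrite rnormN in Une.
exact: le_trans Une He.
Qed.

(** Membership of [q] in the local unstable set of size [rho] at [p], as a relation because both
    points move along their orbits. *)
Definition backclose (rho : R) p q :=
  forall k, (rdist g (iter k finv p) (iter k finv q) <= rho%:E)%E.

Lemma backclose0 rho p q : backclose rho p q -> (rdist g p q <= rho%:E)%E.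
Proof. by move/(_ 0%N). Qed.

Lemma backclose_finv rho p q k : backclose rho p q ->
  backclose rho (iter k finv p) (iter k finv q).
Proof. by move=> H m; rewrite -!iterD; exact: H. Qed.

Lemma backclose_f rho p q : backclose rho p q -> (rdist g (f p) (f q) <= rho%:E)%E ->
  backclose rho (f p) (f q).
Proof. by move=> H H0 [|k]; [exact: H0|rewrite !iterSr !fK; exact: H]. Qed.

Lemma backclose_iter rho p q m : backclose rho p q ->
  (forall j, (j < m)%N -> (rdist g (iter j f p) (iter j f q) <= rho%:E)%E) ->
  forall j, (j < m)%N -> backclose rho (iter j f p) (iter j f q).
Proof.
move=> H Hm; elim=> [//|j IH] jm; rewrite !iterS; apply: backclose_f.
  by apply: IH; exact: ltnW.
by rewrite -!iterS; exact: Hm.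
Qed.

Lemma disp_le_rdist : \forall rho \near (0 : R)^'+, forall p q,
  (rdist g p q <= rho%:E)%E -> rnorm g p (disp p q) <= 1.
Proof.
have H := @displacement_rdist R n M S g cM kappa kappaP.
have H0 : \forall rho \near (0 : R)^'+, 0 < rho by exact: nbhs_right_gt.
apply: filterS2 H0 H => rho r0 H p q d; have [_ A] := H p q d.
rewrite -lee_fin; apply: (le_trans A).
have -> : 1%:E = (rho^-1%:E * rho%:E)%E by rewrite -EFinM mulVf ?gt_eqF.
by apply: lee_wpmul2l => //; rewrite lee_fin invr_ge0 ltW.
Qed.

Lemma unstable_cone (al : R) : 0 < al <= 1 -> \forall rho \near (0 : R)^'+,
  forall p q, L p -> backclose rho p q -> snorm p (disp p q) <= al * unorm p (disp p q).
Proof.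
move=> al01; have /andP[al0 al1] := al01; have /andP[_ lam1] := lam01.
pose eta := al * (1 - lam) / 8.
have eta0 : 0 < eta by rewrite divr_gt0// mulr_gt0// subr_gt0.
have [K K1 HK] := su_norm_bounded.
apply: filterS2 disp_le_rdist (su_norm_step eta0) => rho H1 H2 p q Lp bc.
pose a k := snorm (iter k finv p) (disp (iter k finv p) (iter k finv q)).
pose b k := unorm (iter k finv p) (disp (iter k finv p) (iter k finv q)).
have Lk k := iter_closed Lfinv k Lp.
apply: (@cone_sequence R a b K lam al eta) => //.
- by rewrite lexx ltW.
- move=> k; apply/andP; split; first exact: snorm_ge0.
  have [A _] := HK _ (disp (iter k finv p) (iter k finv q)) (Lk k).
  apply: (le_trans A); rewrite -[leRHS]mulr1 ler_wpM2l//; first lra.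
  by apply: H1; exact: bc.
- by move=> k; exact: unorm_ge0.
- move=> k; have [A _] := H2 _ _ (Lk k.+1) (bc k.+1).
  by rewrite !iterS !finvK in A.
- move=> k; have [_ A] := H2 _ _ (Lk k.+1) (bc k.+1).
  by rewrite !iterS !finvK in A.
Qed.

(** In the cone of slope 1 the linearization error is a small multiple of the unstable part, so a
    backward step contracts it by (1 + lam) / 2. *)
Lemma unstable_contraction : \forall rho \near (0 : R)^'+, forall p q, L p ->
  backclose rho p q -> forall k,
  unorm (iter k finv p) (disp (iter k finv p) (iter k finv q)) <=
    ((1 + lam) / 2) ^+ k * unorm p (disp p q) /\
  rnorm g (iter k finv p) (disp (iter k finv p) (iter k finv q)) <=
    2 * ((1 + lam) / 2) ^+ k * unorm p (disp p q).
Proof.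
have /andP[l0 lam1] := lam01.
have eta0 : 0 < (1 - lam) / 8 by lra.
have one : 0 < (1 : R) <= 1 by rewrite ltr01 lexx.
apply: filterS2 (unstable_cone one) (su_norm_step eta0) => rho H1 H2 p q Lp bc.
have Lk k := iter_closed Lfinv k Lp.
have main k : unorm (iter k finv p) (disp (iter k finv p) (iter k finv q)) <=
    ((1 + lam) / 2) ^+ k * unorm p (disp p q).
  elim: k => [|k IH]; first by rewrite expr0 mul1r.
  rewrite exprS -mulrA; apply: (@le_trans _ _ ((1 + lam) / 2 *
    unorm (iter k finv p) (disp (iter k finv p) (iter k finv q)))); last first.
    by rewrite ler_pM2l//; lra.
  have [_ A] := H2 _ _ (Lk k.+1) (bc k.+1).
  have B := H1 _ _ (Lk k.+1) (backclose_finv k.+1 bc).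
  have U := unorm_ge0 (disp (iter k.+1 finv p) (iter k.+1 finv q)) (Lk k.+1).
  have U0 := unorm_ge0 (disp (iter k finv p) (iter k finv q)) (Lk k).
  have Ef (x : M) : f (iter k.+1 finv x) = iter k finv x by rewrite iterS finvK.
  rewrite !Ef in A; rewrite mul1r in B.
  move: A B U U0; set s1 := snorm _ _; set u1 := unorm _ _; set u0 := unorm _ _ => A B U U0.
  have h1 : (1 - lam) / 8 * (s1 + u1) <= (1 - lam) / 4 * u1.
    have -> : (1 - lam) / 4 * u1 = (1 - lam) / 8 * (u1 + u1) by field.
    by rewrite ler_pM2l// lerD2r.
  have h2 : u1 <= lam * (u0 + (1 - lam) / 4 * u1).
    by apply: (le_trans A); rewrite ler_pM2l// lerD2l.
  have h3 : lam * ((1 - lam) / 4 * u1) <= (1 - lam) / 4 * u1.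
    by apply: ler_piMl; [apply: mulr_ge0 => //; lra|exact: ltW].
  have h4 : (1 - (1 - lam) / 4) * u1 <= lam * u0.
    by rewrite mulrDr in h2; rewrite mulrBl mul1r; lra.
  have c0 : 0 < 1 - (1 - lam) / 4 by lra.
  (* What remains is lam <= (1 - (1 - lam) / 4) (1 + lam) / 2. *)
  rewrite -(ler_pM2l c0); apply: (le_trans h4); rewrite mulrA ler_wpM2r//.
  nra.
move=> k; split=> //; have B := H1 _ _ (Lk k) (backclose_finv k bc); rewrite mul1r in B.
apply: (le_trans (rnorm_le_su _ (Lk k))).
apply: (@le_trans _ _ (2 * unorm (iter k finv p) (disp (iter k finv p) (iter k finv q)))).
  by rewrite mulr_natl mulr2n lerD2r.
by rewrite -mulrA ler_wpM2l.
Qed.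

Lemma rdist_le_disp : exists2 K : R, 0 < K & \forall rho \near (0 : R)^'+, forall p q,
  (rdist g p q <= rho%:E)%E -> (rdist g p q <= (K * rnorm g p (disp p q))%:E)%E /\
   ((rnorm g p (disp p q))%:E <= K%:E * rdist g p q)%E.
Proof.
have H := @displacement_rdist R n M S g cM kappa kappaP.
have H0 : \forall rho \near (0 : R)^'+, 0 < rho by exact: nbhs_right_gt.
have [r [r0 Hr]] := filter_ex (filterI H0 H).
exists r^-1; first by rewrite invr_gt0.
have H1 : \forall rho \near (0 : R)^'+, rho < r by exact: nbhs_right_lt.
apply: filterS H1 => rho rr p q d; apply: Hr; apply: (le_trans d).
by rewrite lee_fin ltW.
Qed.

(** By backward contraction the present distance controls all past ones. Thus points of a local
    unstable set of fixed size that are very close now have been very close throughout the past. *)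
Lemma backclose_shrink : exists2 K : R, 0 < K & \forall rho \near (0 : R)^'+, forall p q, L p ->
  backclose rho p q -> forall r, (rdist g p q <= r%:E)%E -> backclose (K * r) p q.
Proof.
have [K K0 HK] := rdist_le_disp; have [K' K'1 HK'] := su_norm_bounded.
have K'0 : 0 < K' by lra.
exists (K * (2 * (K' * K))); first by rewrite !mulr_gt0.
have /andP[l0 l1] := lam01.
apply: filterS2 HK unstable_contraction => rho H1 H2 p q Lp bc r dr k.
have [A _] := H1 _ _ (bc k); apply: (le_trans A); rewrite lee_fin -mulrA ler_pM2l//.
have [_ B] := H2 p q Lp bc k; apply: (le_trans B).
rewrite -mulrA -[leRHS]mulrA ler_pM2l//.
have U0 : 0 <= unorm p (disp p q) by exact: unorm_ge0.
apply: (@le_trans _ _ (unorm p (disp p q))).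
  by apply: ler_piMl => //; apply: exprn_ile1; lra.
have [_ U] := HK' p (disp p q) Lp; apply: (le_trans U); rewrite -mulrA ler_pM2l//.
have [_ D] := H1 p q (backclose0 bc); rewrite -lee_fin; apply: (le_trans D).
by rewrite EFinM; apply: lee_wpmul2l => //; rewrite lee_fin ltW.
Qed.

(** A displacement in a thin cone around [Eu p] is expanded by almost the rate [m] of [Eu p]. The
    radius works for all [m >= m0], because the errors are small relative to [m0]. *)
Lemma expansion_step (mu m0 : R) : 0 < mu < 1 -> 0 < m0 -> \forall rho \near (0 : R)^'+,
  forall p q, L p -> backclose rho p q -> forall m, m0 <= m ->
  (forall v, v \in Eu p -> m * rnorm g p v <= rnorm g (f p) (tangent_map S f p v)) ->
  mu * m * rnorm g p (disp p q) <= rnorm g (f p) (disp (f p) (f q)).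
Proof.
move=> /andP[mu0 mu1] m00.
have [K [K1 HK HK2]] := tangent_bounds; have [K' K'1 HK'] := su_norm_bounded.
have K0 : 0 < K by lra.
have K'0 : 0 < K' by lra.
(* the total error is [al * K' * (m + K) + eta], relative to [m] *)
pose al := Num.min 1 ((1 - mu) / 4 / K' / (1 + K / m0)).
have d0 : 0 < 1 + K / m0 by rewrite ltr_pwDl// divr_ge0 ?ltW.
have mu10 : 0 < (1 - mu) / 4 by lra.
have al0 : 0 < al.
  by rewrite lt_min ltr01 /=; apply: divr_gt0 => //; apply: divr_gt0.
have al01 : 0 < al <= 1 by rewrite al0 ge_min lexx.
have eta0 : 0 < (1 - mu) / 4 * m0 by rewrite mulr_gt0.
have HL := @displacement_linearization R n M S g cM kappa kappaP f _ fC eta0.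
apply: filterS2 HL (unstable_cone al01) => rho H1 H2 p q Lp bc m mm0 Hm.
have m_gt0 : 0 < m by apply: lt_le_trans mm0.
have h1 := H1 p q (backclose0 bc); have h2 := H2 p q Lp bc.
have [_ h3] := HK' p (disp p q) Lp.
set v := disp p q in h1 h2 h3 *; set v' := disp (f p) (f q) in h1 *.
have Ev := proj_add v Lp.
have h4 : rnorm g p (sproj p v) <= al * K' * rnorm g p v.
  apply: (le_trans (lyap_ge lam01 (sproj_contracted v Lp))).
  by apply: (le_trans h2); rewrite -mulrA ler_pM2l.
have h5 : rnorm g p v <= rnorm g p (uproj p v) + rnorm g p (sproj p v).
  by rewrite addrC -{1}Ev; exact: ler_rnormD.
have h6 := Hm _ (uproj_in p v); have h7 := HK p (sproj p v).
have h8 : rnorm g (f p) (tangent_map S f p (uproj p v)) <= rnorm g (f p) v' +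
   rnorm g (f p) (v' - tangent_map S f p v) + rnorm g (f p) (tangent_map S f p (sproj p v)).
  have -> : tangent_map S f p (uproj p v) = v' - (v' - tangent_map S f p v) - tangent_map S f p (sproj p v).
    have E : tangent_map S f p v = tangent_map S f p (sproj p v) + tangent_map S f p (uproj p v).
      by rewrite -tangent_mapD Ev.
    by rewrite subKr E addrAC subrr add0r.
  apply: (le_trans (ler_rnormB _ _ _ _)); rewrite lerD2r; exact: ler_rnormB.
have V0 := rnorm_ge0 g p v.
have h9 : al * K' * (m + K) <= (1 - mu) / 4 * m.
  have a1 : al <= (1 - mu) / 4 / K' / (1 + K / m0) by rewrite ge_min lexx orbT.
  have a2 : m + K <= m * (1 + K / m0).
    rewrite mulrDr mulr1 lerD2l mulrCA -[leLHS]mulr1 ler_pM2l//.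
    by rewrite ler_pdivlMr// mul1r.
  apply: (@le_trans _ _ ((1 - mu) / 4 / K' / (1 + K / m0) * K' * (m * (1 + K / m0)))).
    by apply: ler_pM => //; [rewrite mulr_ge0 ?ltW|rewrite addr_ge0 ?ltW|rewrite ler_pM2r].
  move: d0; set d := 1 + K / m0 => d0.
  by rewrite le_eqVlt; apply/orP; left; apply/eqP; field; rewrite !gt_eqF.
have h10 : (1 - mu) / 4 * m0 * rnorm g p v <= (1 - mu) / 4 * m * rnorm g p v.
  by rewrite ler_wpM2r// ler_pM2l.
have h11 : al * K' * (m + K) * rnorm g p v <= (1 - mu) / 4 * m * rnorm g p v.
  by rewrite ler_wpM2r.
have h12 : m * rnorm g p (sproj p v) <= m * (al * K' * rnorm g p v) by rewrite ler_pM2l.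
have h13 : K * rnorm g p (sproj p v) <= K * (al * K' * rnorm g p v) by rewrite ler_pM2l.
have h14 : m * rnorm g p v <= m * rnorm g p (uproj p v) + m * rnorm g p (sproj p v).
  by rewrite -mulrDr ler_pM2l.
have h15 : al * K' * (m + K) * rnorm g p v = m * (al * K' * rnorm g p v) + K * (al * K' * rnorm g p v) by ring.
have h16 : 0 <= (1 - mu) / 4 * m * rnorm g p v.
  by apply: mulr_ge0 => //; apply: ltW; apply: mulr_gt0.
(* The slack (1 - mu) m is cut into quarters; the stable part and the linearization use one each. *)
have h17 : mu * m * rnorm g p v = m * rnorm g p v - 4 * ((1 - mu) / 4 * m * rnorm g p v) by field.
rewrite h15 in h11.
lra.
Qed.

Lemma unstable_trivial : \forall rho \near (0 : R)^'+, forall p q, L p -> backclose rho p q ->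
  Eu p = 0%VS -> rdist g p q = 0%E.
Proof.
have one : 0 < (1 : R) <= 1 by rewrite ltr01 lexx.
have [K K0 HK] := rdist_le_disp.
apply: filterS2 HK (unstable_cone one) => rho H1 H2 p q Lp bc E0.
have A := H2 p q Lp bc.
have u0 : uproj p (disp p q) = 0.
  by apply/eqP; rewrite -memv0 -E0; exact: uproj_in.
have un0 : unorm p (disp p q) = 0 by rewrite /unorm u0; exact: lyap0.
rewrite un0 mulr0 in A.
have B := rnorm_le_su (disp p q) Lp; rewrite un0 addr0 in B.
have r0 : rnorm g p (disp p q) <= 0 := le_trans B A.
have [D _] := H1 p q (backclose0 bc).
apply/eqP; rewrite eq_le rdist_ge0 andbT; apply: (le_trans D).
by rewrite lee_fin pmulr_rle0.
Qed.

Lemma unorm_trivial p v : L p -> Eu p = 0%VS -> unorm p v = 0.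
Proof.
move=> Lp E0; have u0 : uproj p v = 0.
  by apply/eqP; rewrite -memv0 -E0; exact: uproj_in.
by rewrite /unorm u0; exact: lyap0.
Qed.

Lemma Eu_trivial_f p : L p -> Eu (f p) = 0%VS <-> Eu p = 0%VS.
Proof.
move=> Lp; split=> E0; apply/eqP; rewrite -subv0; apply/subvP => v vE; rewrite memv0; apply/eqP.
  have := subbundle_f EuD Lp vE; rewrite E0 memv0 => /eqP Dv.
  by rewrite -(tangent_finv_f fC finvC fK p v) Dv tangent_map0.
have := subbundle_finv EuD (Lf Lp) vE; rewrite fK E0 memv0 => /eqP Dv.
by rewrite -(tangent_f_finv fC finvC finvK (f p) v) Dv tangent_map0.
Qed.

Lemma unstable_set_backclose (rho : R) : 0 < rho -> \forall be \near (0 : R)^'+,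
  forall x y z, unstable_set g finv be x y -> unstable_set g finv be x z -> backclose rho y z.
Proof.
move=> rho0; have H := rdist_quasi_triangle g cM.
have H0 : \forall r \near (0 : R)^'+, 0 < r by exact: nbhs_right_gt.
have [r [r0 Hr]] := filter_ex (filterI H0 H).
have H1 : \forall be \near (0 : R)^'+, be < r by exact: nbhs_right_lt.
have H2 : \forall be \near (0 : R)^'+, be < r * rho by apply: nbhs_right_lt; rewrite mulr_gt0.
apply: filterS2 H1 H2 => be ber berr x y z Wy Wz k.
apply: (le_trans (Hr _ _ _ be (ltW ber) (Wy k) (Wz k))).
by rewrite lee_fin mulrC ler_pdivrMr// mulrC ltW.
Qed.

Lemma rdist_quasi_sym : exists2 K : R, 0 < K & \forall rho \near (0 : R)^'+, forall p q r,
  r <= rho -> (rdist g p q <= r%:E)%E -> (rdist g q p <= (K * r)%:E)%E.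
Proof.
have H := rdist_quasi_triangle g cM.
have H0 : \forall r \near (0 : R)^'+, 0 < r by exact: nbhs_right_gt.
have [r [r0 Hr]] := filter_ex (filterI H0 H).
exists r^-1; first by rewrite invr_gt0.
have H1 : \forall be \near (0 : R)^'+, be < r by exact: nbhs_right_lt.
apply: filterS H1 => rho rr p q r' r'rho d.
apply: (Hr p q p r' _ d); first exact: le_trans (ltW rr).
by rewrite rdist_refl// lee_fin -lee_fin (le_trans (rdist_ge0 g p q)).
Qed.

(** Displacements grow by at most [K1 + 1] per step: [K1] for the tangent map and 1 for the
    linearization error. *)
Lemma orbit_lipschitz : exists2 K : R, 1 <= K & forall e : R, 0 < e -> exists2 c : R, 0 < c &
  forall p q m, (rdist g p q <= (c / K ^+ m)%:E)%E ->
    forall j, (j <= m)%N -> (rdist g (iter j f p) (iter j f q) <= e%:E)%E.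
Proof.
have [fc _] := fC.
have [K1 [K11 HK _]] := tangent_bounds; have [K2 K20 HK2] := rdist_le_disp.
have HL := @displacement_linearization R n M S g cM kappa kappaP f _ fC (@ltr01 R).
have H0 : \forall r \near (0 : R)^'+, 0 < r by exact: nbhs_right_gt.
have [r1 [r10 [H1 H2]]] := filter_ex (filterI H0 (filterI HL HK2)).
have HU := @rdist_unif_continuous R n M S g cM f r1 fc r10.
have [r2 [r20 H3]] := filter_ex (filterI H0 HU).
exists (K1 + 1) => [|e e0]; first lra.
pose e' := Num.min e (Num.min r1 r2).
have e'0 : 0 < e' by rewrite !lt_min e0 r10 r20.
have [e'e e'1 e'2] : [/\ e' <= e, e' <= r1 & e' <= r2] by rewrite !ge_min !lexx !orbT.
pose c := Num.min e' (e' / (K2 * K2)).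
have KK0 : 0 < K2 * K2 by rewrite mulr_gt0.
have c0 : 0 < c by rewrite lt_min e'0 divr_gt0.
have K0 : 0 < K1 + 1 by lra.
exists c => // p q m dpq.
have Km : 1 <= (K1 + 1) ^+ m by apply: exprn_ege1; lra.
have dpq1 : c / (K1 + 1) ^+ m <= c.
  by rewrite ler_pdivrMr ?exprn_gt0// ler_peMr// ltW.
have dr1 : (rdist g p q <= r1%:E)%E.
  by apply: (le_trans dpq); rewrite lee_fin (le_trans dpq1)// ge_min e'1.
have v0 : rnorm g p (disp p q) <= K2 * (c / (K1 + 1) ^+ m).
  have [_ A] := H2 p q dr1; rewrite -lee_fin; apply: (le_trans A).
  by rewrite EFinM; apply: lee_wpmul2l => //; rewrite lee_fin ltW.
suff main j : (j <= m)%N -> (rdist g (iter j f p) (iter j f q) <= e'%:E)%E /\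
    rnorm g (iter j f p) (disp (iter j f p) (iter j f q)) <= (K1 + 1) ^+ j * rnorm g p (disp p q).
  by move=> j jm; have [A _] := main j jm; apply: (le_trans A); rewrite lee_fin.
elim: j => [_|j IH jm].
  split; last by rewrite expr0 mul1r.
  by apply: (le_trans dpq); rewrite lee_fin (le_trans dpq1)// ge_min lexx.
have [dj vj] := IH (ltnW jm).
have dj1 : (rdist g (iter j f p) (iter j f q) <= r1%:E)%E by apply: (le_trans dj); rewrite lee_fin.
have vS : rnorm g (iter j.+1 f p) (disp (iter j.+1 f p) (iter j.+1 f q)) <=
    (K1 + 1) ^+ j.+1 * rnorm g p (disp p q).
  rewrite exprS -mulrA; apply: (@le_trans _ _ ((K1 + 1) *
    rnorm g (iter j f p) (disp (iter j f p) (iter j f q)))); last by rewrite ler_pM2l.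
  have A := H1 _ _ dj1; rewrite mul1r in A.
  have B := ler_rnorm_dist g (f (iter j f p)) (disp (f (iter j f p)) (f (iter j f q)))
    (tangent_map S f (iter j f p) (disp (iter j f p) (iter j f q))).
  have D := HK (iter j f p) (disp (iter j f p) (iter j f q)).
  by rewrite !iterS mulrDl mul1r; lra.
(* Displacements control distances only within [r1]; uniform continuity of [f] provides this before
   the sharper bound is available. *)
split=> //; have dS1 : (rdist g (iter j.+1 f p) (iter j.+1 f q) <= r1%:E)%E.
  by rewrite !iterS; apply: H3; apply: (le_trans dj); rewrite lee_fin.
have [A _] := H2 _ _ dS1; apply: (le_trans A); rewrite lee_fin.
apply: (@le_trans _ _ (K2 * ((K1 + 1) ^+ m * (K2 * (c / (K1 + 1) ^+ m))))).
  rewrite ler_pM2l//; apply: (le_trans vS); apply: ler_pM => //.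
  - by rewrite exprn_ge0// ltW.
  - exact: rnorm_ge0.
  - by apply: ler_weXn2l => //; lra.
have -> : K2 * ((K1 + 1) ^+ m * (K2 * (c / (K1 + 1) ^+ m))) = c * (K2 * K2).
  by field; rewrite expf_neq0// gt_eqF.
by rewrite -ler_pdivlMr// ge_min lexx orbT.
Qed.

(** Displacements are purely stable here, and their Lyapunov norm does not grow: the error [1 - lam]
    just makes up for the factor [lam]. *)
Lemma stable_orbit (e : R) : 0 < e -> exists2 rho : R, 0 < rho & forall p q, L p ->
  Eu p = 0%VS -> (rdist g p q <= rho%:E)%E ->
  forall j, (rdist g (iter j f p) (iter j f q) <= e%:E)%E.
Proof.
move=> e0; have [fc _] := fC; have /andP[l0 l1] := lam01.
have [K1 K11 HK] := su_norm_bounded; have [K2 K20 HK2] := rdist_le_disp.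
have lam10 : 0 < 1 - lam by rewrite subr_gt0.
have H0 : \forall r \near (0 : R)^'+, 0 < r by exact: nbhs_right_gt.
have [r1 [r10 [H1 H2]]] := filter_ex (filterI H0 (filterI (su_norm_step lam10) HK2)).
have HU := @rdist_unif_continuous R n M S g cM f r1 fc r10.
have [r2 [r20 H3]] := filter_ex (filterI H0 HU).
pose e' := Num.min e (Num.min r1 r2).
have e'0 : 0 < e' by rewrite !lt_min e0 r10 r20.
have [e'e e'1 e'2] : [/\ e' <= e, e' <= r1 & e' <= r2] by rewrite !ge_min !lexx !orbT.
have K10 : 0 < K1 by lra.
have KK0 : 0 < K2 * (K1 * K2) by rewrite !mulr_gt0.
pose c := Num.min e' (e' / (K2 * (K1 * K2))).
have c0 : 0 < c by rewrite lt_min e'0 divr_gt0.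
exists c => // p q Lp E0 dpq.
have dr1 : (rdist g p q <= r1%:E)%E.
  by apply: (le_trans dpq); rewrite lee_fin ge_min e'1.
have v0 : rnorm g p (disp p q) <= K2 * c.
  have [_ A] := H2 p q dr1; rewrite -lee_fin; apply: (le_trans A).
  by rewrite EFinM; apply: lee_wpmul2l => //; rewrite lee_fin ltW.
have a0 : snorm p (disp p q) <= K1 * (K2 * c).
  have [A _] := HK p (disp p q) Lp; apply: (le_trans A).
  by rewrite ler_pM2l.
suff main j : (rdist g (iter j f p) (iter j f q) <= e'%:E)%E /\
    snorm (iter j f p) (disp (iter j f p) (iter j f q)) <= snorm p (disp p q).
  by move=> j; have [A _] := main j; apply: (le_trans A); rewrite lee_fin.
elim: j => [|j [dj vj]].
  by split=> //; apply: (le_trans dpq); rewrite lee_fin ge_min lexx.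
have Lj := iter_closed Lf j Lp; have Ej := (Eu_iter Lf Eu_trivial_f j Lp).2 E0.
have dj1 : (rdist g (iter j f p) (iter j f q) <= r1%:E)%E by apply: (le_trans dj); rewrite lee_fin.
have vS : snorm (iter j.+1 f p) (disp (iter j.+1 f p) (iter j.+1 f q)) <= snorm p (disp p q).
  have [A _] := H1 _ _ Lj dj1; rewrite (unorm_trivial _ Lj Ej) addr0 -mulrDl in A.
  rewrite addrC subrK mul1r in A.
  by apply: le_trans vj; rewrite !iterS.
split=> //; have dS1 : (rdist g (iter j.+1 f p) (iter j.+1 f q) <= r1%:E)%E.
  by rewrite !iterS; apply: H3; apply: (le_trans dj); rewrite lee_fin.
have [A _] := H2 _ _ dS1; apply: (le_trans A); rewrite lee_fin.
have LS := iter_closed Lf j.+1 Lp; have ES := (Eu_iter Lf Eu_trivial_f j.+1 Lp).2 E0.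
apply: (@le_trans _ _ (K2 * (K1 * (K2 * c)))).
  rewrite ler_pM2l//; apply: (le_trans (rnorm_le_su _ LS)).
  rewrite (unorm_trivial _ LS ES) addr0; exact: le_trans vS a0.
have -> : K2 * (K1 * (K2 * c)) = c * (K2 * (K1 * K2)) by ring.
by rewrite -ler_pdivlMr// ge_min lexx orbT.
Qed.

(** The backward images of the stable part stay bounded, since those of [v] and of its unstable part
    do. Returning by forward contraction bounds the stable part by a multiple of [lam ^+ k] for
    every [k]. *)
Lemma Eu_of_contracted p v : L p ->
  (forall k, rnorm g (iter k finv p) (tangent_map S (iter k finv) p v) <=
    C * lam ^+ k * rnorm g p v) -> v \in Eu p.
Proof.
move=> Lp H; have /andP[l0 l1] := lam01.
have Ev := proj_add v Lp; set s := sproj p v in Ev; set u := uproj p v in Ev.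
suff s0 : rnorm g p s <= 0.
  by rewrite -Ev (rnorm_le0 s0) add0r; exact: uproj_in.
pose B := C * (C * (rnorm g p v + rnorm g p u)).
have bound k : rnorm g p s <= lam ^+ k * B.
  have sE : tangent_map S (iter k finv) p s \in Es (iter k finv p).
    by apply: subbundle_iter_finv => //; exact: sproj_in.
  have := Hs k (iter_closed Lfinv k Lp) sE.
  rewrite (iter_f_finv finvK) (tangent_iter_f_finv fC finvC finvK) => /le_trans; apply.
  rewrite mulrAC mulrC ler_pM2l ?exprn_gt0// /B ler_pM2l//.
  have -> : s = v - u by rewrite -Ev addrK.
  rewrite tangent_mapB; apply: (le_trans (ler_rnormB _ _ _ _)).
  rewrite mulrDr; apply: lerD.
    apply: (le_trans (H k)); apply: ler_wpM2r; first exact: rnorm_ge0.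
    by rewrite ger_pMr// exprn_ile1// ltW.
  apply: (le_trans (Hu k Lp (uproj_in p v))); apply: ler_wpM2r; first exact: rnorm_ge0.
  by rewrite ger_pMr// exprn_ile1// ltW.
have lim : (fun k => lam ^+ k * B) @ \oo --> 0 * B.
  by apply: cvgM; [apply: cvg_expr; rewrite ger0_norm// ltW|exact: cvg_cst].
rewrite mul0r in lim; rewrite leNgt; apply/negP => s0.
have [k Hk] := filter_ex (cvgr_lt 0 lim _ s0).
by have := lt_le_trans Hk (bound k); rewrite ltxx.
Qed.

(** Compactness of [L] and of the sphere makes the expansion uniform, once the unstable vectors are
    seen to be closed under limits. *)
Lemma uniform_expansion : compact L ->
  (forall p v, L p -> v \in Eu p -> v != 0 -> rnorm g p v < rnorm g (f p) (tangent_map S f p v)) ->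
  exists2 mu : R, 1 < mu & forall p v, L p -> v \in Eu p ->
    mu * rnorm g p v <= rnorm g (f p) (tangent_map S f p v).
Proof.
move=> cL Hexp.
have H : \forall k \near (1 : R)^'+, forall p, L p -> forall v, v != 0 -> L p -> v \in Eu p ->
    k * rnorm g p v <= rnorm g (f p) (tangent_map S f p v).
  apply: (@tangent_near_compact R n M S L R (at_right (1 : R)) _
    (fun k p v => L p -> v \in Eu p -> k * rnorm g p v <= rnorm g (f p) (tangent_map S f p v)) cL).
    move=> p0 w0 Lp0 w00 Z G FG w q k wc qc kc.
    have ip := chart_atP S p0; set i := chart_at S p0 in ip *.
    have c1 := tangent_cvg (g := g) FG fC ip qc wc; have c2 := rnorm_cvg (g := g) FG ip qc wc.
    have v00 : of_chart i p0 w0 != 0.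
      by apply: contra_neq w00 => E; rewrite -(of_chartK w0 ip) E; exact: linear0.
    have [vE|vnE] := pselect (of_chart i p0 w0 \in Eu p0).
      have lt := Hexp _ _ Lp0 vE v00.
      have k1 : k @ G --> (1 : R) by apply: cvg_trans kc _; exact: cvg_within.
      have c3 : rnorm g (f (q z)) (tangent_map S f (q z) (of_chart i (q z) (w z))) -
          k z * rnorm g (q z) (of_chart i (q z) (w z)) @[z --> G] -->
          rnorm g (f p0) (tangent_map S f p0 (of_chart i p0 w0)) - 1 * rnorm g p0 (of_chart i p0 w0).
        by apply: cvgB => //; exact: cvgM.
      rewrite mul1r in c3; rewrite -subr_gt0 in lt.
      by apply: filterS (cvgr_gt _ c3 _ lt) => z; rewrite subr_gt0 => /ltW.
    (* A vector outside [Eu p0] violates some backward contraction inequality. This is an open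
       condition, so nearby vectors over [L] are not unstable either. *)
    have [m Hm] : exists m, C * lam ^+ m * rnorm g p0 (of_chart i p0 w0) <
        rnorm g (iter m finv p0) (tangent_map S (iter m finv) p0 (of_chart i p0 w0)).
      apply: contrapT => nex; apply: vnE; apply: Eu_of_contracted => // m.
      by rewrite leNgt; apply/negP => lt; apply: nex; exists m.
    have c3 := tangent_cvg (g := g) FG (C1_map_iter m finvC) ip qc wc.
    have c4 : rnorm g (iter m finv (q z)) (tangent_map S (iter m finv) (q z) (of_chart i (q z) (w z))) -
        C * lam ^+ m * rnorm g (q z) (of_chart i (q z) (w z)) @[z --> G] -->
        rnorm g (iter m finv p0) (tangent_map S (iter m finv) p0 (of_chart i p0 w0)) -
        C * lam ^+ m * rnorm g p0 (of_chart i p0 w0).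
      by apply: cvgB => //; apply: cvgM => //; exact: cvg_cst.
    rewrite -subr_gt0 in Hm.
    apply: filterS (cvgr_gt _ c4 _ Hm) => z; rewrite subr_gt0 => lt Lq vE.
    exact: (False_ind _ (elimF idP (lt_geF lt) (Hu m Lq vE))).
  move=> k p v c c0 A Lp vE; rewrite tangent_mapZ !rnormZ mulrCA ler_pM2l ?normr_gt0//.
  apply: A => //; have := memvZ c^-1 vE.
  by rewrite scalerA mulVf// scale1r.
have H1 : \forall k \near (1 : R)^'+, 1 < k by exact: nbhs_right_gt.
have [mu [mu1 Hmu]] := filter_ex (filterI H1 H).
exists mu => // p v Lp vE; have [->|v0] := eqVneq v 0; last exact: Hmu.
by rewrite tangent_map0 !rnorm0 mulr0.
Qed.

(** * Entropy and pressure on the hyperbolic set *)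

Local Notation w := (uweight g f Eu).

(** Points in one cell of a grid of mesh about K^(-k) stay [e]-close for [k] steps, and there are
    about K^(kn) cells; the summand 1 absorbs the constants. *)
Lemma entropy_finite : exists b, subexp_bound g f L (w 0) b.
Proof.
have [K K1 HK] := orbit_lipschitz; have [N HN] := rdist_coloring g cM.
have K0 : 0 < K by lra.
exists (n%:R * ln K + 1) => e e0; have [c c0 Hc] := HK e e0.
pose A := N%:R / c + 1; have A0 : 0 < A by rewrite ltr_wpDl// divr_ge0// ltW.
have kA : \forall k \near \oo, N%:R * A ^+ n <= k%:R by exact: nbhs_infty_ger.
apply: filterS kA => k kA s us sL ss.
have Kk : 1 <= K ^+ k by exact: exprn_ege1.
have Kk0 : 0 < K ^+ k by lra.
have q0 : 0 <= N%:R * K ^+ k / c by rewrite divr_ge0 ?mulr_ge0// ltW.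
pose l := Num.truncn (N%:R * K ^+ k / c).
have [T [col [Tle colP]]] := HN l.
have lle : N%:R / l.+1%:R <= c / K ^+ k.
  rewrite ler_pdivrMr ?ltr0n// mulrAC ler_pdivlMr// -ler_pdivrMl// mulrC.
  by apply: ltW; exact: truncnS_gt.
have sT : (size s <= #|T|)%N.
  apply: (separated_size us ss (c := col)) => p q ps qs E.
  apply: bowen_dist_le => [|j jk]; first exact: ltW.
  apply: (Hc p q k _ j (ltnW jk)); apply: le_trans (colP p q E) _.
  by rewrite lee_fin.
have l1 : l.+1%:R <= A * K ^+ k.
  rewrite -natr1 /A mulrDl mul1r; apply: lerD => //.
  have /andP[h _] := truncn_itv q0; apply: (le_trans h).
  by rewrite mulrAC.
rewrite (eq_bigr (fun=> 1%:E)); last by move=> x _; exact: uweight_potential0.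
rewrite sumEFin lee_fin big_const_seq count_predT iter_addr_0.
apply: (@le_trans _ _ (N%:R * (A * K ^+ k) ^+ n)).
  apply: (@le_trans _ _ (N * l.+1 ^ n)%N%:R).
    by rewrite ler_nat; exact: leq_trans sT Tle.
  rewrite natrM natrX ler_wpM2l//; apply: lerXn2r => //; rewrite nnegrE//.
  by rewrite mulr_ge0// ltW.
rewrite exprMn mulrA mulrDr mulr1 expRD.
have -> : (K ^+ k) ^+ n = expR (k%:R * (n%:R * ln K)).
  by rewrite !expRM_natl lnK ?posrE// -!exprM mulnC.
rewrite mulrC ler_pM2l ?expR_gt0//; apply: (le_trans kA).
by apply: le_trans (expR_ge1Dx _); rewrite lerDr.
Qed.

Lemma trivial_separated (e : R) : 0 < e -> exists N : nat, forall k (s : seq M),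
  uniq s -> {in s, forall x, L x} -> {in s, forall x, Eu x = 0%VS} ->
  Defs.separated g f k e [set` s] -> (size s <= N)%N.
Proof.
move=> e0; have [rho rho0 H] := stable_orbit e0; have [N HN] := rdist_coloring g cM.
pose l := Num.truncn (N%:R / rho); have [T [col [_ colP]]] := HN l.
exists #|T| => k s us sL sE ss; apply: (separated_size us ss (c := col)) => p q ps qs E.
apply: bowen_dist_le => [|j jk]; first exact: ltW.
apply: H; [exact: sL|exact: sE|]; apply: le_trans (colP p q E) _.
rewrite lee_fin ler_pdivrMr ?ltr0n// mulrC -ler_pdivrMr//.
by apply: ltW; exact: truncnS_gt.
Qed.

Lemma adapted_uniform : compact L -> adapted_metric g f L Eu ->
  exists2 mu : R, 1 < mu & forall p, L p -> (mu%:E <= min_norm g f p (Eu p))%E.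
Proof.
move=> cL ad; have [|mu mu1 H] := uniform_expansion cL.
  move=> p v Lp vE v0; have A := ad p Lp.
  rewrite -[ltLHS]mul1r -ltr_pdivlMr ?rnorm_gt0// -lte_fin.
  by apply: (lt_le_trans A); apply: ereal_inf_lbound; exists v.
by exists mu => // p Lp; apply/min_norm_geP => v vE; exact: H.
Qed.

Lemma adapted_pressure_zero : compact L -> L !=set0 -> adapted_metric g f L Eu ->
  exists2 tstar : R, 0 <= tstar & unique_pressure_zero g f L Eu tstar.
Proof.
move=> cL L0 ad; have [mu mu1 H] := adapted_uniform cL ad.
have [K [K1 HK HK']] := tangent_bounds.
exact: (pressure_zero_exists Lf Eu_trivial_f K1 HK HK' L0 entropy_finite trivial_separated mu1 H).
Qed.

(** On a single orbit the bound at [s] says that - s B_k <= k b. The extra factor exp (- (t - s)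
    B_k) of the weights at [t] therefore adds at most (t - s) / s * b to the rate. This takes the
    place of the monotonicity that uniform expansion would give. *)
Lemma subexp_scale (s t b : R) : 0 < s <= t -> subexp_bound g f L (w s) b ->
  subexp_bound g f L (w t) (t / s * b).
Proof.
move=> /andP[s0 st] H e e0; have t0 : 0 < t by lra.
have [K [K1 HK HK']] := tangent_bounds.
have k1 : \forall k \near \oo, (0 < k)%N by exists 1%N.
apply: filterS2 k1 (H e e0) => k k0 Hk sq us sL ss.
have single x : L x -> Eu x <> 0%VS -> - s * birkhoff g f Eu k x <= k%:R * b.
  move=> Lx E0; rewrite -ler_expR -lee_fin -(uweightE Lf Eu_trivial_f K1 HK HK')//.
  have := Hk [:: x] isT; rewrite big_seq1; apply.
    by move=> y; rewrite inE => /eqP ->.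
  by move=> y z /=; rewrite !inE => /eqP -> /eqP ->.
apply: (@le_trans _ _ (\sum_(x <- sq) (expR ((t - s) / s * (k%:R * b)))%:E * w s k x)%E).
  rewrite !big_seq; apply: lee_sum => x xs; have Lx := sL x xs.
  have [E0|E0] := pselect (Eu x = 0%VS).
    rewrite (uweight_trivial g Lf Eu_trivial_f t Lx E0 k0) gt_eqF// t0.
    by apply: mule_ge0; [rewrite lee_fin expR_ge0|exact: uweight_ge0].
  rewrite !(uweightE Lf Eu_trivial_f K1 HK HK')// -EFinM lee_fin -expRD ler_expR.
  have := single x Lx E0; set B := birkhoff _ _ _ _ _ => hB.
  have d0 : 0 <= (t - s) / s by rewrite divr_ge0 ?subr_ge0// ltW.
  have -> : - t * B = (t - s) / s * (- s * B) + - s * B by field; rewrite gt_eqF.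
  by rewrite lerD2r ler_wpM2l.
rewrite -ge0_sume_distrr; last by move=> x _; exact: uweight_ge0.
apply: (@le_trans _ _ ((expR ((t - s) / s * (k%:R * b)))%:E * (expR (k%:R * b))%:E)%E).
  by apply: lee_wpmul2l; [rewrite lee_fin expR_ge0|exact: Hk].
rewrite -EFinM lee_fin -expRD ler_expR le_eqVlt; apply/orP; left; apply/eqP.
by field; rewrite gt_eqF.
Qed.

(** Scaling from [tstar] shows that the pressure at [t] is at most 0, and uniqueness of the zero
    excludes equality. *)
Lemma pressure_neg (tstar t : R) : 0 < tstar -> tstar < t ->
  unique_pressure_zero g f L Eu tstar -> exists2 c : R, 0 < c & subexp_bound g f L (w t) (- c).
Proof.
move=> ts0 tt [P0 uP]; apply/pressure_lt0P; rewrite lt_neqAle; apply/andP; split.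
  by apply/eqP => /uP E; rewrite E ltxx in tt.
apply: (pressure_leP g f L _ 0).2 => b b0.
have t0 : 0 < t by lra.
have -> : b = t / tstar * (tstar / t * b) by field; rewrite !gt_eqF.
apply: subexp_scale; first by rewrite ts0 ltW.
apply: (pressure_leP g f L _ 0).1; first by rewrite P0.
by rewrite mulr_gt0// divr_gt0.
Qed.

(** * Contraction of Bowen balls and the dimension of local unstable sets *)

Section LocalUnstable.
Variable W : set M.
Hypothesis WL : W `<=` L.

(** The displacement grows along the orbit of [y] by [expansion_step], with loss exp (- delta) per
    step, and is bounded at time [k]; hence it was exponentially small at time 0. *)
Lemma bowen_contraction (rho K K' delta : R) : 0 < delta -> 1 <= K -> 0 < K' ->
  (forall p v, rnorm g (f p) (tangent_map S f p v) <= K * rnorm g p v) ->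
  (forall p v, rnorm g p v <= K * rnorm g (f p) (tangent_map S f p v)) ->
  (forall y z, W y -> W z -> backclose rho y z) ->
  (forall p q, L p -> backclose rho p q ->
    forall r, (rdist g p q <= r%:E)%E -> backclose (K' * r) p q) ->
  exists2 Kc : R, 0 < Kc & exists2 eps : R, 0 < eps & forall y z k, W y -> W z -> Eu y <> 0%VS ->
    (0 < k)%N ->
    (forall j, (j < k)%N -> (rdist g (iter j f y) (iter j f z) <= eps%:E)%E) ->
    (rdist g y z <= (Kc * expR (- (birkhoff g f Eu k y - k%:R * delta)))%:E)%E.
Proof.
move=> d0 K1 K'0 HK HK' Wrho shrink; have K0 : 0 < K by lra.
have [K2 K20 HK2] := rdist_le_disp.
have mu01 : 0 < expR (- delta) < 1 by rewrite expR_gt0 expR_lt1// oppr_lt0.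
have Ki0 : 0 < K^-1 by rewrite invr_gt0.
have HL := @displacement_linearization R n M S g cM kappa kappaP f _ fC (@ltr01 R).
have H0 : \forall r \near (0 : R)^'+, 0 < r by exact: nbhs_right_gt.
have [r [[r0 Hexp] [[H1 H2] H3]]] := filter_ex (filterI (filterI H0 (expansion_step mu01 Ki0))
  (filterI (filterI HL disp_le_rdist) HK2)).
(* Points within [eps] at time 0 have their whole past within [K' * eps <= r], as [expansion_step]
   requires. *)
pose eps := Num.min r (r / K').
have eps0 : 0 < eps by rewrite lt_min r0 divr_gt0.
have epsr : eps <= r by rewrite ge_min lexx.
have epsK : K' * eps <= r by rewrite mulrC -ler_pdivlMr// ge_min lexx orbT.
exists (K2 * (K + 1)); first by rewrite mulr_gt0//; lra.
exists eps => // y z k Wy Wz E0 k0 close.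
have Ly := WL Wy; have bc0 := shrink y z Ly (Wrho y z Wy Wz) eps (close 0%N k0).
have bcr : backclose r y z by move=> j; apply: (le_trans (bc0 j)); rewrite lee_fin.
have closer j : (j < k)%N -> (rdist g (iter j f y) (iter j f z) <= r%:E)%E.
  by move=> jk; apply: (le_trans (close j jk)); rewrite lee_fin.
have bcj := backclose_iter bcr closer.
have grow j : (j <= k)%N -> expR (birkhoff g f Eu j y - j%:R * delta) *
    rnorm g y (disp y z) <= rnorm g (iter j f y) (disp (iter j f y) (iter j f z)).
  elim: j => [_|j IH jk]; first by rewrite /birkhoff big_ord0 mul0r subr0 expR0 mul1r.
  have Lj := iter_closed Lf j Ly.
  have Ej : Eu (iter j f y) <> 0%VS by rewrite (Eu_iter Lf Eu_trivial_f j Ly).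
  have [_ mlo _ mE] := min_normE K1 HK HK' Ej.
  have := Hexp _ _ Lj (bcj j jk) _ mlo mE; rewrite !iterS; apply: le_trans.
  have -> : birkhoff g f Eu j.+1 y - j.+1%:R * delta = - delta + log_min_norm g f Eu (iter j f y) +
    (birkhoff g f Eu j y - j%:R * delta) by rewrite birkhoffS -natr1; ring.
  by rewrite expRD [expR (- delta + _)]expRD -mulrA ler_wpM2l ?IH ?mulr_ge0 ?expR_ge0// ltnW.
(* Closeness is known up to time [k - 1] only; the last step costs the bound [K] of the tangent map
   and 1 for linearization. *)
have last_le : rnorm g (iter k f y) (disp (iter k f y) (iter k f z)) <= K + 1.
  case: k k0 close closer bcj grow => [//|k] _ close closer bcj grow.
  have dk := closer k (ltnSn k); have A := H1 _ _ dk; have B := H2 _ _ dk.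
  have D := HK (iter k f y) (disp (iter k f y) (iter k f z)).
  have E := ler_rnorm_dist g (f (iter k f y)) (disp (f (iter k f y)) (f (iter k f z)))
    (tangent_map S f (iter k f y) (disp (iter k f y) (iter k f z))).
  have F : K * rnorm g (iter k f y) (disp (iter k f y) (iter k f z)) <= K * 1 by rewrite ler_pM2l.
  rewrite !iterS; lra.
have [A _] := H3 _ _ (closer 0%N k0); apply: (le_trans A); rewrite lee_fin -mulrA ler_pM2l//.
rewrite expRN ler_pdivlMr ?expR_gt0// mulrC.
exact: le_trans (grow k (leqnn k)) last_le.
Qed.

(** Backward contraction from the last time of closeness to time 0, at the uniform rate of the
    hyperbolic set. *)
Lemma bowen_contraction_hyp (rho : R) : 0 < rho ->
  (forall p q, L p -> backclose rho p q -> forall k,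
    unorm (iter k finv p) (disp (iter k finv p) (iter k finv q)) <=
    ((1 + lam) / 2) ^+ k * unorm p (disp p q) /\
    rnorm g (iter k finv p) (disp (iter k finv p) (iter k finv q)) <=
    2 * ((1 + lam) / 2) ^+ k * unorm p (disp p q)) ->
  (forall p q, (rdist g p q <= rho%:E)%E -> rnorm g p (disp p q) <= 1) ->
  (forall y z, W y -> W z -> backclose rho y z) ->
  exists2 Kc : R, 0 < Kc & exists2 eps : R, 0 < eps & forall y z k, W y -> W z -> (0 < k)%N ->
    (forall j, (j < k)%N -> (rdist g (iter j f y) (iter j f z) <= eps%:E)%E) ->
    (rdist g y z <= (Kc * ((1 + lam) / 2) ^+ k)%:E)%E.
Proof.
move=> rho0 H1 H2 Wrho; have /andP[l0 l1] := lam01; have l0' : 0 < (1 + lam) / 2 by lra.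
have [K K1 HK] := su_norm_bounded; have K0 : 0 < K by lra.
have [K2 K20 HK2] := rdist_le_disp.
have H0 : \forall r \near (0 : R)^'+, 0 < r by exact: nbhs_right_gt.
have [r [r0 H3]] := filter_ex (filterI H0 HK2).
(* Closeness at [k.+1] times allows [k] backward steps; the missing factor (1 + lam) / 2 goes into
   the constant. *)
exists (K2 * (2 * K / ((1 + lam) / 2))); first by rewrite mulr_gt0// divr_gt0// mulr_gt0.
exists (Num.min r rho) => [|y z [//|k] Wy Wz _ close]; first by rewrite lt_min r0.
have closerho j : (j < k.+1)%N -> (rdist g (iter j f y) (iter j f z) <= rho%:E)%E.
  by move=> jk; apply: (le_trans (close j jk)); rewrite lee_fin ge_min lexx orbT.
have Lk := iter_closed Lf k (WL Wy).
have bc := backclose_iter (Wrho y z Wy Wz) closerho (ltnSn k).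
have [_ A] := H1 _ _ Lk bc k; rewrite !(iter_finv_f fK) in A.
have [D _] : (rdist g y z <= (K2 * rnorm g y (disp y z))%:E)%E /\
   ((rnorm g y (disp y z))%:E <= K2%:E * rdist g y z)%E.
  by apply: H3; apply: (le_trans (close 0%N isT)); rewrite lee_fin ge_min lexx.
apply: (le_trans D); rewrite lee_fin -mulrA ler_pM2l//; apply: (le_trans A).
have [_ U] := HK _ (disp (iter k f y) (iter k f z)) Lk.
have V := H2 _ _ (closerho k (ltnSn k)).
apply: (@le_trans _ _ (2 * ((1 + lam) / 2) ^+ k * (K * 1))).
  rewrite ler_wpM2l ?mulr_ge0 ?exprn_ge0//; first exact: ltW.
  by apply: (le_trans U); rewrite ler_pM2l.
rewrite exprS le_eqVlt; apply/orP; left; apply/eqP; field.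
by rewrite gt_eqF//; lra.
Qed.

End LocalUnstable.

Lemma local_unstable_dim (tstar : R) : 0 <= tstar -> unique_pressure_zero g f L Eu tstar ->
  \forall rho \near (0 : R)^'+, forall W : set M, W `<=` L ->
    (forall y z, W y -> W z -> backclose rho y z) -> (upper_box_dim g W <= tstar%:E)%E.
Proof.
move=> ts0 uz; have [K' K'0 shrink] := backclose_shrink.
have [K [K1 HK HK']] := tangent_bounds; have K0 : 0 < K by lra.
have lK0 : 0 <= ln K by rewrite ln_ge0.
have [Ks Ks0 Hs'] := rdist_quasi_sym.
have H0 : \forall r \near (0 : R)^'+, 0 < r by exact: nbhs_right_gt.
have [rs [rs0 Hrs]] := filter_ex (filterI H0 Hs').
apply: filterS2 (filterI (filterI shrink unstable_trivial) H0)
  (filterI unstable_contraction disp_le_rdist) => rho [[H1 H2] rho0] [H3 H4] W WL Wrho.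
(* If [Eu] vanishes at a point of [W], all of [W] is at distance 0 from it. *)
have [[y Wy E0]|W0] := pselect (exists2 y, W y & Eu y = 0%VS).
  apply: (@le_trans _ _ 0%:E); last by rewrite lee_fin.
  apply: (@upper_box_dim_le R n M S g W 0 1 1) => //; apply: nearW => tau.
  exists [:: y] => [|z Wz]; first by rewrite mul0r expR0 mulr1.
  exists y; first by rewrite inE.
  by rewrite (H2 y z (WL y Wy) (Wrho y z Wy Wz) E0) lee_fin mul1r expR_ge0.
have WE y : W y -> Eu y <> 0%VS by move=> Wy E0; apply: W0; exists y.
apply/lee_addgt0Pr => e e0; rewrite -EFinD; set t := tstar + e.
have t0 : 0 < t by rewrite /t; lra.
have rself p : rdist g p p = 0%E by exact: rdist_refl.
have [tsp|tsn] := ltP 0 tstar.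
  have tt : tstar < t by rewrite /t; lra.
  have [c c0 Qc] := pressure_neg tsp tt uz.
  (* Half of the decay rate [c] pays for the correction, as t k delta = k c / 2. *)
  pose delta := c / 2 / t; have d0 : 0 < delta by rewrite !divr_gt0.
  have [Kc Kc0 [eps eps0 ct]] := bowen_contraction WL d0 K1 K'0 HK HK' Wrho H1.
  apply: (box_dim_cover rself eps0 t0 (gam := c / 2) (kap := ln K + 1)
    (B := fun k y => birkhoff g f Eu k y - k%:R * delta) _ _ Kc0 Ks0 rs0 Hrs).
  - by rewrite divr_gt0.
  - lra.
  - by move=> y z k Wy Wz; apply: ct => //; exact: WE.
  - move=> k y Wy; rewrite birkhoffS -natr1.
    have Ek : Eu (iter k f y) <> 0%VS by rewrite (Eu_iter Lf Eu_trivial_f k (WL y Wy)); exact: WE.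
    have := log_min_norm_le K1 HK HK' Ek; lra.
  - move=> k y Wy; have A := birkhoff_le Lf Eu_trivial_f K1 HK HK' k (WL y Wy) (WE y Wy).
    have B1 : 0 <= k%:R * delta by rewrite mulr_ge0// ltW.
    have B2 : 0 <= k%:R :> R by [].
    rewrite mulrDr; lra.
  apply: filterS (Qc eps eps0) => k Hk s us sW ss.
  have := Hk s us (fun x xs => WL x (sW x xs)) ss.
  have -> : (\sum_(x <- s) w t k x)%E = (\sum_(x <- s) expR (- t * birkhoff g f Eu k x))%:E.
    rewrite -sumEFin big_seq [RHS]big_seq; apply: eq_bigr => x xs.
    by apply: (uweightE Lf Eu_trivial_f K1 HK HK'); [exact: WL (sW x xs)|exact: WE (sW x xs)].
  rewrite lee_fin => A.
  have -> : \sum_(y <- s) expR (- t * (birkhoff g f Eu k y - k%:R * delta)) =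
      expR (k%:R * (c / 2)) * \sum_(y <- s) expR (- t * birkhoff g f Eu k y).
    rewrite mulr_sumr; apply: eq_bigr => y _; rewrite -expRD; congr expR.
    by rewrite /delta; field; rewrite gt_eqF.
  apply: (@le_trans _ _ (expR (k%:R * (c / 2)) * expR (k%:R * - c))).
    by rewrite ler_pM2l ?expR_gt0.
  by rewrite -expRD ler_expR le_eqVlt; apply/orP; left; apply/eqP; field.
(* Weights at exponent 0 are all 1, and the pressure there is 0: separated sets grow at less than
   half of the rate [t * - ln lam'], and the other half gives the decay [gam0]. *)
have ts : tstar = 0 by apply/eqP; rewrite eq_le ts0 tsn.
have /andP[l0 l1] := lam01; pose lam' := (1 + lam) / 2.
have l0' : 0 < lam' by rewrite /lam'; lra.
have kap0 : 0 < - ln lam' by rewrite oppr_gt0 ln_lt0// l0'/= /lam'; lra.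
have [Kc Kc0 [eps eps0 ct]] := bowen_contraction_hyp WL rho0 H3 H4 Wrho.
have gam0 : 0 < t * - ln lam' / 2 by rewrite divr_gt0// mulr_gt0.
apply: (box_dim_cover rself eps0 t0 gam0 kap0
    (B := fun k y => k%:R * - ln lam') Kc0 Ks0 rs0 Hrs).
- move=> y z k Wy Wz k0 close; have := ct y z k Wy Wz k0 close.
  by rewrite -mulrN opprK expRM_natl lnK.
- by move=> k y _; rewrite -natr1 mulrDl mul1r.
- by [].
have Q0 : subexp_bound g f L (w 0) (t * - ln lam' / 2).
  have [P0 _] := uz; rewrite ts in P0.
  by apply: (pressure_leP g f L _ 0).1 => //; rewrite P0.
apply: filterS (Q0 eps eps0) => k Hk s us sW ss.
have := Hk s us (fun x xs => WL x (sW x xs)) ss.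
rewrite (eq_bigr (fun=> 1%:E)); last by move=> x _; exact: uweight_potential0.
rewrite sumEFin lee_fin !big_const_seq !count_predT !iter_addr_0 => A.
rewrite -[leLHS]mulr_natl; apply: (@le_trans _ _ (expR (k%:R * (t * - ln lam' / 2)) *
   expR (- t * (k%:R * - ln lam')))).
  by rewrite ler_pM2r ?expR_gt0.
by rewrite -expRD ler_expR le_eqVlt; apply/orP; left; apply/eqP; field.
Qed.

End HyperbolicSet.

Theorem lemma3p6 (R : realType) (n : nat) (M : topologicalType)
    (S : smooth_manifold R n M) (g : riemannian_metric S)
    (compactM : compact [set: M])
    (f finv : M -> M) (diffeo_f : C1_diffeo S f finv)
    (L : set M) (Es Eu : M -> {vspace 'rV[R]_n})
    (hyp_L : hyperbolic_set g f finv L Es Eu)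
    (locmax_L : locally_maximal f finv L)
    (x : M) (Lx : L x) :
  (adapted_metric g f L Eu ->
     exists2 tstar : R, 0 <= tstar & unique_pressure_zero g f L Eu tstar) /\
  (forall tstar : R, 0 <= tstar -> unique_pressure_zero g f L Eu tstar ->
     \forall beta \near 0^'+,
       (upper_box_dim g (unstable_set g finv beta x `&` L) <= tstar%:E)%E).
Proof.
have [fK finvK fC finvC] := diffeo_f.
have [cL fL EsuP [_ _ EsD EuD] [C [lam [C0 lam01 Hs Hu]]]] := hyp_L.
have Lf p : L p -> L (f p) by move=> Lp; rewrite -fL; exists p.
have Lfinv p : L p -> L (finv p) by rewrite -{1}fL => -[q Lq <-]; rewrite fK.
have EsuT p (Lp : L p) := (EsuP p Lp).1.
have Esu0 p (Lp : L p) := (EsuP p Lp).2.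
have [kappa kappaP] := chart_selector_exists S compactM.
split=> [|tstar ts0 uz].
  apply: (adapted_pressure_zero compactM fC finvC fK finvK kappaP Lf Lfinv EsuT Esu0 EsD EuD
    C0 lam01 Hs Hu cL); by exists x.
have H := local_unstable_dim compactM fC finvC fK finvK kappaP Lf Lfinv EsuT Esu0 EsD EuD
  C0 lam01 Hs Hu ts0 uz.
have H0 : \forall rho \near (0 : R)^'+, 0 < rho by exact: nbhs_right_gt.
have [rho [rho0 Hrho]] := filter_ex (filterI H0 H).
(* Points of the unstable set are close to [x], while the dimension bound asks that they be close to
   each other; hence [beta] is chosen after [rho]. *)
apply: filterS (unstable_set_backclose g compactM finv rho0) => beta Hbeta.
apply: Hrho => [y []//|y z [Wy _] [Wz _]]; exact: (Hbeta x).
Qed.
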